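(* Consider the Galton-Watson process with immigration $\{N_n\}_{n\ge0}$ with offspring probability generating function $f$ and immigration probability generating function $g$. Assume $f(0)=g(0)=0$, $\mu:=f'(1)>1$, $g'(1)<\infty$ and $f''(1)<\infty$. Let $W,X,V$ and $W_{m,l},X_m,V_m$ be the almost sure limits defined in the context, so that for each $m\ge0$ the $W_{m,l}$ are copies of $W$, $(X_m,V_m)$ is a copy of $(X,V)$, and $N_m$, $W_{m,1},W_{m,2},\dots$, $(X_m,V_m)$ are mutually independent. Then: (i) for almost every family tree $\mathbb T$, for every $0\le m<\infty$, $$\lim_{n\to\infty}P(m\le X_{2,1}^n<\infty\mid\mathbb T)=\frac{\sum_{l=1}^{N_m}W_{m,l}^2+V_m}{\left(\sum_{l=1}^{N_m}W_{m,l}+X_m\right)^2};$$ (ii) for every $0\le m<\infty$, $$\lim_{n\to\infty}P(m\le X_{2,1}^n<\infty)=E\left(\frac{\sum_{l=1}^{N_m}W_{m,l}^2+V_m}{\left(\sum_{l=1}^{N_m}W_{m,l}+X_m\right)^2}\right),$$ and in particular $$\lim_{n\to\infty}P(X_{2,1}^n<\infty)=E\left(\frac{V}{X^2}\right)<1.$$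
   Context: Model. Let $M$ and $I$ be $\mathbb Z^+=\{0,1,2,\dots\}$-valued random variables with probability generating functions $f(z)=E(z^M)$ and $g(z)=E(z^I)$, $z\in[0,1]$. Let $I_n$ ($n\ge0$) be copies of $I$ and $\xi_{n,j}$ ($n\ge0$, $j\ge1$) be copies of $M$, all these variables being mutually independent. Set $N_0=0$ and $N_{n+1}=\sum_{j=1}^{N_n+I_n}\xi_{n,j}$ for $n\ge 0$ (empty sums are $0$). Interpretation: at generation $k$ there are $N_k$ individuals born in the system, and $I_k$ immigrants join them at generation $k$; each of these $N_k+I_k$ individuals independently produces children according to the law of $M$, and the children form the $N_{k+1}$ individuals born in generation $k+1$. Since $f(0)=g(0)=0$, $N_n\ge n$ for $n\ge1$. Let $\mathbb T$ denote the random family tree (genealogy) generated by this process. Coalescence time. For $n\ge2$, given $\mathbb T$, pick $2$ individuals uniformly at random without replacement from the $N_n$ individuals born in the $n$-th generation (the immigrants $I_n$ are not included) and trace their lines of descent back in time. $X_{2,1}^n$ is the index of the generation at which, going backward from generation $n$, the two lines first coalesce into one individual, i.e. the generation of their most recent common ancestor (an immigrant arriving at generation $k$ is regarded as living in generation $k$). If the two individuals have no common ancestor, $X_{2,1}^n=\infty$. Notation. For $m<n$: $N_{m,n}^{(l)}$ is the number of descendants in generation $n$ of the $l$-th of the $N_m$ individuals born in generation $m$; $\overline N_{m,n}^{(l)}$ is the number of descendants in generation $n$ of the $l$-th of the $I_m$ immigrants arriving at generation $m$. Limits. Almost surely the following limits exist and lie in $(0,\infty)$: $$W=\lim_{n\to\infty}\frac{\overline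 N_{0,n}^{(1)}}{\mu^n},\quad X=\lim_{n\to\infty}\frac1{\mu^n}\sum_{k=0}^{n-1}\sum_{l=1}^{I_k}\overline N_{k,n}^{(l)},\quad V=\lim_{n\to\infty}\frac1{\mu^{2n}}\sum_{k=0}^{n-1}\sum_{l=1}^{I_k}\left(\overline N_{k,n}^{(l)}\right)^2.$$ For $m\ge0$ put $$W_{m,l}=\lim_{n\to\infty}\frac{N_{m,n}^{(l)}}{\mu^{n-m}}\ (1\le l\le N_m),\quad X_m=\lim_{n\to\infty}\frac1{\mu^{n-m}}\sum_{k=m}^{n-1}\sum_{l=1}^{I_k}\overline N_{k,n}^{(l)},\quad V_m=\lim_{n\to\infty}\frac1{\mu^{2(n-m)}}\sum_{k=m}^{n-1}\sum_{l=1}^{I_k}\left(\overline N_{k,n}^{(l)}\right)^2,$$ where for $l>N_m$ the $W_{m,l}$ may be taken to be further independent copies of $W$ (they do not enter the formulas). *)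

(* Defs.v *)
From HB Require Import structures.
From mathcomp Require Import all_boot all_order all_algebra.
From mathcomp Require Import all_classical all_reals all_analysis.

Set Implicit Arguments.
Unset Strict Implicit.
Unset Printing Implicit Defensive.

Import Order.TTheory GRing.Theory Num.Theory.
Import numFieldNormedType.Exports.

Local Open Scope classical_set_scope.
Local Open Scope ring_scope.

Definition pgf (R : realType) (d : measure_display) (Omega : measurableType d)
    (P : probability Omega R) (Z : {RV P >-> nat}) (z : R) : R :=
  fine ('E_P[fun w => (z ^+ Z w)%R])%E.

(* The r-th derivative at 1 of a generating function, which is only meaningful
   on [0, 1]: the limit, possibly +oo, of the r-th derivative at z as z tends
   to 1 from the left. *)
Definition pgf_deriv1 (R : realType) (d : measure_display)
    (Omega : measurableType d) (P : probability Omega R)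
    (Z : {RV P >-> nat}) (r : nat) : \bar R :=
  lim ((derive1n r (pgf Z) z)%:E @[z --> 1^'-]).

(* [immigrants t n] individuals arrive at generation n and [children t n j] is
   the number of children of individual j of generation n.  In generation n the
   individuals are numbered from 0, first the [born t n] individuals born in
   the system and then the immigrants; only the values [children t n j] with
   [j < present t n] belong to the tree. *)
Record family_tree := FamilyTree {
  immigrants : nat -> nat;
  children : nat -> nat -> nat }.

Fixpoint born (t : family_tree) (n : nat) : nat :=
  if n is n'.+1 then
    (\sum_(j < born t n' + immigrants t n') children t n' j)%N
  else 0%N.

Definition present (t : family_tree) (n : nat) : nat :=
  (born t n + immigrants t n)%N.

(* The individuals born in generation n.+1 are numbered by increasing parent,
   so that the parent of c is the first j such that the individuals 0, ..., j
   of generation n have more than c children altogether. *)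
Definition parent (t : family_tree) (n c : nat) : nat :=
  find (fun j => c < \sum_(i < j.+1) children t n i)%N (iota 0 (present t n)).

(* The ancestor in generation k of individual c of generation n, every
   individual being its own ancestor in its own generation; [None] when there
   is none, because the line of c starts with an immigrant after generation k
   (or because [n < k]). *)
Fixpoint ancestor (t : family_tree) (n c k : nat) : option nat :=
  if n == k then Some c else
  if n is n'.+1 then
    if (c < born t n'.+1)%N then ancestor t n' (parent t n' c) k else None
  else None.

(* The number of individuals born in generation n that descend from individual
   l of generation m. *)
Definition descendants (t : family_tree) (m l n : nat) : nat :=
  #|[pred c : 'I_(born t n) | ancestor t n c m == Some l]|.

Definition imm_descendants (t : family_tree) (m l n : nat) : nat :=
  descendants t m (born t m + l) n.

Definition common_ancestor (t : family_tree) (n a b k : nat) : bool :=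
  (ancestor t n a k != None) && (ancestor t n a k == ancestor t n b k).

(* The generation of the most recent common ancestor of the individuals a and b
   of generation n, +oo when they have no common ancestor. *)
Definition coalescence (R : realType) (t : family_tree) (n a b : nat) : \bar R :=
  if [exists k : 'I_n.+1, common_ancestor t n a b k]
  then (\max_(k < n.+1 | common_ancestor t n a b k) k)%:R%:E
  else +oo%E.

(* Individuals l of generation m and immigrants l of generation k are numbered
   from 0.  The limits exist almost surely for the supercritical trees considered
   here; [limn] is unspecified on the remaining null set. *)

Definition W_ (R : realType) (mu : R) (t : family_tree) (m l : nat) : R :=
  limn (fun n => (descendants t m l n)%:R / mu ^+ (n - m)).

Definition X_ (R : realType) (mu : R) (t : family_tree) (m : nat) : R :=
  limn (fun n =>
    (\sum_(m <= k < n) \sum_(l < immigrants t k) (imm_descendants t k l n)%:R)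
    / mu ^+ (n - m)).

Definition V_ (R : realType) (mu : R) (t : family_tree) (m : nat) : R :=
  limn (fun n =>
    (\sum_(m <= k < n) \sum_(l < immigrants t k)
        (imm_descendants t k l n)%:R ^+ 2)
    / mu ^+ (2 * (n - m))).

Definition limit_ratio (R : realType) (mu : R) (t : family_tree) (m : nat) : R :=
  (\sum_(l < born t m) W_ mu t m l ^+ 2 + V_ mu t m)
  / (\sum_(l < born t m) W_ mu t m l + X_ mu t m) ^+ 2.

Definition same_law (R : realType) (d d' : measure_display)
    (Omega : measurableType d) (T : measurableType d')
    (P : probability Omega R) (X Y : {RV P >-> T}) : Prop :=
  forall B : set T, measurable B -> distribution P X B = distribution P Y B.

Definition mutually_independent (R : realType) (d d' : measure_display)
    (Omega : measurableType d) (T : measurableType d')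
    (P : probability Omega R) (K : eqType) (X : K -> {RV P >-> T}) : Prop :=
  forall (s : seq K) (B : K -> set T), uniq s ->
    (forall k, measurable (B k)) ->
    P (\bigcap_(k in [set` s]) (X k @^-1` B k)) =
    (\prod_(k <- s) P (X k @^-1` B k))%E.

(* [Y] is a version of the conditional probability of [E] given the
   sigma-algebra [G]. *)
Definition is_cond_prob (R : realType) (d : measure_display)
    (Omega : measurableType d) (P : probability Omega R)
    (G : set (set Omega)) (E : set Omega) (Y : Omega -> R) : Prop :=
  [/\ forall B : set R, measurable B -> G (Y @^-1` B),
      P.-integrable [set: Omega] (EFin \o Y) &
      forall A, G A -> (\int[P]_(w in A) (Y w)%:E)%E = P (E `&` A)].

Definition process_tree (R : realType) (d : measure_display)
    (Omega : measurableType d) (P : probability Omega R)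
    (imm : nat -> {RV P >-> nat}) (xi : nat -> nat -> {RV P >-> nat})
    (w : Omega) : family_tree :=
  FamilyTree (fun n => imm n w) (fun n j => xi n j w).

Definition all_variables (R : realType) (d : measure_display)
    (Omega : measurableType d) (P : probability Omega R)
    (imm : nat -> {RV P >-> nat}) (xi : nat -> nat -> {RV P >-> nat})
    (k : nat + nat * nat) : {RV P >-> nat} :=
  match k with inl n => imm n | inr (n, j) => xi n j end.

(* The sigma-algebra generated by a random tree: the numbers of immigrants and
   the numbers of children of the individuals actually present. *)
Definition tree_sigma (Omega : Type) (T : Omega -> family_tree) :
    set (set Omega) :=
  <<s [set A | (exists n k : nat, A = [set w | immigrants (T w) n = k]) \/
               (exists n j k : nat,
                  A = [set w | (j < present (T w) n)%N /\
                               children (T w) n j = k])] >>.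

(* For every n >= 2, given the tree, (a n, b n) is an ordered sample of size 2
   drawn uniformly without replacement from the individuals born in generation
   n. *)
Definition uniform_pairs (R : realType) (d : measure_display)
    (Omega : measurableType d) (P : probability Omega R)
    (T : Omega -> family_tree) (a b : nat -> {RV P >-> nat}) : Prop :=
  forall n i j : nat, (2 <= n)%N ->
    is_cond_prob P (tree_sigma T) [set w | a n w = i /\ b n w = j]
      (fun w => let N := born (T w) n in
         if [&& i != j, i < N & j < N]%N then ((N * N.-1)%:R)^-1 else 0).

(* Main.v *)
Require Import Defs.
From HB Require Import structures.
From mathcomp Require Import all_boot all_order all_algebra.
From mathcomp Require Import all_classical all_reals all_analysis.
From mathcomp Require Import measurable_realfun.
From mathcomp Require Import ring lra zify.
(** Fix a generation [m] and call founder of an individual its earliest ancestor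
    living in generation [m] or later. Two individuals have a common ancestor in
    generation [m] or later exactly when they have the same founder
    ([coalescence_founder]). Coalescence is thus an equivalence relation on
    generation [n], and given the tree the sampled pair coalesces with probability
    [(r - N) / (N * (N - 1))], where [N = born t n] and [r = related t m n] counts
    the ordered pairs with a common founder ([cond_prob_coalesced]). Sorting the
    individuals by founders writes [N] and [r] as the sums of the numbers of
    descendants and of their squares ([born_partition], [related_partition]). Hence
    everything follows from the almost sure convergence of [N / mu ^+ n], of the
    normalised numbers of descendants and of [r / mu ^+ (2 * n)], provided that the
    limit of the first is positive ([limit_ratioE], [pair_ratio_cvg]).

    The convergence comes from geometric bounds on the mean of the increments
    ([ae_cvg_increments]). For the number of individuals in a class closed under
    taking children, the deviation from [mu] times the previous size is a sum of
    uncorrelated centred variables, so it is of order the square root of the size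
    ([cvg_born_sel]). The number of related pairs is quadratic in the offspring
    numbers, whose fourth moments may be infinite, so its fluctuation must be
    bounded in mean and not in mean square. The relation being an equivalence, the
    form attached to it is positive, and this bounds the cross terms by diagonal ones
    ([related_fluctuation], [cvg_related]).

    For positivity, a class that grows slower than [mu ^+ n] is bounded by the sum of
    its own later noise ([extinction_noise]). The immigrants make the class of
    individuals descending from later generations tend to infinity, and noise is of
    smaller order than a large population; so slow growth has probability zero
    ([ae_later_pos]). The same bound shows that the line of the first immigrant
    does not almost surely grow slowly ([first_line_not_extinct]), since its mean is
    [mu ^+ n].

    Part (i) is then the uniqueness of conditional probabilities
    ([cond_prob_unique]), and part (ii) is bounded convergence. With positive
    probability the line of the first immigrant and the later lines both make up a
    positive proportion of the population; their members are unrelated, so the limit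
    ratio for [m = 0], where no individual has been born yet, is not almost surely one
    and has mean less than one ([related_limit_lt], [integral_limit_ratio_lt1]). *)

Import Order.TTheory GRing.Theory Num.Theory.
Import numFieldNormedType.Exports.
Local Open Scope classical_set_scope.
Local Open Scope ring_scope.

Set Implicit Arguments.
Unset Strict Implicit.
Unset Printing Implicit Defensive.

(** * Founders and coalescence in a family tree *)

Section Genealogy.
Variable t : family_tree.

(** Siblings are numbered consecutively, so a sum over a generation can be
    grouped by parents. *)
Lemma sum_parent (V : nmodType) (n : nat) (F : nat -> V) :
  \sum_(c < born t n.+1) F (parent t n c) =
  \sum_(j < present t n) F j *+ children t n j.
Proof.
rewrite /= -/(present t n) /parent.
elim: (present t n) => [|p IH]; first by rewrite !big_ord0.
rewrite [in RHS]big_ord_recr /= -IH big_ord_recr /=.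
set s := (\sum_(i < p) children t n i)%N.
have iotaS : iota 0 p.+1 = iota 0 p ++ [:: p] by rewrite -addn1 iotaD.
rewrite big_split_ord /=; congr (_ + _).
  apply: eq_bigr => c _; congr F.
  rewrite -[LHS]/(find (fun j => c < \sum_(i < j.+1) children t n i)%N (iota 0 p.+1)).
  rewrite iotaS find_cat ifT //.
  apply/hasP; case: (posnP p) => [p0|p_gt0].
    by case: c => c; rewrite /s p0 big_ord0.
  exists p.-1; first by rewrite mem_iota add0n prednK ?leqnn.
  by rewrite prednK.
rewrite (eq_bigr (fun=> F p)) ?sumr_const ?card_ord // => c _; congr F.
rewrite -[LHS]/(find (fun j => s + c < \sum_(i < j.+1) children t n i)%N (iota 0 p.+1)).
rewrite iotaS find_cat ifF; last first.
  apply/hasPn => j; rewrite mem_iota add0n -leqNgt => /andP[_ jp].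
  rewrite (leq_trans _ (leq_addr c s)) //.
  rewrite /s -!(big_mkord xpredT (fun i => children t n i)).
  by rewrite [leqRHS](big_cat_nat (n := j.+1)) //= leq_addr.
by rewrite size_iota /= big_ord_recr /= ltn_add2l ltn_ord addn0.
Qed.

Lemma parent_lt (n c : nat) : (c < born t n.+1)%N -> (parent t n c < present t n)%N.
Proof.
move=> lt_c; rewrite -[ltnRHS](size_iota 0) -has_find; apply/hasP.
have: (0 < present t n)%N.
  by move: lt_c; rewrite /= -/(present t n); case: present => //; rewrite big_ord0.
case E : (present t n) => [|p] // _; exists p; first by rewrite mem_iota add0n leqnn.
by move: lt_c; rewrite /= -/(present t n) E.
Qed.

Lemma ancestor_refl (n c : nat) : ancestor t n c n = Some c.
Proof. by case: n => [|n] //=; rewrite eqxx. Qed.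

Lemma ancestorS (n c k : nat) : (k <= n)%N -> (c < born t n.+1)%N ->
  ancestor t n.+1 c k = ancestor t n (parent t n c) k.
Proof.
move=> kn cb; rewrite [LHS]/= -/(born t n.+1) gtn_eqF ?ltnS //.
by move: cb => /= ->.
Qed.

Lemma ancestor_immigrant (n c k : nat) : (k < n)%N -> (born t n <= c)%N ->
  ancestor t n c k = None.
Proof.
case: n => [//|n] kn; rewrite leqNgt => /negbTE /= cb.
by rewrite gtn_eqF // cb.
Qed.

Lemma ancestor_lt (n c k l : nat) : ancestor t n c k = Some l ->
  (c < present t n)%N -> (l < present t k)%N.
Proof.
elim: n c => [|n IH] c; first by rewrite [ancestor _ _ _ _]/=; case: eqP => [<- [<-]|].
case: (eqVneq n.+1 k) => [<-|nk]; first by rewrite ancestor_refl => -[<-].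
rewrite /= -/(born t n.+1) (negbTE nk).
case: ifP => // cb /IH anc _; apply: anc; exact: parent_lt.
Qed.

(** The earliest ancestor of individual [c] of generation [n] that lives in
    generation [m] or later, as a pair (generation, number).  Individuals
    with the same founder are those with a common ancestor not older than
    generation [m], so founders turn coalescence into an equivalence relation. *)
Fixpoint founder (m n c : nat) : nat * nat :=
  if n == m then (m, c) else
  if n is n'.+1 then
    if (c < born t n'.+1)%N then founder m n' (parent t n' c) else (n, c)
  else (n, c).

Lemma founder_refl (m c : nat) : founder m m c = (m, c).
Proof. by case: m => [|m] //=; rewrite eqxx. Qed.

Lemma founderS (m n c : nat) : (m <= n)%N -> (c < born t n.+1)%N ->
  founder m n.+1 c = founder m n (parent t n c).
Proof.
move=> kn cb; rewrite [LHS]/= -/(born t n.+1) gtn_eqF ?ltnS //.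
by move: cb => /= ->.
Qed.

Lemma founder_immigrant (m n c : nat) : (born t n <= c)%N -> founder m n c = (n, c).
Proof.
case: n => [_|n]; first by rewrite /=; case: eqP => // ->.
rewrite leqNgt => /negbTE /= cb; case: eqP => [->//|_].
by rewrite cb.
Qed.

Lemma founder_ancestor (m n c k e : nat) : (m <= k <= n)%N ->
  ancestor t n c k = Some e -> founder m n c = founder m k e.
Proof.
elim: n c => [|n IH] c.
  by move=> /andP[mk]; rewrite leqn0 => /eqP k0; subst k; move=> [<-].
case: (eqVneq n.+1 k) => [<-|nk]; first by rewrite ancestor_refl => _ [<-].
move=> /andP[mk kn]; have {}kn : (k <= n)%N by rewrite -ltnS ltn_neqAle eq_sym nk.
case: (ltnP c (born t n.+1)) => cb; last by rewrite ancestor_immigrant.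
rewrite ancestorS // founderS ?(leq_trans mk) //.
by apply: IH; rewrite mk.
Qed.

Lemma founderP (m n c : nat) : (m <= n)%N ->
  [/\ (m <= (founder m n c).1 <= n)%N,
      ancestor t n c (founder m n c).1 = Some (founder m n c).2 &
      (founder m n c).1 = m \/ (born t (founder m n c).1 <= (founder m n c).2)%N].
Proof.
elim: n c => [|n IH] c mn.
  by move: mn; rewrite leqn0 => /eqP ->; split => //; left.
case: (eqVneq m n.+1) => [->|nm].
  by rewrite founder_refl /= leqnn eqxx; split => //; left.
have {}mn : (m <= n)%N by rewrite -ltnS ltn_neqAle nm.
case: (ltnP c (born t n.+1)) => cb.
  rewrite founderS //; case: (IH (parent t n c) mn) => /andP[-> kn] anc H.
  by rewrite (leqW kn); split => //; rewrite ancestorS.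
by rewrite founder_immigrant // leqnn leqW //= eqxx; split => //; right.
Qed.

(** A founder lives in generation [m] or is an immigrant of a later generation;
    conversely an individual of either kind founds all its descendants. *)
Lemma founder_eq (m n c k l : nat) : (m <= k <= n)%N ->
  k = m \/ (born t k <= l)%N ->
  (founder m n c == (k, l)) = (ancestor t n c k == Some l).
Proof.
move=> /[dup] mkn /andP[mk kn] kl; apply/eqP/eqP => [E|/(founder_ancestor mkn) ->].
  by have [_ + _] := founderP c (leq_trans mk kn); rewrite E.
by case: kl => [->|kl]; rewrite ?founder_refl ?founder_immigrant.
Qed.

Lemma common_ancestor_founder (m n a b : nat) : (m <= n)%N ->
  (exists2 k, (m <= k <= n)%N & common_ancestor t n a b k) <->
  founder m n a = founder m n b.
Proof.
move=> mn; split => [[k mkn /andP[]]|E].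
  case Ea : (ancestor t n a k) => [e|] // _ /eqP /esym Eb.
  by rewrite (founder_ancestor mkn Ea) (founder_ancestor mkn Eb).
have [mkn Ea _] := founderP a mn; have [_ Eb _] := founderP b mn.
exists (founder m n a).1 => //.
by rewrite /common_ancestor Ea E Eb eqxx.
Qed.

Lemma coalescence_founder (R : realType) (m n a b : nat) : (m <= n)%N ->
  (m%:R%:E <= coalescence R t n a b < +oo)%E =
  (founder m n a == founder m n b).
Proof.
move=> mn; rewrite /coalescence; case: ifPn => [/existsP[k0 k0P]|noc].
  rewrite ltry andbT lee_fin ler_nat.
  apply/idP/eqP => [|/(common_ancestor_founder _ _ mn)[k /andP[mk kn] kP]].
    case: (eq_bigmax_cond (fun k : 'I_n.+1 => k : nat)
        (A := [pred k : 'I_n.+1 | common_ancestor t n a b k])).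
      by rewrite (cardD1 k0) inE k0P.
    move=> k; rewrite inE => kP -> mk; apply/common_ancestor_founder => //.
    by exists k => //; rewrite mk -ltnS ltn_ord.
  apply: (leq_trans mk); rewrite -ltnS in kn.
  exact: (@leq_bigmax_cond _ _ (fun k : 'I_n.+1 => k : nat) (Ordinal kn)).
rewrite ltxx andbF; apply/esym/negbTE/eqP => /(common_ancestor_founder _ _ mn).
move=> [k /andP[_ kn] kP]; rewrite -ltnS in kn.
by move: noc; rewrite negb_exists => /forallP /(_ (Ordinal kn)) /=; rewrite kP.
Qed.

End Genealogy.

Section Counting.
Variables (R : realType) (t : family_tree).

Lemma descendantsE (m l n : nat) : (descendants t m l n)%:R =
  \sum_(c < born t n) (ancestor t n c m == Some l)%:R :> R.
Proof.
rewrite /descendants -sum1_card natr_sum big_mkcond /=.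
by apply: eq_bigr => c _; rewrite inE; case: eqP.
Qed.

(** Ordered pairs with a common founder. The diagonal is kept because it turns
    the count into a sum of squares over the founders, which is the numerator
    of the limit before normalisation. *)
Definition related (m n : nat) : R :=
  \sum_(c < born t n) \sum_(c' < born t n) (founder t m n c == founder t m n c')%:R.

Lemma relatedS (m n : nat) : (m <= n)%N -> related m n.+1 =
  \sum_(j < present t n) \sum_(j' < present t n)
    (founder t m n j == founder t m n j')%:R
    * (children t n j)%:R * (children t n j')%:R.
Proof.
move=> mn; pose F j j' : R := (founder t m n j == founder t m n j')%:R.
transitivity (\sum_(c < born t n.+1) \sum_(c' < born t n.+1)
    F (parent t n c) (parent t n c')).
  by apply: eq_bigr => c _; apply: eq_bigr => c' _; rewrite !founderS.
under eq_bigr do rewrite (sum_parent t n (F (parent t n _))).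
rewrite (sum_parent t n (fun j => \sum_(j' < present t n) F j j' *+ children t n j')).
apply: eq_bigr => j _; rewrite -sumrMnl; apply: eq_bigr => j' _.
by rewrite /F -[LHS]mulr_natr -[X in X * _]mulr_natr; ring.
Qed.

Lemma sum_pick (p x : nat) (G : nat -> R) :
  \sum_(l < p) (x == l)%:R * G l = (x < p)%:R * G x.
Proof.
case: ltnP => [xp|px].
  rewrite (bigD1 (Ordinal xp)) //= eqxx big1 ?addr0 // => i ix.
  by rewrite -val_eqE /= eq_sym in ix; rewrite (negbTE ix) mul0r.
rewrite big1 ?mul0r // => i _.
by rewrite gtn_eqF ?mul0r // (leq_trans (ltn_ord i)).
Qed.

Lemma sum_pick_nat (a b x : nat) (G : nat -> R) :
  \sum_(a <= k < b) (x == k)%:R * G k = (a <= x < b)%:R * G x.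
Proof.
case: (boolP (a <= x < b)%N) => xab.
  rewrite (bigD1_seq x) ?mem_index_iota ?iota_uniq //= eqxx big1 ?addr0 //.
  by move=> k kx; rewrite eq_sym (negbTE kx) mul0r.
rewrite big_nat_cond big1 ?mul0r // => k; rewrite andbT => kab.
by case: eqP => [xk|]; [rewrite -xk (negbTE xab) in kab|rewrite mul0r].
Qed.

(** An individual has exactly one founder among the individuals born in
    generation [m] and the immigrants of the generations from [m] on. *)
Lemma sum_founders (m n c : nat) (F : nat -> nat -> R) : (m <= n)%N -> (c < born t n)%N ->
  \sum_(l < born t m) (ancestor t n c m == Some (l : nat))%:R * F m l +
  \sum_(m <= k < n) \sum_(l < immigrants t k)
    (ancestor t n c k == Some (born t k + l)%N)%:R * F k (born t k + l)%N =
  F (founder t m n c).1 (founder t m n c).2.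
Proof.
move=> mn cb; have := @founderP t m n c mn; have := @founder_eq t m n c.
case: (founder t m n c) => k0 l0 /= fE [/andP[mk0 k0n] anc k0m].
have l0p : (l0 < present t k0)%N by apply: (ancestor_lt anc); rewrite ltn_addr.
have imm_lt k l : ((l < present t k) && (born t k <= l) = 
    (l - born t k < immigrants t k) && (born t k <= l))%N.
  by rewrite /present; apply/andP/andP => -[]; lia.
have -> : \sum_(l < born t m) (ancestor t n c m == Some (l : nat))%:R * F m l =
    (k0 == m)%:R * ((l0 < born t m)%:R * F m l0).
  rewrite -sum_pick mulr_sumr; apply: eq_bigr => l _.
  rewrite -fE ?leqnn ?mn //; last by left.
  by rewrite xpair_eqE -mulnb natrM mulrA.
have -> : \sum_(m <= k < n) \sum_(l < immigrants t k)
    (ancestor t n c k == Some (born t k + l)%N)%:R * F k (born t k + l)%N =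
  \sum_(m <= k < n) (k0 == k)%:R * ((born t k <= l0)%:R * F k l0).
  apply: eq_big_nat => k /andP[mk kn].
  transitivity ((k0 == k)%:R * ((born t k <= l0)%:R * 
     (\sum_(l < immigrants t k) (l0 - born t k == l)%N%:R * F k (born t k + l)%N))).
    rewrite !mulr_sumr; apply: eq_bigr => l _.
    rewrite -fE ?mk ?(ltnW kn) //; last by right; rewrite leq_addr.
    rewrite xpair_eqE; case: eqP => _; rewrite ?mul0r ?mul1r //=.
    case: leqP => l0k; rewrite ?mul0r ?mul1r.
      by congr ((nat_of_bool _)%:R * _); apply/eqP/eqP; lia.
    by rewrite (_ : (l0 == _) = false) ?mul0r //; apply/eqP; lia.
  rewrite (sum_pick _ _ (fun l => F k (born t k + l)%N)).
  case: eqP => [<-|]; rewrite ?mul0r ?mul1r //.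
  case: (leqP (born t k0) l0) => l0k; last by rewrite !mul0r.
  rewrite subnKC //.
  by have := imm_lt k0 l0; rewrite l0p l0k !andbT => <-; rewrite mul1r.
rewrite (sum_pick_nat _ _ _ (fun k => (born t k <= l0)%:R * F k l0)) mk0 /=.
case: (eqVneq k0 n) => [E|k0n'].
  (* If the founder is [c] itself then [n = m], since [c] is not an immigrant. *)
  move: anc; rewrite E ancestor_refl => -[cl0]; subst l0.
  have mn' : k0 = m by case: k0m => // ; rewrite E leqNgt cb.
  by rewrite -E ltnn mul0r addr0 -mn' eqxx E cb !mul1r.
have -> : (k0 < n)%N by rewrite ltn_neqAle k0n'.
case: (ltnP l0 (born t k0)) => l0k; last first.
  case: (eqVneq k0 m) => [E|]; rewrite ?mul0r ?mul1r ?add0r //.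
  by rewrite -E ltnNge l0k mul0r add0r.
have {}k0m : k0 = m by case: k0m => //; rewrite leqNgt l0k.
by rewrite -k0m eqxx l0k !mul1r mul0r addr0.
Qed.

Lemma born_partition (m n : nat) : (m <= n)%N -> (born t n)%:R =
  \sum_(l < born t m) (descendants t m l n)%:R +
  \sum_(m <= k < n) \sum_(l < immigrants t k) (imm_descendants t k l n)%:R :> R.
Proof.
move=> mn; transitivity (\sum_(c < born t n) (1 : R)).
  by rewrite sumr_const card_ord.
under eq_bigr => c _ do rewrite -(sum_founders (fun _ _ => 1) mn (ltn_ord c)).
rewrite big_split /= exchange_big /=; congr (_ + _).
  by apply: eq_bigr => l _; rewrite descendantsE; under eq_bigr do rewrite mulr1.
rewrite exchange_big /=; apply: eq_bigr => k _.
rewrite exchange_big /=; apply: eq_bigr => l _.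
by rewrite /imm_descendants descendantsE; under eq_bigr do rewrite mulr1.
Qed.

Lemma related_partition (m n : nat) : (m <= n)%N -> related m n =
  \sum_(l < born t m) (descendants t m l n)%:R ^+ 2 +
  \sum_(m <= k < n) \sum_(l < immigrants t k) (imm_descendants t k l n)%:R ^+ 2.
Proof.
move=> mn; pose G k l : R := \sum_(c < born t n) (founder t m n c == (k, l))%:R.
have GE k l : (m <= k <= n)%N -> k = m \/ (born t k <= l)%N ->
    G k l = (descendants t k l n)%:R.
  by move=> mkn kl; rewrite descendantsE; apply: eq_bigr => c _; rewrite founder_eq.
transitivity (\sum_(c < born t n) G (founder t m n c).1 (founder t m n c).2).
  apply: eq_bigr => c _; apply: eq_bigr => c' _.
  by rewrite -surjective_pairing eq_sym.
under eq_bigr => c _ do rewrite -(sum_founders G mn (ltn_ord c)).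
rewrite big_split /= exchange_big /=; congr (_ + _).
  apply: eq_bigr => l _; rewrite -mulr_suml GE ?leqnn ?mn //; last by left.
  by rewrite -descendantsE.
rewrite exchange_big /=; apply: eq_big_nat => k /andP[mk kn].
rewrite exchange_big /=; apply: eq_bigr => l _.
rewrite -mulr_suml GE ?mk ?(ltnW kn) //; last by right; rewrite leq_addr.
by rewrite -descendantsE.
Qed.

End Counting.

(** * The past of a tree *)

Section History.

(** The past up to generation [n] stops just before generation [n] reproduces,
    so that the offspring numbers of generation [n] are independent of it. *)
Definition agree (n : nat) (t t' : family_tree) : Prop :=
  (forall k, (k <= n)%N -> immigrants t k = immigrants t' k) /\
  (forall k j, (k < n)%N -> (j < present t k)%N -> children t k j = children t' k j).

(** The past is encoded as a natural number: conditioning on it then only means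
    cutting the probability space into countably many events. *)
Definition history (n : nat) (t : family_tree) : nat :=
  pickle (mkseq (immigrants t) n.+1,
          mkseq (fun k => mkseq (children t k) (present t k)) n).

Lemma agree_born (n k : nat) (t t' : family_tree) : agree n t t' -> (k <= n)%N ->
  born t k = born t' k /\ present t k = present t' k.
Proof.
move=> [ai ac]; elim: k => [|k IH] kn; first by rewrite /present /= ai.
have [_ pk] := IH (ltnW kn).
have bk : born t k.+1 = born t' k.+1.
  by rewrite /= -/(present t k) -/(present t' k) -pk; apply: eq_bigr => j _; rewrite ac.
by rewrite /present bk ai.
Qed.

Lemma agree_leq (m n : nat) (t t' : family_tree) : (m <= n)%N ->
  agree n t t' -> agree m t t'.
Proof.
move=> mn [ai ac]; split => [k km|k j km jp]; first by rewrite ai // (leq_trans km).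
by rewrite ac // (leq_trans km).
Qed.

Lemma historyP (n : nat) (t t' : family_tree) :
  history n t = history n t' <-> agree n t t'.
Proof.
split => [/(pcan_inj pickleK) E|att].
  have E1 : mkseq (immigrants t) n.+1 = mkseq (immigrants t') n.+1 := congr1 fst E.
  have E2 := congr1 snd E; rewrite /snd in E2.
  split => [k kn|k j kn jp].
    by have := congr1 (nth 0%N ^~ k) E1; rewrite !nth_mkseq.
  have := congr1 (nth [::] ^~ k) E2; rewrite !nth_mkseq // => E3.
  have /esym := congr1 size E3; rewrite !size_mkseq => pE.
  by have := congr1 (nth 0%N ^~ j) E3; rewrite !nth_mkseq // pE.
have [ai ac] := att; rewrite /history; congr (pickle (_, _)).
  by apply/eq_in_map => k; rewrite mem_iota add0n ltnS => /ai.
apply/eq_in_map => k; rewrite mem_iota add0n => /= kn.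
have [_ pE] := agree_born att (ltnW kn); rewrite -pE.
by apply/eq_in_map => j; rewrite mem_iota add0n => /ac ->.
Qed.

Lemma agree_parent (n k c : nat) (t t' : family_tree) : agree n t t' -> (k < n)%N ->
  parent t k c = parent t' k c.
Proof.
move=> att kn; rewrite /parent.
have [_ <-] := agree_born att (ltnW kn).
apply: eq_in_find => j; rewrite mem_iota add0n => jp; congr (_ < _)%N.
apply: eq_bigr => i _; case: att => _ -> //.
by rewrite (leq_trans (ltn_ord i)).
Qed.

Lemma agree_ancestor (n m c k : nat) (t t' : family_tree) : agree n t t' ->
  (m <= n)%N -> ancestor t m c k = ancestor t' m c k.
Proof.
move=> att; elim: m c => [//|m IH] c mn.
case: (eqVneq m.+1 k) => [<-|mk]; first by rewrite !ancestor_refl.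
rewrite /= -/(born t m.+1) -/(born t' m.+1) (negbTE mk).
have [<- _] := agree_born att mn; case: ifP => // cb.
by rewrite IH ?(ltnW mn) // (agree_parent _ att).
Qed.

Lemma agree_founder (n l m c : nat) (t t' : family_tree) : agree n t t' ->
  (m <= n)%N -> founder t l m c = founder t' l m c.
Proof.
move=> att; elim: m c => [//|m IH] c mn.
rewrite /= -/(born t m.+1) -/(born t' m.+1); case: eqP => // _.
have [<- _] := agree_born att mn; case: ifP => // cb.
by rewrite IH ?(ltnW mn) // (agree_parent _ att).
Qed.

End History.

(** * Generating functions and factorial moments *)

Section Moments.
Context (R : realType) (d : measure_display) (Omega : measurableType d).
Variables (P : probability Omega R) (Z : {RV P >-> nat}).

Lemma measurable_nat_fun (g : nat -> R) : measurable_fun [set: Omega] (fun w => g (Z w)).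
Proof. by apply: (measurableT_comp (f := g)). Qed.

Lemma emeasurable_nat_fun (g : nat -> R) :
  measurable_fun [set: Omega] (fun w => (g (Z w))%:E).
Proof. by apply/measurable_EFinP; exact: measurable_nat_fun. Qed.

(** This is one term of the binomial expansion of [1 = (x + (1 - x)) ^+ n]. *)
Lemma ffact_pow_bound (n r : nat) (x : R) : 0 <= x < 1 ->
  (n ^_ r)%:R * x ^+ (n - r) <= r`!%:R / (1 - x) ^+ r.
Proof.
move=> /andP[x0 x1]; have y0 : 0 < 1 - x by rewrite subr_gt0.
rewrite ler_pdivlMr ?exprn_gt0 // -bin_ffact natrM.
case: (leqP r n) => rn; last by rewrite bin_small // !mul0r.
have: ((x + (1 - x)) ^+ n : R) = 1 by rewrite addrC subrK expr1n.
rewrite exprDn; have rn' : (r < n.+1)%N by [].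
rewrite (bigD1 (Ordinal rn')) //= => /eqP; rewrite eq_sym => /eqP E.
have : x ^+ (n - r) * (1 - x) ^+ r *+ 'C(n, r) <= 1.
  rewrite [leRHS]E lerDl; apply: sumr_ge0 => i _.
  by rewrite mulrn_wge0 // mulr_ge0 // exprn_ge0 // ltW.
rewrite -mulr_natr => le1.
have := ler_wpM2l (ler0n R r`!) le1; rewrite mulr1; apply: le_trans.
by rewrite le_eqVlt; apply/orP; left; apply/eqP; ring.
Qed.

Definition factorial_pgf (r : nat) (z : R) : R :=
  \int[P]_w ((Z w ^_ r)%:R * z ^+ (Z w - r)).

Lemma integrable_factorial_pgf (r : nat) (x : R) : 0 <= x < 1 ->
  P.-integrable [set: Omega] (EFin \o (fun w => (Z w ^_ r)%:R * x ^+ (Z w - r))).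
Proof.
move=> x01; apply: measurable_bounded_integrable => //.
- by rewrite (le_lt_trans (probability_le1 P measurableT)) ?ltry.
- exact: (measurable_nat_fun (fun k => (k ^_ r)%:R * x ^+ (k - r))).
- exists (r`!%:R / (1 - x) ^+ r); split; first by rewrite num_real.
  move=> y ltxy w _ /=; rewrite ger0_norm; last first.
    by rewrite mulr_ge0 // exprn_ge0 //; case/andP: x01.
  exact: le_trans (ffact_pow_bound _ _ x01) (ltW ltxy).
Qed.

Lemma derive1_factorial_pow (r k : nat) (x : R) :
  is_derive x 1 (fun x => (k ^_ r)%:R * x ^+ (k - r)) ((k ^_ r.+1)%:R * x ^+ (k - r.+1)).
Proof.
pose p := fun y : R => y ^+ (k - r).
have p' : is_derive x (1 : R) p ((k - r)%:R * x ^+ (k - r).-1).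
  have := @is_deriveX R R id (k - r) x 1 1 (is_derive_id x 1).
  by rewrite exprfctE => H; apply: (is_derive_eq H); rewrite [LHS]mulr1.
have H := is_deriveZ (k ^_ r)%:R p'; apply: (is_derive_eq H).
by rewrite [LHS]mulrA -natrM -ffactnSr subnS.
Qed.

Lemma derive1_factorial_pgf (r : nat) (x : R) : 0 < x < 1 ->
  derive1 (factorial_pgf r) x = factorial_pgf r.+1 x.
Proof.
move=> /andP[x0 x1]; pose v := (x + 1) / 2.
have [xv v1] : x < v /\ v < 1 by rewrite /v; split; lra.
have v01 : 0 <= v < 1 by rewrite v1 (le_trans (ltW x0)) // ltW.
rewrite (@differentiation_under_integral _ _ _ P
  (fun x w => (Z w ^_ r)%:R * x ^+ (Z w - r)) setT measurableT x 0 v _ _ _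
  (fun=> r.+1`!%:R / (1 - v) ^+ r.+1)).
- apply: eq_Rintegral => w _; rewrite partial1of2E.
  by have -> := @derive_val _ _ _ _ _ _ _ (derive1_factorial_pow r (Z w) x).
- by rewrite /= in_itv /= x0.
- move=> y; rewrite /= in_itv /= => /andP[y0 yv]; apply: integrable_factorial_pgf.
  by rewrite (ltW y0) (lt_trans yv).
- by move=> y w _ _; have [] := derive1_factorial_pow r (Z w) y.
- by move=> w; rewrite divr_ge0 // exprn_ge0 // subr_ge0 ltW.
- by apply: finite_measure_integrable_cst.
- move=> y w; rewrite /= in_itv /= => /andP[y0 yv] _.
  rewrite partial1of2E.
  have -> := @derive_val _ _ _ _ _ _ _ (derive1_factorial_pow r (Z w) y).
  rewrite ger0_norm; last by rewrite mulr_ge0 // exprn_ge0 // ltW.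
  apply: le_trans (ffact_pow_bound (Z w) r.+1 v01).
  by rewrite ler_wpM2l // lerXn2r // ?nnegrE ltW // (lt_trans y0).
Qed.

Lemma derive1n_pgf (r : nat) (x : R) : 0 < x < 1 ->
  derive1n r (pgf Z) x = factorial_pgf r x.
Proof.
elim: r x => [|r IH] x /andP[x0 x1].
  rewrite derive1n0 /pgf /factorial_pgf /Rintegral unlock; congr fine.
  by apply: eq_integral => w _; rewrite subn0 mul1r.
rewrite derive1nS -derive1_factorial_pgf ?x0 // !derive1E.
apply: near_eq_derive.
have : x \in `]0, 1[ by rewrite in_itv /= x0.
by move=> /near_in_itvoo; apply: filterS => y; rewrite in_itv /= => /IH.
Qed.

(** Inside [0 < z < 1] the generating function can be differentiated under the
    expectation, and the derivatives are monotone in [z]; monotone convergence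
    then identifies the limit at 1, finite or not. *)
Lemma pgf_deriv1E (r : nat) :
  pgf_deriv1 Z r = (\int[P]_w (Z w ^_ r)%:R%:E)%E.
Proof.
apply: cvg_lim => //; apply/cvg_at_leftNP.
(* After a reflection, the left limit at 1 is a monotone right limit at -1. *)
pose G (x : R) : \bar R := (\int[P]_w ((Z w ^_ r)%:R * (- x) ^+ (Z w - r))%:E)%E.
have GE : {in `](-1), 0[, G =1 (fun x => (derive1n r (pgf Z) (- x))%:E)}.
  move=> x; rewrite in_itv /= => /andP[x1 x0].
  have x01 : 0 < - x < 1 by lra.
  rewrite derive1n_pgf // fineK //; apply: integrable_fin_num => //.
  by apply: integrable_factorial_pgf; lra.
have mono : {in `](-1 : R), 0[ &, nonincreasing_fun G}.
  move=> x y; rewrite !in_itv /= => /andP[x1 x0] /andP[y1 y0] xy.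
  apply: ge0_le_integral => //.
  - by move=> w _; rewrite lee_fin mulr_ge0 // exprn_ge0 //; lra.
  - exact: (emeasurable_nat_fun (fun k => ((k ^_ r)%:R * (- y) ^+ (k - r)))).
  - exact: (emeasurable_nat_fun (fun k => ((k ^_ r)%:R * (- x) ^+ (k - r)))).
  - by move=> w _; rewrite lee_fin ler_wpM2l // lerXn2r // ?nnegrE; lra.
have ab : (BRight (-1 : R) < BLeft 0)%O by rewrite bnd_simp ltrN10.
have cvG := nonincreasing_at_right_cvge _ ab mono; clear ab.
suff <- : ereal_sup (G @` [set` `](-1 : R), 0[]) = (\int[P]_w (Z w ^_ r)%:R%:E)%E.
  apply: cvg_trans cvG; apply: near_eq_cvg; near=> x.
  by rewrite GE // in_itv /=; apply/andP; split.
apply/eqP; rewrite eq_le; apply/andP; split.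
  apply: ge_ereal_sup => _ [x /= + <-]; rewrite in_itv /= => /andP[x1 x0].
  apply: ge0_le_integral => //.
  - by move=> w _; rewrite lee_fin mulr_ge0 // exprn_ge0 //; lra.
  - exact: (emeasurable_nat_fun (fun k => ((k ^_ r)%:R * (- x) ^+ (k - r)))).
  - exact: (emeasurable_nat_fun (fun k => (k ^_ r)%:R)).
  - by move=> w _; rewrite lee_fin ler_piMr // exprn_ile1; lra.
pose z n : R := 1 - harmonic n / 2.
have h01 n : 0 < @harmonic R n / 2 < 1.
  have h1 : @harmonic R n <= 1 by rewrite /harmonic invf_le1 ?ltr0n // ler1n.
  have h0 : 0 < @harmonic R n := harmonic_gt0 n; lra.
have z01 n : 0 < z n < 1 by have := h01 n; rewrite /z; lra.
have z_le n m : (n <= m)%N -> z n <= z m.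
  move=> nm; rewrite /z lerB // ler_wpM2r // /harmonic lef_pV2 ?posrE ?ltr0n //.
  by rewrite ler_nat ltnS.
have pow_le k n m : (n <= m)%N -> z n ^+ k <= z m ^+ k.
  move=> nm; have := (z_le _ _ nm, z01 n, z01 m) => -[[? ?] ?].
  by rewrite lerXn2r // nnegrE; lra.
pose g n w : \bar R := ((Z w ^_ r)%:R * z n ^+ (Z w - r))%:E.
have zc : z n @[n --> \oo] --> (1 : R).
  rewrite -[X in _ --> X]subr0; apply: cvgB; first exact: cvg_cst.
  by rewrite -[X in _ --> X](mul0r 2^-1); apply: cvgMl; exact: cvg_harmonic.
have gc w : g n w @[n --> \oo] --> ((Z w ^_ r)%:R : R)%:E.
  apply: cvg_EFin; first exact: nearW.
  rewrite /= -[X in _ --> X]mulr1; apply: cvgMr.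
  rewrite -[X in _ --> X](expr1n R (Z w - r)).
  exact: (continuous_cvg _ (@exprn_continuous R (Z w - r) 1) zc).
have -> : (\int[P]_w (Z w ^_ r)%:R%:E = \int[P]_w limn (g ^~ w))%E.
  by apply: eq_integral => w _; apply/esym/cvg_lim => //; exact: gc.
rewrite monotone_convergence //.
- apply: lime_le; last first.
    apply: nearW => n; apply: ereal_sup_ubound; exists (- z n).
      by rewrite /= in_itv /=; have := z01 n; lra.
    by rewrite /G opprK.
  apply: ereal_nondecreasing_is_cvgn => n m nm; apply: ge0_le_integral => //.
  - by move=> w _; rewrite lee_fin mulr_ge0 // exprn_ge0 //; have := z01 n; lra.
  - exact: (emeasurable_nat_fun (fun k => ((k ^_ r)%:R * z n ^+ (k - r)))).
  - exact: (emeasurable_nat_fun (fun k => ((k ^_ r)%:R * z m ^+ (k - r)))).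
  - by move=> w _; rewrite lee_fin ler_wpM2l // pow_le.
- by move=> n; exact: (emeasurable_nat_fun (fun k => ((k ^_ r)%:R * z n ^+ (k - r)))).
- by move=> n w _; rewrite lee_fin mulr_ge0 // exprn_ge0 //; have := z01 n; lra.
- by move=> w _ n m nm; rewrite lee_fin ler_wpM2l // pow_le.
Unshelve. all: end_near. Qed.

Lemma pgf0_eq0 : pgf Z 0 = 0 -> P [set w | Z w = 0%N] = 0.
Proof.
rewrite /pgf unlock => H.
rewrite -(setIT [set w | Z w = 0%N]) -integral_indic //; last first.
  exact: (@measurable_funPTI _ _ _ _ Z [set 0%N]).
rewrite -[RHS]/(0%:E) -[in RHS]H fineK.
  apply: eq_integral => w _; congr EFin; rewrite indicE /=.
  case: (eqVneq (Z w) 0%N) => E; first by rewrite mem_set //= E.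
  by rewrite memNset ?expr0n ?(negbTE E) //; exact/eqP.
have := @integrable_factorial_pgf 0 0; rewrite lexx ltr01 => /(_ erefl).
move=> /(integrable_fin_num measurableT).
by under eq_integral do rewrite /= subn0 mul1r.
Qed.

End Moments.

(** * Discrete conditioning and almost sure convergence *)

Section IntegralTools.
Context (R : realType) (d : measure_display) (Omega : measurableType d).
Variable P : probability Omega R.

Lemma measurable_EFin_fun (D : set Omega) (f : Omega -> R) :
  measurable_fun D f -> measurable_fun D (fun w => (f w)%:E).
Proof. by move=> mf; apply/measurable_EFinP. Qed.

Lemma integral_fibers (D : set Omega) (H : Omega -> nat) (F : Omega -> \bar R) :
  measurable D -> measurable_fun [set: Omega] H ->
  measurable_fun D F -> (forall w, D w -> (0 <= F w)%E) ->
  (\int[P]_(w in D) F w = \sum_(i <oo) \int[P]_(w in D `&` H @^-1` [set i]) F w)%E.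
Proof.
move=> mD mH mF F0.
have DE : D = \bigcup_i (D `&` H @^-1` [set i]).
  by apply/seteqP; split => [w Dw|w [i _ []] //]; exists (H w).
rewrite {1}DE ge0_integral_bigcup -?DE // => [i|].
  by apply: measurableI => //; rewrite -[X in measurable X]setTI; exact: mH.
by apply/trivIsetP => i j _ _ ij; apply/seteqP; split => // w [[_ /= Hi] [_ /= Hj]]; rewrite -Hi Hj eqxx in ij.
Qed.

(** This replaces conditional expectations given a discrete variable: the fibres
    of the variable form a countable partition, and integrals add up over it. *)
Lemma eq_integral_fibers (H : Omega -> nat) (F G : Omega -> \bar R) :
  measurable_fun [set: Omega] H ->
  measurable_fun [set: Omega] F -> (forall w, (0 <= F w)%E) ->
  measurable_fun [set: Omega] G -> (forall w, (0 <= G w)%E) ->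
  (forall w, \int[P]_(v in H @^-1` [set H w]) F v =
             \int[P]_(v in H @^-1` [set H w]) G v)%E ->
  (\int[P]_w F w = \int[P]_w G w)%E.
Proof.
move=> mH mF F0 mG G0 FG; rewrite (integral_fibers _ mH) // (@integral_fibers _ H G) //.
apply: eq_eseriesr => i _; rewrite !setTI.
case: (pselect (exists w, H w = i)) => [[w <-] //|noi].
rewrite (_ : H @^-1` [set i] = set0) ?integral_set0 //.
by apply/seteqP; split => // w wi; case: noi; exists w.
Qed.

Lemma measurable_fibers (d' : measure_display) (T : measurableType d')
    (H : Omega -> nat) (F : nat -> Omega -> T) :
  measurable_fun [set: Omega] H ->
  (forall i, measurable_fun [set: Omega] (F i)) ->
  measurable_fun [set: Omega] (fun w => F (H w) w).
Proof.
move=> mH mF _ B mB; rewrite setTI.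
have -> : (fun w => F (H w) w) @^-1` B = \bigcup_i (H @^-1` [set i] `&` F i @^-1` B).
  by apply/seteqP; split => [w Fw|w [i _ [/= <-]] //]; exists (H w).
apply: bigcupT_measurable => i; apply: measurableI.
  by rewrite -[X in measurable X]setTI; exact: mH.
by rewrite -[X in measurable X]setTI; exact: mF.
Qed.

Section Noise.
Variables (D : nat -> Omega -> R) (C q : R).
Hypotheses (mD : forall n, measurable_fun [set: Omega] (D n)) (D0 : forall n w, 0 <= D n w).
Hypotheses (q01 : 0 < q < 1).
Hypothesis intD : forall n, (\int[P]_w (D n w)%:E <= (C * q ^+ n)%:E)%E.

Lemma geometric_bound_ge0 : 0 <= C.
Proof.
have := intD 0; rewrite expr0 mulr1 => H; rewrite -lee_fin; apply: le_trans H.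
by apply: integral_ge0 => w _; rewrite lee_fin.
Qed.

Lemma integral_noise_le : (\int[P]_w \sum_(n <oo) (D n w)%:E <= (C / (1 - q))%:E)%E.
Proof.
rewrite integral_nneseries //; last first.
- by move=> n w _; rewrite lee_fin.
- by move=> n; exact: measurable_EFin_fun.
apply: lime_le; first by apply: is_cvg_nneseries => n _ _; apply: integral_ge0 => w _; rewrite lee_fin.
apply: nearW => n; apply: (@le_trans _ _ (\sum_(0 <= k < n) (C * q ^+ k)%:E)%E).
  by apply: lee_sum => k _.
rewrite sumEFin lee_fin; case/andP: q01 => q0 q1.
have q1' : `|q| < 1 by rewrite ger0_norm // ltW.
exact: (geometric_le_lim n geometric_bound_ge0 q0 q1').
Qed.

Lemma noise_summable : {ae P, forall w, cvgn (series (D ^~ w))}.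
Proof.
have mS : measurable_fun [set: Omega] (fun w => (\sum_(n <oo) (D n w)%:E)%E).
  apply: ge0_emeasurable_sum => k *; last exact: measurable_EFin_fun.
  by rewrite lee_fin.
have : P.-integrable [set: Omega] (fun w => (\sum_(n <oo) (D n w)%:E)%E).
  apply/integrableP; split => //.
  rewrite (eq_integral (fun w => (\sum_(n <oo) (D n w)%:E)%E)); last first.
    by move=> w _; rewrite gee0_abs // nneseries_ge0 // => *; rewrite lee_fin.
  exact: (le_lt_trans integral_noise_le (ltry _)).
move=> /(integrable_ae measurableT); apply: filterS => w /(_ I) fS.
apply: nondecreasing_is_cvgn.
  by apply: nondecreasing_series => k _ _.
exists (fine (\sum_(n <oo) (D n w)%:E)%E) => _ [n _ <-].
rewrite -lee_fin fineK // /series /= -sumEFin.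
by apply: nneseries_lim_ge => *; rewrite lee_fin.
Qed.

End Noise.

(** Increments that decay geometrically in mean are almost surely absolutely
    summable, since the sum of their absolute values has a finite mean. *)
Lemma ae_cvg_increments (u : nat -> Omega -> R) (m : nat) (C q : R) :
  (forall n, measurable_fun [set: Omega] (u n)) -> 0 < q < 1 ->
  (forall n, (m <= n)%N ->
     (\int[P]_w (`|u n.+1 w - u n w|)%:E <= (C * q ^+ n)%:E)%E) ->
  {ae P, forall w, cvgn (u ^~ w)}.
Proof.
move=> mu q01 intu.
have mD n : measurable_fun [set: Omega] (fun w => `|u (n + m).+1 w - u (n + m)%N w|).
  by apply: measurableT_comp => //; exact: measurable_funB.
have intD n : (\int[P]_w (`|u (n + m).+1 w - u (n + m)%N w|)%:E
    <= (C * q ^+ m * q ^+ n)%:E)%E.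
  by rewrite -mulrA -exprD (addnC m) intu ?leq_addl.
have := @noise_summable _ _ _ mD (fun n w => normr_ge0 _) q01 intD.
apply: filterS => w cw.
suff /cvg_ex[l] : cvgn (fun n => u (n + m)%N w).
  by rewrite /= (cvg_shiftn m (u ^~ w)) => ul; apply/cvg_ex; exists l.
suff : cvgn (series (telescope (fun n => u (n + m)%N w))).
  rewrite telescopeK => H.
  have -> : (fun n => u (n + m)%N w) =
      [sequence u (n + m)%N w - u (0 + m)%N w]_n + cst (u m w).
    by apply/funext => n /=; rewrite fctE /= subrK.
  by apply: is_cvgD => //; exact: is_cvg_cst.
exact: normed_cvg.
Qed.

(** Where the sequence diverges [limn] is a fixed default value, so it suffices
    that the set of convergence is measurable; there the limit is the upper
    limit. *)
Lemma measurable_limn (u : nat -> Omega -> R) :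
  (forall n, measurable_fun [set: Omega] (u n)) ->
  measurable_fun [set: Omega] (fun w => limn (u ^~ w)).
Proof.
move=> mu.
pose S w := limn_esup (fun n => (u n w)%:E).
pose I w := limn_einf (fun n => (u n w)%:E).
have mS : measurable_fun [set: Omega] S.
  by apply: measurable_fun_limn_esup => n; exact/measurable_EFinP.
have mI : measurable_fun [set: Omega] I.
  rewrite /I; under eq_fun do rewrite -[limn_einf _]oppeK -limn_esupN.
  apply: measurableT_comp => //; apply: measurable_fun_limn_esup => n /=.
  by apply: measurable_EFin_fun; exact: measurableT_comp.
have cvgE w : cvgn (u ^~ w) <-> (S w \is a fin_num) /\ S w = I w.
  split => [/cvg_ex[l /= ul]|[fS SI]].
    have ul' : (u n w)%:E @[n --> \oo] --> l%:E by apply: cvg_EFin => //; exact: nearW.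
    by rewrite /S /I !(cvg_limn_einf_sup ul').
  apply/cvg_ex; exists (fine (S w)).
  have ul : (u n w)%:E @[n --> \oo] --> (fine (S w))%:E.
    rewrite fineK //; apply: (@squeeze_cvge _ _ _ _
      (fun n => einfs (fun n => (u n w)%:E) n) _ (fun n => esups (fun n => (u n w)%:E) n)).
    - apply: nearW => n; apply/andP; split.
        by apply: ereal_inf_lbound; exists n => //=.
      by apply: ereal_sup_ubound; exists n => //=.
    - by rewrite SI /I limn_einf_lim; exact: is_cvg_einfs.
    - by rewrite /S limn_esup_lim; exact: is_cvg_esups.
  by have /fine_cvgP[_] := ul.
pose B := [set w | S w \is a fin_num] `&` [set w | S w = I w].
have mB : measurable B.
  apply: measurableI; rewrite -[X in measurable X]setTI.
    exact: emeasurable_fin_num.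
  exact: measurable_eqe.
have -> : (fun w => limn (u ^~ w)) = (fun w => if w \in B then fine (S w) else point).
  apply/funext => w; case: ifPn => [/set_mem[fS SI]|/negP wB].
    have [_ /(_ (conj fS SI)) cw] := cvgE w.
    have ul : (u n w)%:E @[n --> \oo] --> (limn (u ^~ w))%:E by apply: cvg_EFin => //; exact: nearW.
    by rewrite /S (cvg_limn_einf_sup ul).
  by apply: dvgP => /cvgE [fS SI]; apply: wB; apply/mem_set.
apply: measurable_fun_ifT => //.
  apply: (measurable_fun_bool true); rewrite setTI [X in measurable X](_ : _ = B) //.
  by apply/seteqP; split => [w /set_mem|w ?] //; apply/mem_set.
exact: measurableT_comp.
Qed.
End IntegralTools.

(** * Means over an event *)

Section MeanOn.
Context (R : realType) (d : measure_display) (Omega : measurableType d).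
Variable P : probability Omega R.

(** Integrability is carried along with the value, so that polynomials in signed
    variables, such as centred offspring numbers, are integrated term by term. *)
Definition mean_on (D : set Omega) (f : Omega -> R) (v : R) : Prop :=
  P.-integrable D (EFin \o f) /\ (\int[P]_(w in D) (f w)%:E = v%:E)%E.

Variable D : set Omega.
Hypothesis mD : measurable D.

Lemma mean_on_cst (c : R) : mean_on D (cst c) (c * fine (P D)).
Proof.
split; first exact: finite_measure_integrable_cst.
by rewrite (integral_cst P mD c%:E) EFinM fineK // fin_num_measure.
Qed.

Lemma mean_onD (f g : Omega -> R) (v u : R) :
  mean_on D f v -> mean_on D g u -> mean_on D (fun w => f w + g w) (v + u).
Proof.
move=> [fi fv] [gi gu]; split.
  by rewrite (_ : EFin \o _ = (EFin \o f) \+ (EFin \o g))%E //; exact: integrableD.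
under eq_integral do rewrite EFinD.
by rewrite (integralD mD fi gi) fv gu EFinD.
Qed.

Lemma mean_onZ (c : R) (f : Omega -> R) (v : R) :
  mean_on D f v -> mean_on D (fun w => c * f w) (c * v).
Proof.
move=> [fi fv]; split.
  by rewrite (_ : EFin \o _ = (fun w => c%:E * (EFin \o f) w))%E //; exact: integrableZl.
under eq_integral do rewrite EFinM.
by rewrite (integralZl mD fi) fv EFinM.
Qed.

Lemma mean_on_sum (I : Type) (s : seq I) (f : I -> Omega -> R) (v : I -> R) :
  (forall i, mean_on D (f i) (v i)) ->
  mean_on D (fun w => \sum_(i <- s) f i w) (\sum_(i <- s) v i).
Proof.
move=> fv; elim: s => [|i s IH].
  rewrite big_nil; under eq_fun do rewrite big_nil.
  by have := mean_on_cst 0; rewrite mul0r.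
by rewrite big_cons; under eq_fun do rewrite big_cons; exact: mean_onD.
Qed.

Lemma eq_mean_on (f g : Omega -> R) (v : R) :
  (forall w, D w -> f w = g w) -> mean_on D f v -> mean_on D g v.
Proof.
move=> fg [fi fv]; split.
  by apply: eq_integrable fi => // w /set_mem Dw /=; rewrite fg.
by rewrite -fv; apply: eq_integral => w /set_mem Dw; rewrite fg.
Qed.

End MeanOn.

Section IndependentMoments.
Context (R : realType) (d : measure_display) (Omega : measurableType d).
Variables (P : probability Omega R) (M : {RV P >-> nat}).

(** For variables with values in [nat] it is enough to test independence of the
    event [D] and equality of laws on singletons. *)
Definition indep_copy (D : set Omega) (Z : {RV P >-> nat}) : Prop :=
  forall c : nat, P (D `&` Z @^-1` [set c]) = (P D * P (M @^-1` [set c]))%E.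

Lemma measurable_RV_fiber (Z : {RV P >-> nat}) (c : nat) : measurable (Z @^-1` [set c]).
Proof. exact: measurable_funPTI. Qed.

Lemma integral_indep_copy (D : set Omega) (Z : {RV P >-> nat}) (g : nat -> R) :
  measurable D -> indep_copy D Z -> (forall k, 0 <= g k) ->
  (\int[P]_(w in D) (g (Z w))%:E = P D * \int[P]_w (g (M w))%:E)%E.
Proof.
move=> mD DZ g0.
have fiber (A : set Omega) (Y : {RV P >-> nat}) c : measurable A ->
    (\int[P]_(w in A `&` Y @^-1` [set c]) (g (Y w))%:E =
     (g c)%:E * P (A `&` Y @^-1` [set c]))%E.
  move=> mA; rewrite -integral_cst; last first.
    by apply: measurableI => //; exact: measurable_RV_fiber.
  by apply: eq_integral => w /set_mem[_ /= ->].
rewrite (@integral_fibers _ _ _ P D Z) //; last 2 first.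
- by apply: measurable_funTS; exact: emeasurable_nat_fun.
- by move=> w _; rewrite lee_fin.
rewrite (@integral_fibers _ _ _ P setT M) //; last 2 first.
- exact: emeasurable_nat_fun.
- by move=> w _; rewrite lee_fin.
rewrite -[P D]fineK ?fin_num_measure // -nneseriesZl; last first.
  by move=> i _; apply: integral_ge0 => w _; rewrite lee_fin.
by apply: eq_eseriesr => c _; rewrite !fiber // DZ setTI muleCA fineK // fin_num_measure.
Qed.

Variables (mu s2 : R).
Hypothesis M1 : (\int[P]_w (M w)%:R%:E = mu%:E)%E.
Hypothesis M2 : (\int[P]_w ((M w)%:R ^+ 2)%:E = (s2 + mu ^+ 2)%:E)%E.

Lemma mean_on_ge0 (D : set Omega) (f : Omega -> R) (v : R) :
  measurable D -> measurable_fun D f -> (forall w, 0 <= f w) ->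
  (\int[P]_(w in D) (f w)%:E = v%:E)%E -> mean_on P D f v.
Proof.
move=> mD mf f0 fv; split => //; apply/integrableP; split.
  exact: measurable_EFin_fun.
rewrite (eq_integral (fun w => (f w)%:E)) ?fv ?ltry // => w _ /=.
by rewrite ger0_norm.
Qed.

Lemma mean_indep1 (D : set Omega) (Z : {RV P >-> nat}) :
  measurable D -> indep_copy D Z ->
  mean_on P D (fun w => (Z w)%:R) (mu * fine (P D)).
Proof.
move=> mD DZ; apply: mean_on_ge0 => //.
  by apply: measurable_funTS; exact: (@measurable_nat_fun R d Omega P _ (fun k => k%:R)).
rewrite (integral_indep_copy (g := fun k => k%:R) mD DZ) // M1.
by rewrite EFinM muleC fineK // fin_num_measure.
Qed.

Lemma mean_indep_sqr (D : set Omega) (Z : {RV P >-> nat}) :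
  measurable D -> indep_copy D Z ->
  mean_on P D (fun w => (Z w)%:R * (Z w)%:R) ((s2 + mu ^+ 2) * fine (P D)).
Proof.
move=> mD DZ; apply: mean_on_ge0 => //.
  by apply: measurable_funTS; exact: (@measurable_nat_fun R d Omega P _ (fun k => k%:R * k%:R)).
rewrite (integral_indep_copy (g := fun k => k%:R * k%:R) mD DZ) //.
under eq_integral do rewrite -expr2.
by rewrite M2 EFinM muleC fineK // fin_num_measure.
Qed.

Lemma mean_indep_prod (D : set Omega) (Z Z' : {RV P >-> nat}) :
  measurable D -> indep_copy D Z ->
  (forall c, indep_copy (D `&` Z @^-1` [set c]) Z') ->
  mean_on P D (fun w => (Z w)%:R * (Z' w)%:R) (mu ^+ 2 * fine (P D)).
Proof.
move=> mD DZ DZ'.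
have mf : measurable_fun [set: Omega] (fun w => (Z w)%:R * (Z' w)%:R : R).
  by apply: measurable_funM; exact: (@measurable_nat_fun R d Omega P _ (fun k => k%:R)).
apply: mean_on_ge0 => //; first exact: measurable_funTS.
rewrite (@integral_fibers _ _ _ P D Z) //; last first.
- by apply: measurable_EFin_fun; exact: measurable_funTS.
transitivity (\sum_(c <oo) (mu%:E * \int[P]_(w in D `&` Z @^-1` [set c]) (Z w)%:R%:E))%E.
  apply: eq_eseriesr => c _.
  have mDc : measurable (D `&` Z @^-1` [set c]).
    by apply: measurableI => //; exact: measurable_RV_fiber.
  transitivity (\int[P]_(w in D `&` Z @^-1` [set c]) (c%:R%:E * (Z' w)%:R%:E))%E.
    by apply: eq_integral => w /set_mem[_ /= ->].
  rewrite ge0_integralZl //; last first.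
    by apply: measurable_funTS; exact: (@emeasurable_nat_fun R d Omega P _ (fun k => k%:R)).
  rewrite (integral_indep_copy (g := fun k => k%:R) mDc (DZ' c)) // M1 muleC -muleA muleCA; congr (_ * _)%E.
  by rewrite muleC -integral_cst //; apply: eq_integral => w /set_mem[_ /= ->].
rewrite nneseriesZl; last by move=> i _; apply: integral_ge0 => w _; rewrite lee_fin.
rewrite -(@integral_fibers _ _ _ P D Z) //; last first.
  by apply: measurable_funTS; exact: (@emeasurable_nat_fun R d Omega P _ (fun k => k%:R)).
by have [_ ->] := mean_indep1 mD DZ; rewrite -EFinM mulrA.
Qed.

End IndependentMoments.

(** * Conditioning on the past of the process *)

Section Process.
Context (R : realType) (d : measure_display) (Omega : measurableType d).
Variables (P : probability Omega R) (M : {RV P >-> nat}).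
Variables (imm : nat -> {RV P >-> nat}) (xi : nat -> nat -> {RV P >-> nat}).
Hypothesis hxi : forall n j, same_law (xi n j) M.
Hypothesis hind : mutually_independent (all_variables imm xi).

Local Notation T := (process_tree imm xi).
Local Notation X := (all_variables imm xi).

(** The indices of the variables that the tree shows before generation [n]
    reproduces. The list depends on the tree itself, because only individuals
    that are present count; on a given history it is constant. *)
Definition past (n : nat) (w : Omega) : seq (nat + nat * nat) :=
  [seq inl k | k <- iota 0 n.+1] ++
  flatten [seq [seq inr (k, j) | j <- iota 0 (present (T w) k)] | k <- iota 0 n].

Lemma inl_past (n k : nat) (w : Omega) : (inl k \in past n w) = (k <= n)%N.
Proof.
rewrite mem_cat mem_map; last by move=> ? ? [].
rewrite mem_iota /= add0n ltnS; case: leqP => //= _.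
by apply/flattenP => -[_ /mapP[k' _ ->] /mapP[]].
Qed.

Lemma inr_past (n k j : nat) (w : Omega) :
  (inr (k, j) \in past n w) = (k < n)%N && (j < present (T w) k)%N.
Proof.
rewrite mem_cat (_ : (_ \in [seq inl _ | _ <- _]) = false) /=; last by apply/mapP => -[].
apply/flattenP/andP => [[_ /mapP[k' + ->]] /mapP[j' + [-> ->]]|[kn jp]].
  by rewrite !mem_iota.
exists [seq inr (k, j) | j <- iota 0 (present (T w) k)].
  by apply/mapP; exists k => //; rewrite mem_iota.
by apply/mapP; exists j => //; rewrite mem_iota.
Qed.

Definition history_event (n : nat) (w : Omega) : set Omega :=
  (fun v => history n (T v)) @^-1` [set history n (T w)].

Lemma history_eventP (n : nat) (w v : Omega) :
  history_event n w v <-> agree n (T w) (T v).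
Proof. by rewrite /history_event /=; split => [/esym /historyP|/historyP]. Qed.

(** Every history is an intersection of constraints on finitely many of the
    independent variables, none of which belongs to a later generation. *)
Lemma history_eventE (n : nat) (w : Omega) :
  history_event n w = \bigcap_(k in [set` past n w]) (X k @^-1` [set X k w]).
Proof.
apply/seteqP; split => v.
  move=> /history_eventP[ai ac] [k|[k j]] /=.
    by rewrite inl_past => kn; rewrite -[LHS]/(immigrants (T v) k) -ai.
  by rewrite inr_past => /andP[kn jp]; rewrite -[LHS]/(children (T v) k j) -ac.
move=> H; apply/history_eventP; split => [k kn|k j kn jp].
  by have /= := H (inl k); rewrite inl_past => /(_ kn) ->.
by have /= := H (inr (k, j)); rewrite inr_past kn => /(_ jp) ->.
Qed.

Lemma measurable_history_event (n : nat) (w : Omega) : measurable (history_event n w).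
Proof.
rewrite history_eventE; apply: fin_bigcap_measurable => [|k _]; first exact: finite_seq.
exact: measurable_funPTI.
Qed.

Lemma measurable_history (n : nat) :
  measurable_fun [set: Omega] (fun w => history n (T w)).
Proof.
move=> _ B _; rewrite setTI.
have -> : (fun w => history n (T w)) @^-1` B =
    \bigcup_(i in B) ((fun w => history n (T w)) @^-1` [set i]).
  by apply/seteqP; split => [w Bw|w [i Bi] /= Hi]; [exists (history n (T w))|rewrite -Hi in Bi].
apply: bigcup_measurable => i _.
case: (pselect (exists w, history n (T w) = i)) => [[w <-]|no].
  exact: measurable_history_event.
rewrite (_ : _ @^-1` _ = set0) //.
by apply/seteqP; split => // w wi; case: no; exists w.
Qed.

Lemma indep_new (s : seq (nat + nat * nat)) (x : nat + nat * nat)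
    (B : nat + nat * nat -> set nat) (C : set nat) :
  uniq s -> x \notin s ->
  P (\bigcap_(k in [set` s]) (X k @^-1` B k) `&` X x @^-1` C) =
  (P (\bigcap_(k in [set` s]) (X k @^-1` B k)) * P (X x @^-1` C))%E.
Proof.
move=> us xs.
pose B' k := if k == x then C else B k.
have H : \bigcap_(k in [set` x :: s]) (X k @^-1` B' k) =
    \bigcap_(k in [set` s]) (X k @^-1` B k) `&` X x @^-1` C.
  apply/seteqP; split => [v Hv|v [Hv Cv] k]; last first.
    rewrite /= inE => /predU1P[->|ks]; first by rewrite /B' eqxx.
    by rewrite /B' ifN; [exact: Hv|apply: contraNN xs => /eqP <-].
  split => [k /= ks|].
    have /= := Hv k; rewrite inE ks orbT => /(_ erefl).
    by rewrite /B' ifN //; apply: contraNN xs => /eqP <-.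
  by have /= := Hv x; rewrite mem_head /B' eqxx => /(_ erefl).
have := hind (s := x :: s) (B := B'); rewrite H => -> //=; last by rewrite xs.
rewrite big_cons /B' eqxx muleC -hind //; congr (P _ * _)%E.
apply/seteqP; split => v Hv k /= ks.
  by have /= := Hv k ks; rewrite ifN //; apply: contraNN xs => /eqP <-.
by rewrite ifN; [exact: Hv|apply: contraNN xs => /eqP <-].
Qed.

Lemma bigcap_undup (s : seq (nat + nat * nat)) (F : nat + nat * nat -> set Omega) :
  \bigcap_(k in [set` undup s]) F k = \bigcap_(k in [set` s]) F k.
Proof.
apply/seteqP; split => v Hv k ks; apply: Hv; first by rewrite /= mem_undup.
by rewrite /= mem_undup in ks.
Qed.

Lemma history_indep (n j : nat) (w : Omega) :
  indep_copy M (history_event n w) (xi n j).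
Proof.
move=> c; rewrite history_eventE -bigcap_undup.
rewrite -[xi n j]/(X (inr (n, j))) indep_new ?undup_uniq //; last first.
  by rewrite mem_undup inr_past ltnn.
by congr (_ * _)%E; exact: (hxi n j).
Qed.

Lemma history_indep2 (n j j' c : nat) (w : Omega) : j != j' ->
  indep_copy M (history_event n w `&` xi n j @^-1` [set c]) (xi n j').
Proof.
move=> jj' c'; rewrite history_eventE -bigcap_undup.
pose B k : set nat := if k == inr (n, j) then [set c] else [set X k w].
have H : \bigcap_(k in [set` undup (past n w)]) (X k @^-1` [set X k w]) `&`
    xi n j @^-1` [set c] =
    \bigcap_(k in [set` inr (n, j) :: undup (past n w)]) (X k @^-1` B k).
  have new k : k \in undup (past n w) -> k != inr (n, j).
    by apply: contraTN => /eqP ->; rewrite mem_undup inr_past ltnn.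
  apply/seteqP; split => [v [Hv Cv] k|v Hv].
    rewrite /= inE => /predU1P[->|ks]; first by rewrite /B eqxx.
    by rewrite /B ifN ?new //; exact: Hv.
  split => [k /= ks|].
    by have /= := Hv k; rewrite inE ks orbT /B ifN ?new // => /(_ erefl).
  by have /= := Hv (inr (n, j)); rewrite mem_head /B eqxx => /(_ erefl).
rewrite H -[xi n j']/(X (inr (n, j'))) indep_new //.
- by congr (_ * _)%E; exact: (hxi n j').
- by rewrite cons_uniq mem_undup inr_past ltnn undup_uniq.
- by rewrite inE mem_undup inr_past ltnn orbF; apply: contraNN jj' => /eqP[->].
Qed.

(** The counterpart, for functions of a tree, of measurability with respect to
    the first [n] generations. *)
Definition determined (n : nat) (A : Type) (F : family_tree -> A) : Prop :=
  forall t t', agree n t t' -> F t = F t'.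

Lemma determined_leq (m n : nat) (A : Type) (F : family_tree -> A) :
  (m <= n)%N -> determined m F -> determined n F.
Proof. by move=> mn dF t t' /(agree_leq mn) /dF. Qed.

Lemma determined_preimage (n : nat) (A : Type) (F : family_tree -> A) (B : set A) :
  determined n F -> (fun w => F (T w)) @^-1` B =
  (fun w => history n (T w)) @^-1` [set i | exists2 w, history n (T w) = i & B (F (T w))].
Proof.
move=> dF; apply/seteqP; split => w /=; first by exists w.
by move=> [v /historyP /dF -> ].
Qed.

Lemma measurable_determined (n : nat) (d' : measure_display) (A : measurableType d')
    (F : family_tree -> A) :
  determined n F -> measurable_fun [set: Omega] (fun w => F (T w)).
Proof.
move=> dF _ B mB; rewrite (determined_preimage B dF).
exact: measurable_history.
Qed.

Variables (mu s2 : R).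
Hypotheses (mu0 : 0 <= mu) (s20 : 0 <= s2).
Hypothesis M1 : (\int[P]_w (M w)%:R%:E = mu%:E)%E.
Hypothesis M2 : (\int[P]_w ((M w)%:R ^+ 2)%:E = (s2 + mu ^+ 2)%:E)%E.

(** The tower property: [G] is the conditional expectation of [F] given the past
    of generation [n], and is constant on each history. *)
Lemma integral_step (n : nat) (F G : family_tree -> R) :
  determined n.+1 F -> determined n G ->
  (forall t, 0 <= F t) -> (forall t, 0 <= G t) ->
  (forall w, mean_on P (history_event n w) (F \o T)
               (G (T w) * fine (P (history_event n w)))) ->
  (\int[P]_w (F (T w))%:E = \int[P]_w (G (T w))%:E)%E.
Proof.
move=> dF dG F0 G0 FG; apply: (eq_integral_fibers (measurable_history n)).
- by apply: measurable_EFin_fun; exact: measurable_determined dF.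
- by move=> w; rewrite lee_fin.
- by apply: measurable_EFin_fun; exact: measurable_determined dG.
- by move=> w; rewrite lee_fin.
move=> w; rewrite -/(history_event n w); have [_ ->] := FG w.
have mH := measurable_history_event n w.
transitivity (\int[P]_(v in history_event n w) (cst (G (T w))%:E v))%E.
  rewrite integral_cst // EFinM fineK // fin_num_measure //.
by apply: eq_integral => v /set_mem /history_eventP /dG <-.
Qed.

Lemma mean_children (n j : nat) (w : Omega) :
  mean_on P (history_event n w) (fun v => (xi n j v)%:R)
    (mu * fine (P (history_event n w))).
Proof.
apply: (mean_indep1 M1); first exact: measurable_history_event.
exact: history_indep.
Qed.

Lemma mean_children2 (n j j' : nat) (w : Omega) :
  mean_on P (history_event n w) (fun v => (xi n j v)%:R * (xi n j' v)%:R)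
    ((mu ^+ 2 + s2 * (j == j')%:R) * fine (P (history_event n w))).
Proof.
have mH := measurable_history_event n w.
case: (eqVneq j j') => [<-|jj']; rewrite ?mulr1 ?mulr0 ?addr0.
  by rewrite addrC; apply: (mean_indep_sqr M2 mH); exact: history_indep.
apply: (mean_indep_prod M1 mH); first exact: history_indep.
by move=> c; exact: history_indep2.
Qed.

Lemma mean_noise (n j : nat) (w : Omega) :
  mean_on P (history_event n w) (fun v => (xi n j v)%:R - mu) 0.
Proof.
have mH := measurable_history_event n w.
have := mean_onD mH (mean_children n j w) (mean_on_cst P mH (- mu)).
by rewrite mulNr subrr.
Qed.

Lemma mean_noise2 (n j j' : nat) (w : Omega) :
  mean_on P (history_event n w) (fun v => ((xi n j v)%:R - mu) * ((xi n j' v)%:R - mu))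
    (s2 * (j == j')%:R * fine (P (history_event n w))).
Proof.
have mH := measurable_history_event n w.
have := mean_onD mH (mean_children2 n j j' w) (mean_onD mH
  (mean_onZ mH (- mu) (mean_noise n j w))
  (mean_onD mH (mean_onZ mH (- mu) (mean_noise n j' w)) (mean_on_cst P mH (- mu ^+ 2)))).
rewrite (_ : _ * _ + _ = s2 * (j == j')%:R * fine (P (history_event n w))); last by ring.
by apply: (eq_mean_on mH) => v _ /=; ring.
Qed.

Lemma determined_children (n : nat) (A : Type) (F : family_tree -> (nat -> nat) -> A) :
  (forall c, determined n (F ^~ c)) ->
  (forall t c c', (forall j, (j < present t n)%N -> c j = c' j) -> F t c = F t c') ->
  determined n.+1 (fun t => F t (children t n)).
Proof.
move=> dF eF t t' a; rewrite (dF _ _ t'); last exact: agree_leq a.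
have [_ pE] := agree_born a (leqnSn n).
apply: eF => j jp; case: a => _ -> //; by rewrite pE.
Qed.

Lemma integral_children (n : nat) (k : family_tree -> nat -> R) :
  determined n k -> (forall t j, 0 <= k t j) ->
  (\int[P]_w (\sum_(j < present (T w) n) k (T w) j * (children (T w) n j)%:R)%:E =
   \int[P]_w (\sum_(j < present (T w) n) k (T w) j * mu)%:E)%E.
Proof.
move=> dk k0; have dp : determined n (fun t => present t n).
  by move=> t t' /agree_born /(_ (leqnn n)) [].
apply: (@integral_step n
  (fun t => \sum_(j < present t n) k t j * (children t n j)%:R)
  (fun t => \sum_(j < present t n) k t j * mu)).
- apply: (@determined_children n _ (fun t c => \sum_(j < present t n) k t j * (c j)%:R)).
    by move=> c t t' a; rewrite (dk _ _ a) (dp _ _ a).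
  by move=> t c c' cc'; apply: eq_bigr => j _; rewrite cc'.
- by move=> t t' a; rewrite (dk _ _ a) (dp _ _ a).
- by move=> t; apply: sumr_ge0 => j _; rewrite mulr_ge0.
- by move=> t; apply: sumr_ge0 => j _; rewrite mulr_ge0.
move=> w; have mH := measurable_history_event n w.
rewrite mulr_suml.
apply: (@eq_mean_on _ _ _ _ _ mH
  (fun v => \sum_(j < present (T w) n) k (T w) j * (xi n j v)%:R)).
  by move=> v /history_eventP a; rewrite /= (dk _ _ a) (dp _ _ a).
apply: mean_on_sum => // j; rewrite -mulrA; apply: mean_onZ => //.
exact: mean_children.
Qed.

Lemma sum_diag (p : nat) (K : nat -> nat -> R) (c : R) :
  \sum_(j < p) \sum_(j' < p) K j j' * (c * ((j : nat) == j')%:R) = \sum_(j < p) K j j * c.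
Proof.
apply: eq_bigr => j _; rewrite (bigD1 j) //= eqxx mulr1 big1 ?addr0 // => j' jj'.
by rewrite val_eqE eq_sym (negbTE jj') !mulr0.
Qed.

Lemma integral_children2 (n : nat) (K : family_tree -> nat -> nat -> R) :
  determined n K -> (forall t j j', 0 <= K t j j') ->
  (\int[P]_w (\sum_(j < present (T w) n) \sum_(j' < present (T w) n)
      K (T w) j j' * (children (T w) n j)%:R * (children (T w) n j')%:R)%:E =
   \int[P]_w (\sum_(j < present (T w) n) \sum_(j' < present (T w) n) K (T w) j j' * mu ^+ 2 +
      \sum_(j < present (T w) n) K (T w) j j * s2)%:E)%E.
Proof.
move=> dK K0; have dp : determined n (fun t => present t n).
  by move=> t t' /agree_born /(_ (leqnn n)) [].
apply: (@integral_step n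
  (fun t => \sum_(j < present t n) \sum_(j' < present t n)
     K t j j' * (children t n j)%:R * (children t n j')%:R)
  (fun t => \sum_(j < present t n) \sum_(j' < present t n) K t j j' * mu ^+ 2 +
     \sum_(j < present t n) K t j j * s2)).
- apply: (@determined_children n _ (fun t c => \sum_(j < present t n)
     \sum_(j' < present t n) K t j j' * (c j)%:R * (c j')%:R)).
    by move=> c t t' a; rewrite (dK _ _ a) (dp _ _ a).
  by move=> t c c' cc'; apply: eq_bigr => j _; apply: eq_bigr => j' _; rewrite !cc'.
- by move=> t t' a; rewrite (dK _ _ a) (dp _ _ a).
- by move=> t; apply: sumr_ge0 => j _; apply: sumr_ge0 => j' _; rewrite !mulr_ge0.
- move=> t; rewrite addr_ge0 //; apply: sumr_ge0 => j _; last by rewrite mulr_ge0.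
  by apply: sumr_ge0 => j' _; rewrite mulr_ge0 // sqr_ge0.
move=> w; have mH := measurable_history_event n w; set p := fine _.
apply: (@eq_mean_on _ _ _ _ _ mH (fun v => \sum_(j < present (T w) n)
    \sum_(j' < present (T w) n) K (T w) j j' * ((xi n j v)%:R * (xi n j' v)%:R))).
  move=> v /history_eventP a; rewrite /= (dK _ _ a) (dp _ _ a).
  by apply: eq_bigr => j _; apply: eq_bigr => j' _; rewrite mulrA.
rewrite -sum_diag -big_split /= mulr_suml; apply: mean_on_sum => // j.
rewrite -big_split mulr_suml; apply: mean_on_sum => // j' /=.
rewrite -mulrDr -mulrA; apply: mean_onZ => //.
exact: mean_children2.
Qed.

(** A quadratic form in the centred offspring numbers of generation [n] has
    the mean of its trace times the variance, because these numbers are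
    uncorrelated given the past. *)
Lemma integral_noise_form (n : nat) (K : family_tree -> nat -> nat -> R) :
  determined n K -> (forall t j, 0 <= K t j j) ->
  (forall t (y : nat -> R), 0 <= \sum_(j < present t n) \sum_(j' < present t n) K t j j' * (y j * y j')) ->
  (\int[P]_w (\sum_(j < present (T w) n) \sum_(j' < present (T w) n)
      K (T w) j j' * (((children (T w) n j)%:R - mu) * ((children (T w) n j')%:R - mu)))%:E =
   \int[P]_w (\sum_(j < present (T w) n) K (T w) j j * s2)%:E)%E.
Proof.
move=> dK K0 Kpsd; have dp : determined n (fun t => present t n).
  by move=> t t' /agree_born /(_ (leqnn n)) [].
apply: (@integral_step n
  (fun t => \sum_(j < present t n) \sum_(j' < present t n)
     K t j j' * (((children t n j)%:R - mu) * ((children t n j')%:R - mu)))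
  (fun t => \sum_(j < present t n) K t j j * s2)).
- apply: (@determined_children n _ (fun t c => \sum_(j < present t n)
     \sum_(j' < present t n) K t j j' * (((c j)%:R - mu) * ((c j')%:R - mu)))).
    by move=> c t t' a; rewrite (dK _ _ a) (dp _ _ a).
  by move=> t c c' cc'; apply: eq_bigr => j _; apply: eq_bigr => j' _; rewrite !cc'.
- by move=> t t' a; rewrite (dK _ _ a) (dp _ _ a).
- by move=> t; exact: (Kpsd t (fun j => (children t n j)%:R - mu)).
- by move=> t; apply: sumr_ge0 => j _; rewrite mulr_ge0.
move=> w; have mH := measurable_history_event n w; set p := fine _.
apply: (@eq_mean_on _ _ _ _ _ mH (fun v => \sum_(j < present (T w) n)
    \sum_(j' < present (T w) n) K (T w) j j' * (((xi n j v)%:R - mu) * ((xi n j' v)%:R - mu)))).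
  by move=> v /history_eventP a; rewrite /= (dK _ _ a) (dp _ _ a).
rewrite -sum_diag mulr_suml; apply: mean_on_sum => // j.
rewrite mulr_suml; apply: mean_on_sum => // j' /=.
rewrite -mulrA; apply: mean_onZ => //.
exact: mean_noise2.
Qed.

End Process.

(** * Growth of a selected population *)

Section SelectedLines.
Context (R : realType) (d : measure_display) (Omega : measurableType d).
Variables (P : probability Omega R) (M I : {RV P >-> nat}).
Variables (imm : nat -> {RV P >-> nat}) (xi : nat -> nat -> {RV P >-> nat}).
Hypothesis himm : forall n, same_law (imm n) I.
Hypothesis hxi : forall n j, same_law (xi n j) M.
Hypothesis hind : mutually_independent (all_variables imm xi).
Variables (mu s2 EI : R).
Hypotheses (mu1 : 1 < mu) (s20 : 0 <= s2).
Hypothesis M1 : (\int[P]_w (M w)%:R%:E = mu%:E)%E.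
Hypothesis M2 : (\int[P]_w ((M w)%:R ^+ 2)%:E = (s2 + mu ^+ 2)%:E)%E.
Hypothesis I1 : (\int[P]_w (I w)%:R%:E = EI%:E)%E.

Local Notation T := (process_tree imm xi).

Let mu_gt0 : 0 < mu. Proof. exact: lt_trans mu1. Qed.
Let mu_ge0 : 0 <= mu. Proof. exact: ltW. Qed.

Lemma EI_ge0 : 0 <= EI.
Proof. by rewrite -lee_fin -I1; apply: integral_ge0 => w _; rewrite lee_fin. Qed.

Lemma integral_imm (n : nat) : (\int[P]_w (immigrants (T w) n)%:R%:E = EI%:E)%E.
Proof.
have DZ : indep_copy I setT (imm n).
  by move=> c; rewrite setTI probability_setT mul1e; exact: himm.
have := @integral_indep_copy _ _ _ _ _ setT _ (fun k => k%:R) measurableT DZ (fun k => ler0n _ _).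
by rewrite I1 probability_setT mul1e.
Qed.

Variables (sel : family_tree -> nat -> nat -> bool) (m : nat).
Hypothesis dsel : forall n, determined n (fun t => sel t n).
(** From generation [m] on, the selected individuals are the children of selected
    individuals, together with some immigrants. *)
Hypothesis hsel : forall t n c, (m <= n)%N -> (c < born t n.+1)%N ->
  sel t n.+1 c = sel t n (parent t n c).

Definition born_sel (n : nat) (t : family_tree) : R := \sum_(c < born t n) (sel t n c)%:R.
Definition present_sel (n : nat) (t : family_tree) : R := \sum_(j < present t n) (sel t n j)%:R.
Definition noise (n : nat) (t : family_tree) : R := born_sel n.+1 t - mu * present_sel n t.

Lemma born_sel_ge0 (n : nat) (t : family_tree) : 0 <= born_sel n t.
Proof. exact: sumr_ge0. Qed.

Lemma present_sel_ge0 (n : nat) (t : family_tree) : 0 <= present_sel n t.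
Proof. exact: sumr_ge0. Qed.

Lemma born_selS (n : nat) (t : family_tree) : (m <= n)%N ->
  born_sel n.+1 t = \sum_(j < present t n) (sel t n j)%:R * (children t n j)%:R.
Proof.
move=> mn; rewrite /born_sel.
transitivity (\sum_(c < born t n.+1) (fun j => (sel t n j)%:R : R) (parent t n c)).
  by apply: eq_bigr => c _; rewrite hsel.
by rewrite (sum_parent t n (fun j => (sel t n j)%:R : R)); apply: eq_bigr => j _; rewrite mulr_natr.
Qed.

Lemma present_selE (n : nat) (t : family_tree) :
  present_sel n t = born_sel n t + \sum_(l < immigrants t n) (sel t n (born t n + l))%:R.
Proof. by rewrite /present_sel /present big_split_ord. Qed.

Lemma born_sel_le (n : nat) (t : family_tree) : born_sel n t <= present_sel n t.
Proof. by rewrite present_selE lerDl sumr_ge0. Qed.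

Lemma present_sel_le (n : nat) (t : family_tree) :
  present_sel n t <= born_sel n t + (immigrants t n)%:R.
Proof.
rewrite present_selE lerD2l.
apply: (@le_trans _ _ (\sum_(l < immigrants t n) (1 : R))).
  by apply: ler_sum => l _; case: (sel _ _ _).
by rewrite sumr_const card_ord.
Qed.

Lemma determined_born (n : nat) : determined n (born ^~ n).
Proof. by move=> t t' /agree_born /(_ (leqnn n)) []. Qed.

Lemma determined_present (n : nat) : determined n (present ^~ n).
Proof. by move=> t t' /agree_born /(_ (leqnn n)) []. Qed.

Lemma determined_born_sel (n : nat) : determined n (born_sel n).
Proof. by move=> t t' a; rewrite /born_sel (determined_born a) (dsel a). Qed.

Lemma determined_present_sel (n : nat) : determined n (present_sel n).
Proof. by move=> t t' a; rewrite /present_sel (determined_present a) (dsel a). Qed.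

Lemma determined_noise (n : nat) : determined n.+1 (noise n).
Proof.
move=> t t' a; rewrite /noise (determined_born_sel a).
by rewrite (determined_leq (leqnSn n) (@determined_present_sel n) a).
Qed.

Lemma determined_imm (n : nat) : determined n (fun t => (immigrants t n)%:R : R).
Proof. by move=> t t' [-> //]. Qed.

Let mT (n : nat) (F : family_tree -> R) :
  determined n F -> measurable_fun [set: Omega] (fun w => (F (T w))%:E).
Proof. by move=> dF; apply: measurable_EFin_fun; exact: measurable_determined dF. Qed.

(** One generation changes a mean size [x] into at most [mu * (x + EI)], and
    [x + imm_const] into [mu * (x + imm_const)]: this constant turns the affine
    recursion into a geometric one. *)
Definition imm_const : R := EI * mu / (mu - 1).

Lemma imm_const_ge0 : 0 <= imm_const.
Proof. by rewrite /imm_const divr_ge0 ?mulr_ge0 ?EI_ge0 // subr_ge0 ltW. Qed.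

Lemma imm_const_eq : imm_const + mu * EI = mu * imm_const.
Proof. by rewrite /imm_const; field; rewrite subr_eq0 gt_eqF. Qed.

Lemma EI_le_imm_const : EI <= imm_const.
Proof.
rewrite /imm_const ler_pdivlMr ?subr_gt0 // ler_wpM2l ?EI_ge0 //.
by rewrite lerBlDr lerDl.
Qed.

(** The population of generation [m] may be weighted by a bounded function [phi]
    of the past of generation [m], because all later means are taken
    conditionally on that past. *)
Section Weighted.
Variables (phi : family_tree -> R) (K b : R).
Hypotheses (dphi : determined m phi) (phi0 : forall t, 0 <= phi t <= K).
Hypothesis phib : (\int[P]_w (phi (T w) * born_sel m (T w))%:E <= b%:E)%E.

Let phi_ge0 t : 0 <= phi t. Proof. by have /andP[] := phi0 t. Qed.
Let K_ge0 : 0 <= K.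
Proof. by have /andP[] := phi0 (FamilyTree (fun=> 0%N) (fun _ _ => 0%N)); exact: le_trans. Qed.

Lemma integral_born_selS (n : nat) : (m <= n)%N ->
  (\int[P]_w (phi (T w) * born_sel n.+1 (T w))%:E =
   mu%:E * \int[P]_w (phi (T w) * present_sel n (T w))%:E)%E.
Proof.
move=> mn.
transitivity (\int[P]_w (\sum_(j < present (T w) n)
    (phi (T w) * (sel (T w) n j)%:R) * (children (T w) n j)%:R)%:E)%E.
  apply: eq_integral => w _; rewrite born_selS // mulr_sumr; congr EFin.
  by apply: eq_bigr => j _; rewrite mulrA.
rewrite (integral_children hxi hind mu_ge0 M1
  (k := fun t j => phi t * (sel t n j)%:R)); last 2 first.
- by move=> t t' a; rewrite (dsel a) (determined_leq mn dphi a).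
- by move=> t j; rewrite mulr_ge0.
rewrite -ge0_integralZl //; last 2 first.
- apply: (@mT n (fun t => phi t * present_sel n t)) => t t' a.
  by rewrite (determined_present_sel a) (determined_leq mn dphi a).
- by move=> w _; rewrite lee_fin mulr_ge0 // present_sel_ge0.
apply: eq_integral => w _; rewrite -EFinM; congr EFin.
rewrite /present_sel !mulr_sumr; apply: eq_bigr => j _; ring.
Qed.

Lemma integral_present_sel_le (n : nat) : (m <= n)%N ->
  (\int[P]_w (phi (T w) * present_sel n (T w))%:E <=
   \int[P]_w (phi (T w) * born_sel n (T w))%:E + (K * EI)%:E)%E.
Proof.
move=> mn; have dphin := determined_leq mn dphi.
have dF1 : determined n (fun t => phi t * born_sel n t).
  by move=> t t' a; rewrite (determined_born_sel a) (dphin _ _ a).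
have dF2 : determined n (fun t => phi t * present_sel n t).
  by move=> t t' a; rewrite (determined_present_sel a) (dphin _ _ a).
have dF3 := @determined_imm n.
have -> : ((K * EI)%:E = \int[P]_w (K * (immigrants (T w) n)%:R)%:E)%E.
  under eq_integral do rewrite EFinM.
  by rewrite ge0_integralZl // ?integral_imm //; exact: (mT dF3).
rewrite -ge0_integralD //; first last.
- by apply: (@mT n (fun t => K * (immigrants t n)%:R)) => t t' a; rewrite (dF3 _ _ a).
- by move=> w _; rewrite lee_fin mulr_ge0.
- exact: mT dF1.
- by move=> w _; rewrite lee_fin mulr_ge0 // born_sel_ge0.
apply: ge0_le_integral => //.
- by move=> w _; rewrite lee_fin mulr_ge0 // present_sel_ge0.
- exact: mT dF2.
- apply: emeasurable_funD; first exact: mT dF1.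
  by apply: (@mT n (fun t => K * (immigrants t n)%:R)) => t t' a; rewrite (dF3 _ _ a).
move=> w _; rewrite -EFinD lee_fin.
apply: (le_trans (ler_wpM2l (phi_ge0 _) (present_sel_le n (T w)))).
by rewrite mulrDr lerD2l ler_wpM2r //; case/andP: (phi0 (T w)).
Qed.

Lemma integral_born_sel_bound (k : nat) :
  (\int[P]_w (phi (T w) * born_sel (m + k) (T w))%:E <=
   (mu ^+ k * (b + K * imm_const) - K * imm_const)%:E)%E.
Proof.
elim: k => [|k IH]; first by rewrite addn0 mul1r addrK.
rewrite addnS integral_born_selS ?leq_addr //.
apply: (@le_trans _ _ (mu%:E * ((mu ^+ k * (b + K * imm_const) - K * imm_const)%:E + (K * EI)%:E))%E).
  rewrite lee_wpmul2l ?lee_fin //.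
  by apply: (le_trans (integral_present_sel_le (leq_addr _ _))); rewrite leeD2r.
rewrite -EFinD -EFinM lee_fin exprS le_eqVlt; apply/orP; left; apply/eqP.
have E : mu * EI = mu * imm_const - imm_const by rewrite -imm_const_eq; ring.
transitivity (mu * mu ^+ k * (b + K * imm_const) - K * (mu * imm_const) + K * (mu * EI)).
  by ring.
by rewrite E; ring.
Qed.

Lemma integral_present_sel_bound (k : nat) :
  (\int[P]_w (phi (T w) * present_sel (m + k) (T w))%:E <=
   (mu ^+ k * (b + K * imm_const))%:E)%E.
Proof.
apply: (le_trans (integral_present_sel_le (leq_addr _ _))).
apply: (le_trans (leeD2r _ (integral_born_sel_bound k))).
rewrite -EFinD lee_fin -addrA gerDl addrC subr_le0.
by rewrite ler_wpM2l // EI_le_imm_const.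
Qed.

Lemma integral_noise_sqr (k : nat) :
  (\int[P]_w (phi (T w) * noise (m + k) (T w) ^+ 2)%:E <=
   (s2 * (mu ^+ k * (b + K * imm_const)))%:E)%E.
Proof.
set n := (m + k)%N; have mn : (m <= n)%N by exact: leq_addr.
have dphin := determined_leq mn dphi.
pose Q t (y : nat -> R) : R := \sum_(j < present t n) \sum_(j' < present t n)
  (phi t * (sel t n j)%:R * (sel t n j')%:R) * (y j * y j').
have QE t y : Q t y = phi t * (\sum_(j < present t n) (sel t n j)%:R * y j) ^+ 2.
  rewrite expr2 mulr_suml mulr_sumr; apply: eq_bigr => j _.
  by rewrite !mulr_sumr; apply: eq_bigr => j' _; ring.
have -> : (\int[P]_w (phi (T w) * noise n (T w) ^+ 2)%:E =
    \int[P]_w (Q (T w) (fun j => (children (T w) n j)%:R - mu))%:E)%E.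
  apply: eq_integral => w _; rewrite QE /noise born_selS // /present_sel; congr (_ * _ ^+ 2)%:E.
  by rewrite mulr_sumr -sumrB; apply: eq_bigr => j _; ring.
rewrite (integral_noise_form hxi hind s20 M1 M2
  (K := fun t j j' => phi t * (sel t n j)%:R * (sel t n j')%:R)); first last.
- by move=> t y; rewrite -/(Q t y) QE mulr_ge0 // sqr_ge0.
- by move=> t j; rewrite !mulr_ge0.
- by move=> t t' a; rewrite (dsel a) (dphin _ _ a).
have -> : (\int[P]_w (\sum_(j < present (T w) n)
      phi (T w) * (sel (T w) n j)%:R * (sel (T w) n j)%:R * s2)%:E =
    s2%:E * \int[P]_w (phi (T w) * present_sel n (T w))%:E)%E.
  rewrite -ge0_integralZl //; last 2 first.
  - apply: (@mT n (fun t => phi t * present_sel n t)) => t t' a.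
    by rewrite (determined_present_sel a) (dphin _ _ a).
  - by move=> w _; rewrite lee_fin mulr_ge0 // present_sel_ge0.
  apply: eq_integral => w _; rewrite -EFinM; congr EFin.
  rewrite /present_sel !mulr_sumr; apply: eq_bigr => j _.
  by case: (sel _ _ _) => /=; ring.
by rewrite EFinM lee_wpmul2l ?lee_fin // integral_present_sel_bound.
Qed.

End Weighted.

(** The noise of a generation has size the square root of its population, that
    is [rho ^+ n], and is thus negligible against [mu ^+ n]. *)
Definition rho : R := Num.sqrt mu.

Lemma rho_sqr : rho ^+ 2 = mu. Proof. by rewrite sqr_sqrtr. Qed.

Lemma rho_gt1 : 1 < rho.
Proof. by rewrite -sqrtr1 ltr_sqrt. Qed.

Lemma rho_gt0 : 0 < rho. Proof. exact: lt_trans rho_gt1. Qed.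

Lemma rho_inv01 : 0 < rho^-1 < 1.
Proof. by rewrite invr_gt0 rho_gt0 invf_lt1 ?rho_gt0 // rho_gt1. Qed.

Lemma mu_pow (k : nat) : mu ^+ k = rho ^+ k * rho ^+ k.
Proof. by rewrite -rho_sqr -exprM mulnC exprM expr2. Qed.

(** The square-integrable noise is turned into an [L1] bound by
    [x <= x ^+ 2 / l + l] with [l = eps * rho ^+ k], which balances both terms;
    [eps] is left free. *)
Lemma integral_noise_abs (psi : family_tree -> R) (K b eps : R) (k : nat) :
  determined m psi -> (forall t, 0 <= psi t) -> (forall t, psi t ^+ 2 <= K) ->
  (\int[P]_w (psi (T w) ^+ 2 * born_sel m (T w))%:E <= b%:E)%E -> 0 < eps ->
  (\int[P]_w (psi (T w) * `|noise (m + k) (T w)|)%:E <=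
   (rho ^+ k * (s2 * (b + K * imm_const) / eps + eps))%:E)%E.
Proof.
move=> dpsi psi0 psiK psib eps0.
have rk0 : 0 < rho ^+ k by rewrite exprn_gt0 // rho_gt0.
pose l := eps * rho ^+ k; have l0 : 0 < l by rewrite mulr_gt0.
have dpn : determined (m + k).+1 psi by apply: determined_leq dpsi; rewrite leqW // leq_addr.
have dF2 : determined (m + k).+1 (fun t => psi t ^+ 2 * noise (m + k) t ^+ 2).
  by move=> t t' a; rewrite (determined_noise a) (dpn _ _ a).
have bound : (\int[P]_w (psi (T w) ^+ 2 * noise (m + k) (T w) ^+ 2)%:E <=
    (s2 * (mu ^+ k * (b + K * imm_const)))%:E)%E.
  apply: (@integral_noise_sqr (fun t => psi t ^+ 2)) => //.
    by move=> t t' a; rewrite (dpsi _ _ a).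
  by move=> t; rewrite sqr_ge0 psiK.
apply: (@le_trans _ _ (\int[P]_w (l^-1%:E * (psi (T w) ^+ 2 * noise (m + k) (T w) ^+ 2)%:E
    + (cst l%:E) w))%E).
  apply: ge0_le_integral => //.
  - by move=> w _; rewrite lee_fin mulr_ge0.
  - apply: (@mT (m + k).+1 (fun t => psi t * `|noise (m + k) t|)) => t t' a.
    by rewrite (determined_noise a) (dpn _ _ a).
  - apply: emeasurable_funD => //; apply: measurable_funeM; exact: mT dF2.
  - move=> w _; rewrite /= -EFinM -EFinD lee_fin.
    set x := psi (T w); set y := `|noise (m + k) (T w)|.
    have -> : noise (m + k) (T w) ^+ 2 = y ^+ 2 by rewrite /y real_normK // num_real.
    rewrite -[x ^+ 2 * y ^+ 2]exprMn.
    have xy0 : 0 <= x * y by apply: mulr_ge0; [exact: psi0|exact: normr_ge0].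
    rewrite -subr_ge0; set z := x * y in xy0 *.
    have -> : l^-1 * z ^+ 2 + l - z = l^-1 * ((z - l) ^+ 2 + z * l).
      by field; rewrite gt_eqF.
    apply: mulr_ge0; first by rewrite invr_ge0 ltW.
    by apply: addr_ge0; [exact: sqr_ge0|apply: mulr_ge0 => //; exact: ltW].
have il : (0 <= l^-1) by rewrite invr_ge0 ltW.
rewrite ge0_integralD //; first last.
- by move=> w _; rewrite lee_fin ltW.
- by apply: measurable_funeM; exact: mT dF2.
- by move=> w _; rewrite -EFinM lee_fin; apply: mulr_ge0 => //; apply: mulr_ge0; exact: sqr_ge0.
rewrite (integral_cst P measurableT l%:E) [X in (_ * X)%E]probability_setT mule1 ge0_integralZl_EFin //; last 2 first.
- by move=> w _; rewrite lee_fin; apply: mulr_ge0; exact: sqr_ge0.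
- exact: mT dF2.
apply: (le_trans (leeD2r _ (lee_wpmul2l _ bound))); first by rewrite lee_fin.
rewrite -EFinM -EFinD lee_fin le_eqVlt; apply/orP; left; apply/eqP.
rewrite mu_pow /l; field.
by rewrite !gt_eqF.
Qed.

Lemma increment_born_sel (n : nat) (t : family_tree) :
  `|born_sel n.+1 t / mu ^+ n.+1 - born_sel n t / mu ^+ n| <=
  `|noise n t| / mu ^+ n.+1 + (immigrants t n)%:R / mu ^+ n.
Proof.
have mn0 : 0 < mu ^+ n by rewrite exprn_gt0.
have -> : born_sel n.+1 t / mu ^+ n.+1 - born_sel n t / mu ^+ n =
    noise n t / mu ^+ n.+1 + (present_sel n t - born_sel n t) / mu ^+ n.
  by rewrite /noise exprS; field; rewrite !gt_eqF.
apply: (le_trans (ler_normD _ _)); rewrite !normrM lerD //.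
  by rewrite (@ger0_norm _ (_ ^-1)) // invr_ge0 exprn_ge0.
have in0 : 0 <= mu ^- n by rewrite invr_ge0 ltW.
rewrite (ger0_norm in0) ler_wpM2r //.
by rewrite ger0_norm ?subr_ge0 ?born_sel_le // lerBlDl present_sel_le.
Qed.

(** Normalised sizes change by the noise and by the immigrants of one generation,
    both of order [rho ^- n] at most in mean. *)
Lemma cvg_born_sel (b : R) : (\int[P]_w (born_sel m (T w))%:E <= b%:E)%E ->
  {ae P, forall w, cvgn (fun n => born_sel n (T w) / mu ^+ n)}.
Proof.
move=> hb.
have mu_n n : measurable_fun [set: Omega] (fun w => born_sel n (T w) / mu ^+ n).
  by apply: (@measurable_determined _ _ _ _ _ _ n _ _ (fun t => born_sel n t / mu ^+ n)) => t t' a;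
     rewrite (determined_born_sel a).
pose C0 := s2 * (b + imm_const) + 1.
apply: (@ae_cvg_increments _ _ _ _ _ m (C0 + EI) rho^-1 mu_n rho_inv01) => n mn.
have [k nE] : exists k, n = (m + k)%N by exists (n - m)%N; rewrite subnKC.
have mn0 j : 0 < mu ^+ j by rewrite exprn_gt0.
have noise_b := @integral_noise_abs (fun=> 1) 1 b 1 k (fun _ _ _ => erefl) (fun=> ler01) (fun=> _).
have dn : determined n.+1 (fun t => `|noise n t|) by move=> t t' a; rewrite (determined_noise a).
apply: (@le_trans _ _ (\int[P]_w ((mu ^+ n.+1)^-1%:E * (`|noise n (T w)|)%:E +
    (mu ^+ n)^-1%:E * (immigrants (T w) n)%:R%:E))%E).
  apply: ge0_le_integral => //.
  - apply: (@mT n.+1 (fun t => `|born_sel n.+1 t / mu ^+ n.+1 - born_sel n t / mu ^+ n|)) => t t' a.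
    by rewrite (determined_born_sel a) (determined_leq (leqnSn n) (@determined_born_sel n) a).
  - apply: emeasurable_funD; apply: measurable_funeM; first exact: mT dn.
    exact: mT (@determined_imm n).
  - move=> w _; rewrite -!EFinM -EFinD lee_fin.
    by rewrite [X in _ <= X + _]mulrC [X in _ <= _ + X]mulrC increment_born_sel.
have iv j : 0 <= (mu ^+ j)^-1 by rewrite invr_ge0 ltW.
rewrite ge0_integralD //; first last.
- by apply: measurable_funeM; exact: mT (@determined_imm n).
- by move=> w _; rewrite -EFinM lee_fin mulr_ge0.
- by apply: measurable_funeM; exact: mT dn.
- by move=> w _; rewrite -EFinM lee_fin mulr_ge0.
rewrite !ge0_integralZl_EFin //; last 2 first.
- exact: mT (@determined_imm n).
- exact: mT dn.
have {noise_b} noise_b : (\int[P]_w `|noise n (T w)|%:E <= (rho ^+ k * C0)%:E)%E.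
  have := noise_b _ _ ltr01; rewrite nE /C0 mul1r divr1 => {}noise_b.
  under eq_integral do rewrite -[`|_|]mul1r.
  apply: noise_b => [_|]; first by rewrite expr1n.
  by under eq_integral do rewrite expr1n mul1r.
rewrite integral_imm.
apply: (le_trans (leeD2r _ (lee_wpmul2l _ noise_b))); first by rewrite lee_fin.
have C00 : 0 <= C0.
  rewrite addr_ge0 // mulr_ge0 // addr_ge0 ?imm_const_ge0 // -lee_fin.
  by apply: le_trans hb; apply: integral_ge0 => w _; rewrite lee_fin born_sel_ge0.
have r1 j : 1 <= rho ^+ j by rewrite exprn_ege1 // ltW // rho_gt1.
have rn0 j : 0 < rho ^+ j by rewrite exprn_gt0 // rho_gt0.
rewrite -!EFinM -EFinD lee_fin mulrDl exprVn lerD //.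
  rewrite mulrA [leRHS]mulrC ler_wpM2r // ler_pdivrMl //.
  have -> : mu ^+ n.+1 / rho ^+ n = mu * rho ^+ n.
    by rewrite exprS mu_pow; field; rewrite gt_eqF.
  apply: (@le_trans _ _ (rho ^+ n)); last by rewrite ler_peMl // ltW.
  by rewrite nE exprD ler_peMl // ltW.
rewrite mulrC ler_wpM2l ?EI_ge0 // lef_pV2 ?posrE // mu_pow.
by rewrite ler_peMl // ltW.
Qed.

(** Without noise the population is multiplied by at least [mu] in every
    generation, so a population that grows slower than [mu ^+ n] has been eaten
    up by the noise of the generations from [m] on. *)
Lemma extinction_noise (t : family_tree) :
  born_sel n t / mu ^+ n @[n --> \oo] --> 0 ->
  ((born_sel m t)%:E <= \sum_(k <oo) (`|noise (m + k) t| / mu ^+ k.+1)%:E)%E.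
Proof.
move=> u0; set S := (\sum_(k <oo) _)%E.
have term0 k : 0 <= `|noise (m + k) t| / mu ^+ k.+1 by rewrite divr_ge0 // exprn_ge0.
have partial N : born_sel m t - mu ^+ m * (born_sel (m + N) t / mu ^+ (m + N)) <=
    \sum_(0 <= k < N) `|noise (m + k) t| / mu ^+ k.+1.
  elim: N => [|N IH].
    by rewrite addn0 big_nil mulrCA divff ?mulr1 ?subrr // expf_neq0 // gt_eqF.
  rewrite big_nat_recr //=; apply: le_trans (lerD IH (lexx _)).
  suff H : mu ^+ m * (born_sel (m + N) t / mu ^+ (m + N)) -
      mu ^+ m * (born_sel (m + N.+1) t / mu ^+ (m + N.+1)) <=
      `|noise (m + N) t| / mu ^+ N.+1 by lra.
  have := ler_norm (- noise (m + N) t); rewrite normrN /noise => nle.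
  have ble := born_sel_le (m + N) t.
  rewrite addnS -subr_ge0 !exprS !exprD.
  have -> : forall x : R, x / (mu * mu ^+ N) - (mu ^+ m * (born_sel (m + N) t / (mu ^+ m * mu ^+ N))
      - mu ^+ m * (born_sel (m + N).+1 t / (mu * (mu ^+ m * mu ^+ N)))) =
      (x - mu * born_sel (m + N) t + born_sel (m + N).+1 t) / (mu * mu ^+ N).
    by move=> x; field; rewrite ?expf_neq0 gt_eqF.
  rewrite divr_ge0 //; last by rewrite mulr_ge0 // exprn_ge0.
  have : mu * born_sel (m + N) t <= mu * present_sel (m + N) t by rewrite ler_wpM2l.
  by move: nle; lra.
have S0 : (0 <= S)%E by apply: nneseries_ge0 => k _ _; rewrite lee_fin.
case ES : S S0 => [s| |] // _; last by rewrite leey.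
rewrite lee_fin.
have bound N : born_sel m t - mu ^+ m * (born_sel (m + N) t / mu ^+ (m + N)) <= s.
  apply: (le_trans (partial N)); rewrite -lee_fin -ES -sumEFin.
  by apply: nneseries_lim_ge => k _ _; rewrite lee_fin.
have cv : born_sel m t - mu ^+ m * (born_sel (m + N) t / mu ^+ (m + N)) @[N --> \oo] -->
    born_sel m t.
  rewrite -[X in _ --> X]subr0; apply: cvgB; first exact: cvg_cst.
  rewrite -(mulr0 (mu ^+ m)); apply: cvgMr.
  have := u0; rewrite -(cvg_shiftn m).
  by under eq_fun do rewrite addnC.
rewrite -(cvg_lim _ cv) //; apply: limr_le; first by apply/cvg_ex; exists (born_sel m t).
exact: nearW.
Qed.

(** On the event of slow growth the population of generation [m] is dominated by
    a sum of noises, whose means [integral_noise_abs] controls. The weight [psi]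
    and the parameter [eps] are left free: the bound serves both to show that
    slow growth has probability zero and that it is not almost sure. *)
Lemma extinction_bound (E : set Omega) (psi : family_tree -> R) (K b eps : R) :
  measurable E -> (forall w, E w -> born_sel n (T w) / mu ^+ n @[n --> \oo] --> 0) ->
  determined m psi -> (forall t, 0 <= psi t) -> (forall t, psi t ^+ 2 <= K) ->
  (\int[P]_w (psi (T w) ^+ 2 * born_sel m (T w))%:E <= b%:E)%E -> 0 < eps ->
  (\int[P]_(w in E) (psi (T w) * born_sel m (T w))%:E <=
   ((s2 * (b + K * imm_const) / eps + eps) / (1 - rho^-1))%:E)%E.
Proof.
move=> mE Ew dpsi psi0 psiK psib eps0.
pose D k w : R := psi (T w) * `|noise (m + k) (T w)| / mu ^+ k.+1.
have mD k : measurable_fun [set: Omega] (D k).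
  apply: (@measurable_determined _ _ _ _ _ _ (m + k).+1 _ _
    (fun t => psi t * `|noise (m + k) t| / mu ^+ k.+1)) => t t' a.
  rewrite (determined_noise a) (determined_leq _ dpsi a) //.
  by rewrite leqW // leq_addr.
have D0 k w : 0 <= D k w by rewrite /D divr_ge0 ?mulr_ge0 // exprn_ge0.
pose C := s2 * (b + K * imm_const) / eps + eps.
have intD k : (\int[P]_w (D k w)%:E <= (C * rho^-1 ^+ k)%:E)%E.
  have nb := integral_noise_abs k dpsi psi0 psiK psib eps0.
  have ik0 : 0 <= (mu ^+ k.+1)^-1 by rewrite invr_ge0 exprn_ge0.
  have -> : (\int[P]_w (D k w)%:E = (mu ^+ k.+1)^-1%:E *
      \int[P]_w (psi (T w) * `|noise (m + k) (T w)|)%:E)%E.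
    rewrite -ge0_integralZl_EFin //.
    - by apply: eq_integral => w _; rewrite -EFinM mulrC.
    - by move=> w _; rewrite lee_fin mulr_ge0.
    - apply: (@mT (m + k).+1 (fun t => psi t * `|noise (m + k) t|)) => t t' a.
      rewrite (determined_noise a) (determined_leq _ dpsi a) //.
      by rewrite leqW // leq_addr.
  apply: (le_trans (lee_wpmul2l _ nb)); first by rewrite lee_fin.
  have rk0 : 0 < rho ^+ k by rewrite exprn_gt0 // rho_gt0.
  have C0 : 0 <= C.
    have : (0 <= (rho ^+ k * C)%:E)%E.
      by apply: le_trans nb; apply: integral_ge0 => w _; rewrite lee_fin mulr_ge0.
    by rewrite lee_fin pmulr_rge0.
  rewrite -EFinM lee_fin mulrA [leRHS]mulrC ler_wpM2r // exprVn exprS mu_pow.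
  rewrite ler_pdivrMl ?mulr_gt0 //.
  have -> : mu * (rho ^+ k * rho ^+ k) / rho ^+ k = mu * rho ^+ k by field; rewrite gt_eqF.
  by rewrite ler_peMl // ltW.
apply: (le_trans _ (integral_noise_le mD D0 rho_inv01 intD)).
have mS : measurable_fun [set: Omega] (fun w => (\sum_(k <oo) (D k w)%:E)%E).
  apply: ge0_emeasurable_sum => k *; last exact: measurable_EFin_fun.
  by rewrite lee_fin.
apply: (@le_trans _ _ (\int[P]_(w in E) (\sum_(k <oo) (D k w)%:E)%E)%E); last first.
  apply: ge0_subset_integral => //.
  by move=> w _; apply: nneseries_ge0 => k _ _; rewrite lee_fin.
apply: ge0_le_integral => //.
- by move=> w _; rewrite lee_fin mulr_ge0 // born_sel_ge0.
- apply: measurable_funTS; apply: (@mT m (fun t => psi t * born_sel m t)) => t t' a.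
  by rewrite (determined_born_sel a) (dpsi _ _ a).
- exact: measurable_funTS.
move=> w /Ew /extinction_noise le1.
rewrite EFinM; apply: (le_trans (lee_wpmul2l _ le1)); first by rewrite lee_fin.
rewrite -nneseriesZl; last by move=> k _; rewrite lee_fin divr_ge0 // exprn_ge0.
by rewrite le_eqVlt; apply/orP; left; apply/eqP; apply: eq_eseriesr => k _; rewrite -EFinM mulrA.
Qed.

End SelectedLines.

(** * Growth of the number of related pairs *)

Section RelatedPairs.
Context (R : realType) (d : measure_display) (Omega : measurableType d).
Variables (P : probability Omega R) (M I : {RV P >-> nat}).
Variables (imm : nat -> {RV P >-> nat}) (xi : nat -> nat -> {RV P >-> nat}).
Hypothesis himm : forall n, same_law (imm n) I.
Hypothesis hxi : forall n j, same_law (xi n j) M.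
Hypothesis hind : mutually_independent (all_variables imm xi).
Variables (mu s2 EI : R).
Hypotheses (mu1 : 1 < mu) (s20 : 0 <= s2).
Hypothesis M1 : (\int[P]_w (M w)%:R%:E = mu%:E)%E.
Hypothesis M2 : (\int[P]_w ((M w)%:R ^+ 2)%:E = (s2 + mu ^+ 2)%:E)%E.
Hypothesis I1 : (\int[P]_w (I w)%:R%:E = EI%:E)%E.

Local Notation T := (process_tree imm xi).

Let mu_gt0 : 0 < mu. Proof. exact: lt_trans mu1. Qed.
Let mu_ge0 : 0 <= mu. Proof. exact: ltW. Qed.
Let mT (n : nat) (F : family_tree -> R) :
  determined n F -> measurable_fun [set: Omega] (fun w => (F (T w))%:E).
Proof. by move=> dF; apply: measurable_EFin_fun; exact: measurable_determined dF. Qed.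

Lemma integral_present (n : nat) :
  (\int[P]_w (present (T w) n)%:R%:E <= (mu ^+ n * imm_const mu EI)%:E)%E.
Proof.
pose sel (t : family_tree) (n j : nat) := true.
have := @integral_present_sel_bound _ _ _ P M I imm xi himm hxi hind mu EI mu1 M1 I1 sel 0
  (fun _ _ _ _ => erefl) (fun _ _ _ _ _ => erefl) (fun=> 1) 1 0 (fun _ _ _ => erefl).
move=> /(_ _ _ n); rewrite mul1r add0r add0n => H.
have -> : (\int[P]_w (present (T w) n)%:R%:E = \int[P]_w (1 * present_sel R sel n (T w))%:E)%E.
  by apply: eq_integral => w _; rewrite mul1r /present_sel sumr_const card_ord.
apply: H => [t|]; first by rewrite lexx ler01.
by under eq_integral do rewrite mul1r /born_sel big_ord0; rewrite integral0.
Qed.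

Lemma integral_born (n : nat) :
  (\int[P]_w (born (T w) n)%:R%:E <= (mu ^+ n * imm_const mu EI)%:E)%E.
Proof.
apply: le_trans (integral_present n); apply: ge0_le_integral => //.
- apply: (@mT n (fun t => (born t n)%:R)) => t t' a.
  by have [->] := agree_born a (leqnn n).
- apply: (@mT n (fun t => (present t n)%:R)) => t t' a.
  by have [_ ->] := agree_born a (leqnn n).
- by move=> w _; rewrite lee_fin ler_nat leq_addr.
Qed.

Variable m : nat.

Let kin (n : nat) (t : family_tree) (j j' : nat) : R := (founder t m n j == founder t m n j')%:R.

Lemma determined_kin (n : nat) : determined n (kin n).
Proof.
move=> t t' a; apply/funext => j; apply/funext => j'; rewrite /kin.
by rewrite !(@agree_founder n m n _ t t').
Qed.

Definition present_related (n : nat) (t : family_tree) : R :=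
  \sum_(j < present t n) \sum_(j' < present t n) kin n t j j'.

(** The form is a sum of squares, one for every founder. *)
Lemma kin_form_ge0 (n : nat) (t : family_tree) (p : nat) (y : nat -> R) :
  0 <= \sum_(j < p) \sum_(j' < p) kin n t j j' * (y j * y j').
Proof.
pose s := undup [seq founder t m n j | j <- iota 0 p].
have -> : \sum_(j < p) \sum_(j' < p) kin n t j j' * (y j * y j') =
    \sum_(f <- s) (\sum_(j < p) (founder t m n j == f)%:R * y j) ^+ 2.
  under [RHS]eq_bigr do rewrite expr2 mulr_suml.
  rewrite [RHS]exchange_big /=; apply: eq_bigr => j _.
  under [RHS]eq_bigr do rewrite mulr_sumr.
  rewrite [RHS]exchange_big /=; apply: eq_bigr => j' _.
  have js : founder t m n j \in s.
    by rewrite mem_undup; apply: map_f; rewrite mem_iota add0n /=.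
  rewrite (bigD1_seq (founder t m n j)) ?undup_uniq //= eqxx big1 => [|f fj].
    by rewrite /kin [in RHS](eq_sym (founder t m n j')) /=; ring.
  by rewrite eq_sym (negbTE fj) !mul0r.
by apply: sumr_ge0 => f _; exact: sqr_ge0.
Qed.

(** The quadratic part of the fluctuation of the number of related pairs. *)
Definition kin_noise (n : nat) (t : family_tree) : R :=
  \sum_(j < present t n) \sum_(j' < present t n)
     kin n t j j' * (((children t n j)%:R - mu) * ((children t n j')%:R - mu)).

(** Only the second moment of the offspring law is finite, so the fluctuation of
    the number of related pairs cannot be squared; the cross terms are absorbed
    by positivity of the form at [c * noise] plus or minus one. *)
Lemma related_fluctuation (n : nat) (t : family_tree) (c : R) : (m <= n)%N -> 0 < c ->
  `|related R t m n.+1 - mu ^+ 2 * present_related n t| <=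
  (1 + mu * c) * kin_noise n t + mu / c * present_related n t.
Proof.
move=> mn c0; set p := present t n.
pose y j : R := (children t n j)%:R - mu.
pose B (u v : nat -> R) := \sum_(j < p) \sum_(j' < p) kin n t j j' * (u j * v j').
have B1 : B (cst 1) (cst 1) = present_related n t.
  by apply: eq_bigr => j _; apply: eq_bigr => j' _; rewrite !mulr1.
have Bc : B y (cst 1) = B (cst 1) y.
  rewrite /B exchange_big; apply: eq_bigr => j _; apply: eq_bigr => j' _.
  by rewrite /kin eq_sym; congr (_ * _); rewrite mulrC.
have BE (a b : R) : B (fun j => a * y j + b) (fun j => a * y j + b) =
    a ^+ 2 * B y y + 2 * a * b * B (cst 1) y + b ^+ 2 * B (cst 1) (cst 1).
  have -> : 2 * a * b * B (cst 1) y = a * b * B (cst 1) y + a * b * B y (cst 1) by rewrite Bc; ring.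
  rewrite /B !mulr_sumr -!big_split; apply: eq_bigr => j _.
  rewrite !mulr_sumr -!big_split; apply: eq_bigr => j' _ /=; ring.
have BR : related R t m n.+1 = B y y + 2 * mu * B (cst 1) y + mu ^+ 2 * B (cst 1) (cst 1).
  rewrite relatedS //; have := BE 1 mu; rewrite expr1n !mul1r mulr1 => <-.
  by apply: eq_bigr => j _; apply: eq_bigr => j' _; rewrite /y !mul1r !subrK mulrA.
have pos a b : 0 <= B (fun j => a * y j + b) (fun j => a * y j + b) by exact: kin_form_ge0.
have Byy : 0 <= B y y by exact: kin_form_ge0.
have p1 := pos c 1; have p2 := pos c (-1).
rewrite BE in p1; rewrite BE in p2.
rewrite -B1 -[kin_noise n t]/(B y y) BR.
have -> : B y y + 2 * mu * B (cst 1) y + mu ^+ 2 * B (cst 1) (cst 1) - mu ^+ 2 * B (cst 1) (cst 1)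
   = B y y + 2 * mu * B (cst 1) y by ring.
set b1 := B (cst 1) y in p1 p2 *; set b0 := B y y in Byy p1 p2 *; set b2 := B (cst 1) (cst 1) in p1 p2 *.
have bnd : 2 * `|b1| <= c * b0 + b2 / c.
  rewrite -(ler_pM2l c0).
  have -> : c * (c * b0 + b2 / c) = c ^+ 2 * b0 + b2 by field; rewrite gt_eqF.
  by rewrite mulrCA; case: (ger0P b1) => _; nra.
apply: (le_trans (ler_normD _ _)); rewrite (ger0_norm Byy) normrM (@ger0_norm _ (2 * mu)) ?mulr_ge0 //.
have := ler_wpM2l mu_ge0 bnd; rewrite !mulrDr mulrA.
rewrite (mulrC 2 mu); set z := `|b1|; rewrite [mu * (b2 / c)]mulrA.
have -> : mu / c * b2 = mu * b2 / c by rewrite mulrAC.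
lra.
Qed.

Lemma determined_kin_noise (n : nat) : determined n.+1 (kin_noise n).
Proof.
apply: (@determined_children n _ (fun t c => \sum_(j < present t n) \sum_(j' < present t n)
     kin n t j j' * (((c j)%:R - mu) * ((c j')%:R - mu)))).
  move=> c t t' a; rewrite (@determined_kin n _ _ a).
  by have [_ ->] := agree_born a (leqnn n).
by move=> t c c' cc'; apply: eq_bigr => j _; apply: eq_bigr => j' _; rewrite !cc'.
Qed.

Lemma determined_present_related (n : nat) : determined n (present_related n).
Proof.
move=> t t' a; rewrite /present_related (@determined_kin n _ _ a).
by have [_ ->] := agree_born a (leqnn n).
Qed.

Lemma determined_related (n : nat) : determined n (fun t => related R t m n).
Proof.
move=> t t' a; rewrite /related; have [-> _] := agree_born a (leqnn n).
apply: eq_bigr => c _; apply: eq_bigr => c' _.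
by rewrite !(@agree_founder n m n _ t t').
Qed.

Lemma related_ge0 (n : nat) (t : family_tree) : 0 <= related R t m n.
Proof. by apply: sumr_ge0 => c _; apply: sumr_ge0. Qed.

Lemma present_related_ge0 (n : nat) (t : family_tree) : 0 <= present_related n t.
Proof. by apply: sumr_ge0 => c _; apply: sumr_ge0. Qed.

Lemma kin_noise_ge0 (n : nat) (t : family_tree) : 0 <= kin_noise n t.
Proof. exact: (kin_form_ge0 n t _ (fun j => (children t n j)%:R - mu)). Qed.

Lemma founder_new (n j j' : nat) (t : family_tree) : (m <= n)%N -> (born t n <= j)%N ->
  founder t m n j = founder t m n j' -> j = j'.
Proof.
move=> mn bj /(common_ancestor_founder _ _ _ mn) [k /andP[_ kn] /andP[]].
case: (ltnP k n) => [kn'|nk]; first by rewrite ancestor_immigrant.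
have -> : k = n by apply/eqP; rewrite eqn_leq kn.
by rewrite !ancestor_refl => _ /eqP [].
Qed.

(** A new immigrant is related to nobody but itself. *)
Lemma present_relatedE (n : nat) (t : family_tree) : (m <= n)%N ->
  present_related n t = related R t m n + (immigrants t n)%:R.
Proof.
move=> mn; rewrite /present_related /present.
under eq_bigr do rewrite big_split_ord /=.
rewrite big_split_ord /=; congr (_ + _).
  apply: eq_bigr => c _; rewrite [X in _ + X]big1 ?addr0 // => l _.
  rewrite /kin; case: eqP => // /esym /founder_new => /(_ mn (leq_addr _ _)) E.
  by have := ltn_ord c; rewrite -E ltnNge leq_addr.
transitivity (\sum_(l < immigrants t n) (1 : R)); last by rewrite sumr_const card_ord.
apply: eq_bigr => l _; rewrite big1 ?add0r => [|c _].
  rewrite (bigD1 l) //= /kin eqxx big1 ?addr0 // => l' ll'.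
  case: eqP => // /founder_new => /(_ mn (leq_addr _ _)) /addnI /val_inj E.
  by rewrite E eqxx in ll'.
rewrite /kin; case: eqP => // /founder_new => /(_ mn (leq_addr _ _)) E.
by have := ltn_ord c; rewrite -E ltnNge leq_addr.
Qed.

Lemma related_refl (t : family_tree) : related R t m m = (born t m)%:R.
Proof.
transitivity (\sum_(c < born t m) (1 : R)); last by rewrite sumr_const card_ord.
apply: eq_bigr => c _; rewrite (bigD1 c) //= eqxx big1 ?addr0 // => c' cc'.
by rewrite !founder_refl xpair_eqE eqxx /= val_eqE eq_sym (negbTE cc').
Qed.

(** The mean of [related] obeys [x (n + 1) <= mu ^+ 2 * x n + c * mu ^+ n] with
    [c = mu ^+ 2 * EI + s2 * imm_const], and [- related_const * mu ^+ n] is a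
    particular solution with equality. *)
Let related_const : R := (mu ^+ 2 * EI + s2 * imm_const mu EI) / (mu * (mu - 1)).

Lemma integral_present_related (n : nat) : (m <= n)%N ->
  (\int[P]_w (present_related n (T w))%:E =
   \int[P]_w (related R (T w) m n)%:E + EI%:E)%E.
Proof.
move=> mn; rewrite -(integral_imm xi himm I1 n) -ge0_integralD //; first last.
- by apply: (@mT n (fun t => (immigrants t n)%:R)) => t t' [-> //].
- by apply: (@mT n (fun t => related R t m n)); exact: determined_related.
- by move=> w _; rewrite lee_fin related_ge0.
by apply: eq_integral => w _; rewrite present_relatedE.
Qed.

Lemma integral_relatedS (n : nat) : (m <= n)%N ->
  (\int[P]_w (related R (T w) m n.+1)%:E =
   (mu ^+ 2)%:E * \int[P]_w (present_related n (T w))%:E +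
   s2%:E * \int[P]_w (present (T w) n)%:R%:E)%E.
Proof.
move=> mn; under eq_integral do rewrite relatedS //.
rewrite (integral_children2 hxi hind s20 M1 M2 (@determined_kin n)); last first.
  by move=> t j j'; rewrite /kin.
have d1 := @determined_present_related n.
have d2 : determined n (fun t => (present t n)%:R : R).
  by move=> t t' a; have [_ ->] := agree_born a (leqnn n).
have mu20 : 0 <= mu ^+ 2 by exact: sqr_ge0.
rewrite -!ge0_integralZl_EFin //; first last.
- exact: mT d1.
- by move=> w _; rewrite lee_fin present_related_ge0.
- exact: mT d2.
rewrite -ge0_integralD //; first last.
- by apply: measurable_funeM; exact: mT d2.
- by move=> w _; rewrite -EFinM lee_fin mulr_ge0.
- by apply: measurable_funeM; exact: mT d1.
- by move=> w _; rewrite -EFinM lee_fin mulr_ge0 // present_related_ge0.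
apply: eq_integral => w _; rewrite -!EFinM -EFinD; congr EFin; congr (_ + _).
  rewrite /present_related mulr_sumr; apply: eq_bigr => j _.
  by rewrite mulr_sumr; apply: eq_bigr => j' _; rewrite mulrC.
rewrite (eq_bigr (fun=> s2)); last by move=> j _; rewrite /kin eqxx mul1r.
by rewrite sumr_const card_ord mulr_natr.
Qed.

Lemma integral_related_bound (k : nat) :
  (\int[P]_w (related R (T w) m (m + k))%:E <=
   ((mu ^+ 2) ^+ k * (mu ^+ m * (imm_const mu EI + related_const)) -
    mu ^+ (m + k) * related_const)%:E)%E.
Proof.
have m10 : 0 < mu * (mu - 1) by rewrite mulr_gt0 // subr_gt0.
elim: k => [|k IH].
  rewrite addn0 expr0 mul1r mulrDr addrK.
  by under eq_integral do rewrite related_refl; exact: integral_born.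
rewrite addnS integral_relatedS ?leq_addr // integral_present_related ?leq_addr //.
set x := (\int[P]_w _)%E in IH *.
apply: (@le_trans _ _ ((mu ^+ 2)%:E * (((mu ^+ 2) ^+ k * (mu ^+ m * (imm_const mu EI + related_const)) -
    mu ^+ (m + k) * related_const)%:E + EI%:E) +
    s2%:E * (mu ^+ (m + k) * imm_const mu EI)%:E)%E).
  apply: leeD; apply: lee_wpmul2l; rewrite ?lee_fin ?sqr_ge0 //.
    by apply: leeD.
  exact: integral_present.
rewrite -?EFinD -?EFinM -?EFinD lee_fin.
have E : related_const * (mu * (mu - 1)) = mu ^+ 2 * EI + s2 * imm_const mu EI.
  by rewrite /related_const divfK // gt_eqF.
have mk1 : 1 <= mu ^+ (m + k) by rewrite exprn_ege1 // ltW.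
rewrite -subr_ge0 [(mu ^+ 2) ^+ k.+1]exprS [mu ^+ (m + k).+1]exprS.
set A := (mu ^+ 2) ^+ k; set c := imm_const mu EI in E *; set r := related_const in E *.
set B := mu ^+ (m + k) in mk1 *; set D := mu ^+ m.
have -> : mu ^+ 2 * A * (D * (c + r)) - mu * B * r -
   (mu ^+ 2 * (A * (D * (c + r)) - B * r + EI) + s2 * (B * c)) =
   B * (r * (mu * (mu - 1))) - mu ^+ 2 * EI - B * (s2 * c) by ring.
rewrite E mulrDr -addrA -opprD.
have -> : B * (mu ^+ 2 * EI) + B * (s2 * c) - (mu ^+ 2 * EI + B * (s2 * c)) =
   (B - 1) * (mu ^+ 2 * EI) by ring.
by rewrite mulr_ge0 ?subr_ge0 // mulr_ge0 ?sqr_ge0 // (EI_ge0 I1).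
Qed.

(** In [related_fluctuation] the choice [c = rho ^+ n] makes both terms of order
    [rho ^- n] relative to [mu ^+ (2 * n)]. *)
Lemma cvg_related :
  {ae P, forall w, cvgn (fun n => related R (T w) m n / (mu ^+ 2) ^+ n)}.
Proof.
pose r := rho mu; have r1 : 1 < r := rho_gt1 mu1.
have r0 : 0 < r := rho_gt0 mu1.
have mur n : mu ^+ n = r ^+ n * r ^+ n := mu_pow mu1 n.
have mu20 : 0 < mu ^+ 2 by rewrite exprn_gt0.
have dR n := @determined_related n; have dp := @determined_present_related.
have dk := determined_kin_noise.
have mu_n n : measurable_fun [set: Omega] (fun w => related R (T w) m n / (mu ^+ 2) ^+ n).
  apply: (@measurable_determined _ _ _ _ _ _ n _ _ (fun t => related R t m n / (mu ^+ 2) ^+ n)).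
  by move=> t t' a; rewrite (dR _ _ _ a).
pose c := imm_const mu EI.
have c0 : 0 <= c := imm_const_ge0 mu1 I1.
pose C2 := mu ^+ m * (c + related_const) + EI.
pose C := (1 + mu) * s2 * c + mu * C2 + EI.
have rc0 : 0 <= related_const.
  rewrite /related_const divr_ge0 ?mulr_ge0 ?subr_ge0 // ?(ltW mu1) //.
  by rewrite addr_ge0 // mulr_ge0 ?(EI_ge0 I1) ?sqr_ge0 // ltW.
have EI0 := EI_ge0 I1.
have C20 : 0 <= C2 by rewrite addr_ge0 // mulr_ge0 ?addr_ge0 // exprn_ge0.
apply: (@ae_cvg_increments _ _ _ _ _ m C r^-1 mu_n (rho_inv01 mu1)) => n mn.
have rn0 : 0 < r ^+ n by rewrite exprn_gt0.
have rn1 : 1 <= r ^+ n by rewrite exprn_ege1 // ltW.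
have m2n0 k : 0 < (mu ^+ 2) ^+ k by rewrite exprn_gt0.
have iv k : 0 <= ((mu ^+ 2) ^+ k)^-1 by rewrite invr_ge0 ltW.
have m2 : (mu ^+ 2) ^+ n = r ^+ n * r ^+ n * (r ^+ n * r ^+ n).
  by rewrite -exprM mulnC exprM expr2 mur.
have bR : (\int[P]_w (present_related n (T w))%:E <= ((mu ^+ 2) ^+ n * C2)%:E)%E.
  have := integral_related_bound (n - m); rewrite subnKC // => bn.
  rewrite integral_present_related //; apply: (le_trans (leeD2r _ bn)).
  rewrite -EFinD lee_fin /C2 [leRHS]mulrDr lerD //; last first.
    by rewrite ler_peMl // exprn_ege1 // expr2 mulr_ege1 // ltW.
  rewrite lerBlDr; apply: (@le_trans _ _ ((mu ^+ 2) ^+ n * (mu ^+ m * (c + related_const)))).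
    rewrite ler_wpM2r ?mulr_ge0 ?addr_ge0 ?exprn_ge0 //.
    by rewrite ler_weXn2l // ?leq_subr // expr2 mulr_ege1 // ltW.
  by rewrite lerDl mulr_ge0 // exprn_ge0.
have bK : (\int[P]_w (kin_noise n (T w))%:E <= (s2 * (mu ^+ n * c))%:E)%E.
  rewrite (integral_noise_form hxi hind s20 M1 M2 (@determined_kin n)); last 2 first.
  - by move=> t j; rewrite /kin.
  - by move=> t y; exact: kin_form_ge0.
  have -> : (\int[P]_w (\sum_(j < present (T w) n) kin n (T w) j j * s2)%:E =
      s2%:E * \int[P]_w (present (T w) n)%:R%:E)%E.
    rewrite -ge0_integralZl_EFin //; last first.
      by apply: (@mT n (fun t => (present t n)%:R)) => t t' a; have [_ ->] := agree_born a (leqnn n).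
    apply: eq_integral => w _; rewrite -EFinM (eq_bigr (fun=> s2)).
      by rewrite sumr_const card_ord mulr_natr.
    by move=> j _; rewrite /kin eqxx mul1r.
  by rewrite EFinM lee_wpmul2l ?lee_fin //; exact: integral_present.
pose a1 := ((mu ^+ 2) ^+ n.+1)^-1 * (1 + mu * r ^+ n).
pose a2 := ((mu ^+ 2) ^+ n.+1)^-1 * (mu / r ^+ n).
pose a3 := ((mu ^+ 2) ^+ n)^-1.
have a10 : 0 <= a1 by rewrite mulr_ge0 // addr_ge0 // mulr_ge0 // ltW.
have a30 : 0 <= a3 := iv n.
have a20 : 0 <= a2 by rewrite mulr_ge0 // divr_ge0 // ltW.
apply: (@le_trans _ _ (\int[P]_w (a1%:E * (kin_noise n (T w))%:E +
    (a2%:E * (present_related n (T w))%:E + a3%:E * (immigrants (T w) n)%:R%:E)))%E).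
  have dI : determined n (fun t => (immigrants t n)%:R : R) by move=> t t' [-> //].
  apply: ge0_le_integral => //.
  - apply: (@mT n.+1 (fun t => `|related R t m n.+1 / (mu ^+ 2) ^+ n.+1 - related R t m n / (mu ^+ 2) ^+ n|)).
    by move=> t t' a; rewrite (dR _ _ _ a) (determined_leq (leqnSn n) (dR n) a).
  - apply: emeasurable_funD; first by apply: measurable_funeM; exact: mT (dk n).
    apply: emeasurable_funD; first by apply: measurable_funeM; exact: mT (dp n).
    by apply: measurable_funeM; exact: mT dI.
  move=> w _; rewrite -!EFinM -!EFinD lee_fin.
  have := related_fluctuation (T w) mn rn0.
  set x := related R _ m n.+1; set y := present_related n _ => fl.
  have -> : x / (mu ^+ 2) ^+ n.+1 - related R (T w) m n / (mu ^+ 2) ^+ n =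
    ((mu ^+ 2) ^+ n.+1)^-1 * (x - mu ^+ 2 * y) + a3 * (immigrants (T w) n)%:R.
    rewrite /y present_relatedE // /a3 exprS; field.
    by rewrite !gt_eqF.
  apply: (le_trans (ler_normD _ _)); rewrite addrA lerD //.
    rewrite normrM (ger0_norm (iv _)); apply: (le_trans (ler_wpM2l (iv n.+1) fl)).
    by rewrite le_eqVlt /a1 /a2; apply/orP; left; apply/eqP; ring.
  by rewrite ger0_norm //; apply: mulr_ge0 => //; exact: iv.
have dI : determined n (fun t => (immigrants t n)%:R : R) by move=> t t' [-> //].
rewrite ge0_integralD //; first last.
- apply: emeasurable_funD; first by apply: measurable_funeM; exact: mT (dp n).
  by apply: measurable_funeM; exact: mT dI.
- move=> w _; rewrite -!EFinM -EFinD lee_fin.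
  by apply: addr_ge0; apply: mulr_ge0; rewrite ?present_related_ge0.
- by apply: measurable_funeM; exact: mT (dk n).
- by move=> w _; rewrite -EFinM lee_fin mulr_ge0 // kin_noise_ge0.
rewrite ge0_integralD //; first last.
- by apply: measurable_funeM; exact: mT dI.
- by move=> w _; rewrite -EFinM lee_fin mulr_ge0.
- by apply: measurable_funeM; exact: mT (dp n).
- by move=> w _; rewrite -EFinM lee_fin mulr_ge0 // present_related_ge0.
rewrite !ge0_integralZl_EFin //; first last.
- exact: mT (dk n).
- by move=> w _; rewrite lee_fin kin_noise_ge0.
- exact: mT (dp n).
- by move=> w _; rewrite lee_fin present_related_ge0.
- exact: mT dI.
rewrite (integral_imm xi himm I1).
apply: (@le_trans _ _ (a1%:E * (s2 * (mu ^+ n * c))%:E +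
   (a2%:E * ((mu ^+ 2) ^+ n * C2)%:E + a3%:E * EI%:E))%E).
  by apply: leeD; [|apply: leeD] => //; apply: lee_wpmul2l; rewrite ?lee_fin.
rewrite -!EFinM -!EFinD lee_fin /C !mulrDl -addrA exprVn.
apply: lerD; last apply: lerD.
- have -> : 1 * s2 * c / r ^+ n + mu * s2 * c / r ^+ n = (1 + mu) / r ^+ n * (s2 * c) by ring.
  have -> : a1 * (s2 * (mu ^+ n * c)) = a1 * mu ^+ n * (s2 * c) by ring.
  apply: ler_wpM2r; first exact: mulr_ge0.
  rewrite /a1 [(mu ^+ 2) ^+ n.+1]exprS m2 (mur n).
  set x := r ^+ n in rn0 rn1 *.
  have -> : (mu ^+ 2 * (x * x * (x * x)))^-1 * (1 + mu * x) * (x * x) =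
      (1 + mu * x) / (mu ^+ 2 * x) / x by field; rewrite !gt_eqF.
  rewrite ler_wpM2r ?invr_ge0 ?(ltW rn0) // ler_pdivrMr ?mulr_gt0 //.
  apply: (@le_trans _ _ ((1 + mu) * x)).
    by rewrite mulrDl mul1r lerD2r.
  rewrite ler_wpM2l ?addr_ge0 // ler_peMl ?(ltW rn0) //.
  by rewrite expr2; apply: mulr_ege1; exact: ltW.
- have -> : a2 * ((mu ^+ 2) ^+ n * C2) = C2 / (mu * r ^+ n).
    by rewrite /a2 [(mu ^+ 2) ^+ n.+1]exprS; field; rewrite !gt_eqF.
  rewrite invfM mulrA ler_wpM2r ?invr_ge0 ?(ltW rn0) // ler_pdivrMr //.
  by rewrite mulrAC ler_peMl //; apply: mulr_ege1; exact: ltW.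
rewrite /a3 mulrC ler_wpM2l // m2 lef_pV2 ?posrE ?mulr_gt0 //.
by rewrite -mulrA ler_peMr ?(ltW rn0) //; do 2!apply: mulr_ege1 => //.
Qed.

End RelatedPairs.

(** * Positivity of the limits *)

Section Positivity.
Context (R : realType) (d : measure_display) (Omega : measurableType d).
Variables (P : probability Omega R) (M I : {RV P >-> nat}).
Variables (imm : nat -> {RV P >-> nat}) (xi : nat -> nat -> {RV P >-> nat}).
Hypothesis himm : forall n, same_law (imm n) I.
Hypothesis hxi : forall n j, same_law (xi n j) M.
Hypothesis hind : mutually_independent (all_variables imm xi).
Variables (mu s2 EI : R).
Hypotheses (mu1 : 1 < mu) (s20 : 0 <= s2).
Hypothesis M1 : (\int[P]_w (M w)%:R%:E = mu%:E)%E.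
Hypothesis M2 : (\int[P]_w ((M w)%:R ^+ 2)%:E = (s2 + mu ^+ 2)%:E)%E.
Hypothesis I1 : (\int[P]_w (I w)%:R%:E = EI%:E)%E.
Hypothesis M0 : P [set w | M w = 0%N] = 0.
Hypothesis I0 : P [set w | I w = 0%N] = 0.

Local Notation T := (process_tree imm xi).

Let mu_gt0 : 0 < mu. Proof. exact: lt_trans mu1. Qed.
Let mu_ge0 : 0 <= mu. Proof. exact: ltW. Qed.
Let mT (n : nat) (F : family_tree -> R) :
  determined n F -> measurable_fun [set: Omega] (fun w => (F (T w))%:E).
Proof. by move=> dF; apply: measurable_EFin_fun; exact: measurable_determined dF. Qed.

Definition fertile (t : family_tree) : Prop :=
  (forall n, 0 < immigrants t n)%N /\ (forall n j, 0 < children t n j)%N.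

Lemma ae_fertile : {ae P, forall w, fertile (T w)}.
Proof.
have pos (Z Y : {RV P >-> nat}) : same_law Z Y -> P [set w | Y w = 0%N] = 0 ->
    {ae P, forall w, (0 < Z w)%N}.
  move=> ZY Y0; exists (Z @^-1` [set 0%N]); split.
  - exact: measurable_RV_fiber.
  - by rewrite -[LHS]/(distribution P Z [set 0%N]) ZY.
  - by move=> w /= /negP; rewrite -eqn0Ngt => /eqP.
have imm_pos := ae_foralln (fun n => pos _ _ (himm n) I0).
have xi_pos := ae_foralln (fun n => ae_foralln (fun j => pos _ _ (hxi n j) M0)).
by move: imm_pos xi_pos; apply: filterS2 => w; split.
Qed.

(** Almost surely these individuals already make up a positive proportion of the population,
    and none of them is related to a descendant of the immigrants of
    generation 0. *)
Definition later (t : family_tree) (n j : nat) : bool := ancestor t n j 0 == None.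

Lemma determined_later (n : nat) : determined n (fun t => later t n).
Proof. by move=> t t' a; apply/funext => j; rewrite /later (agree_ancestor _ _ a). Qed.

Lemma later_parent (m : nat) (t : family_tree) (n c : nat) :
  (m <= n)%N -> (c < born t n.+1)%N -> later t n.+1 c = later t n (parent t n c).
Proof. by move=> _ cb; rewrite /later ancestorS. Qed.

(** Every generation brings a new immigrant and nobody is childless. *)
Lemma later_growth (t : family_tree) (n : nat) : fertile t ->
  n%:R <= born_sel R later n.+1 t.
Proof.
move=> [ip cp]; elim: n => [|n IH]; first exact: born_sel_ge0.
have step k : present_sel R later k t <= born_sel R later k.+1 t.
  rewrite (born_selS R (later_parent (m := 0)) t (leq0n k)) /present_sel.
  by apply: ler_sum => j _; rewrite ler_peMr // ler1n cp.
apply: le_trans (step n.+1); rewrite present_selE -(natr1 n) lerD //.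
rewrite (bigD1 (Ordinal (ip n.+1))) //= addn0 /later ancestor_immigrant //=.
by rewrite lerDl sumr_ge0.
Qed.

(** The weight [psi], the inverse of the population of generation [m + 1], makes
    the left side of [extinction_bound] the probability of slow growth. This
    population is almost surely at least [m] by [later_growth], so the weight
    may be truncated at [1 / m]; with [eps] small and then [m] large the right
    side vanishes. *)
Lemma ae_later_pos :
  {ae P, forall w, 0 < limn (fun n => born_sel R later n (T w) / mu ^+ n)}.
Proof.
pose u n w := born_sel R later n (T w) / mu ^+ n.
have mu_n n : measurable_fun [set: Omega] (u n).
  apply: (@measurable_determined _ _ _ _ _ _ n _ _ (fun t => born_sel R later n t / mu ^+ n)).
  by move=> t t' a; rewrite (determined_born_sel R determined_later a).
have cu : {ae P, forall w, cvgn (u ^~ w)}.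
  apply: (@cvg_born_sel _ _ _ P M I imm xi himm hxi hind mu s2 EI mu1 s20 M1 M2 I1 later 0
    determined_later (@later_parent 0) 0).
  by under eq_integral do rewrite /born_sel big_ord0; rewrite integral0.
have [N [mN N0 subN]] : {ae P, forall w, cvgn (u ^~ w) /\ fertile (T w)}.
  by move: cu ae_fertile; apply: filterS2.
have good w : ~ N w -> cvgn (u ^~ w) /\ fertile (T w).
  by move=> Nw; apply: contrapT => /subN.
pose E := [set w | limn (u ^~ w) = 0] `&` ~` N.
have mE : measurable E.
  apply: measurableI; last exact: measurableC.
  rewrite -[X in measurable X]setTI -[X in _ `&` X]/((fun w => limn (u ^~ w)) @^-1` [set 0]).
  by apply: measurable_limn.
pose q := (rho mu)^-1; have /andP[q0 q1] : 0 < q < 1 := rho_inv01 mu1.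
have q1' : 0 < 1 - q by rewrite subr_gt0.
pose c0 := imm_const mu EI; have c00 : 0 <= c0 := imm_const_ge0 mu1 I1.
have bound (m : nat) eps : (0 < m)%N -> 0 < eps ->
    (P E <= ((s2 * (1 + c0) / m%:R / eps + eps) / (1 - q))%:E)%E.
  move=> m0 eps0; have m0' : 0 < m%:R :> R by rewrite ltr0n.
  have m1' : 1 <= m%:R :> R by rewrite ler1n.
  have A0 t := born_sel_ge0 R later m.+1 t.
  pose psi t : R := (Num.max m%:R (born_sel R later m.+1 t))^-1.
  have psim t : m%:R <= Num.max m%:R (born_sel R later m.+1 t) by rewrite le_max lexx.
  have psi0 t : 0 < psi t by rewrite invr_gt0 (lt_le_trans m0').
  have psi1 t : psi t <= m%:R^-1 by rewrite lef_pV2 ?posrE // (lt_le_trans m0').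
  have im0 : 0 <= (m%:R^-1 : R) by rewrite invr_ge0 ltW.
  have psiA t : psi t * born_sel R later m.+1 t <= 1.
    rewrite mulrC ler_pdivrMr ?(lt_le_trans m0') // mul1r.
    by rewrite le_max lexx orbT.
  have dpsi : determined m.+1 psi.
    by move=> t t' a; rewrite /psi (determined_born_sel R determined_later a).
  have psiK t : psi t ^+ 2 <= m%:R^-1.
    rewrite expr2; apply: (@le_trans _ _ (m%:R^-1 * m%:R^-1)).
      by apply: ler_pM => //; exact: ltW.
    by rewrite ler_piMl // invf_le1.
  have psib : (\int[P]_w (psi (T w) ^+ 2 * born_sel R later m.+1 (T w))%:E <= (m%:R^-1)%:E)%E.
    apply: (@le_trans _ _ (\int[P]_w (cst (m%:R^-1)%:E w))%E); last first.
      by rewrite (integral_cst P measurableT) [X in (_ * X)%E]probability_setT mule1.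
    apply: ge0_le_integral => //.
    - by move=> w _; rewrite lee_fin mulr_ge0 // sqr_ge0.
    - apply: (@mT m.+1 (fun t => psi t ^+ 2 * born_sel R later m.+1 t)) => t t' a.
      by rewrite (dpsi _ _ a) (determined_born_sel R determined_later a).
    - move=> w _; rewrite lee_fin expr2 -mulrA -[leRHS]mulr1.
      by apply: ler_pM => //; [exact: ltW|rewrite mulr_ge0 // ltW].
  have cE w : E w -> born_sel R later n (T w) / mu ^+ n @[n --> \oo] --> 0.
    by move=> [/= <- /good[cw _]].
  have := @extinction_bound _ _ _ P M I imm xi himm hxi hind mu s2 EI mu1 s20 M1 M2 I1 later m.+1
    determined_later (@later_parent m.+1) E psi m%:R^-1 m%:R^-1 eps mE cE dpsi
    (fun t => ltW (psi0 t)) psiK psib eps0.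
  have -> : (\int[P]_(w in E) (psi (T w) * born_sel R later m.+1 (T w))%:E = P E)%E.
    rewrite -[RHS]mul1e -(integral_cst P mE 1%E).
    apply: eq_integral => w /set_mem[_ /good[_ fw]]; congr EFin.
    rewrite /psi max_r ?later_growth // mulVf // gt_eqF //.
    exact: lt_le_trans (later_growth m fw).
  move=> H; apply: (le_trans H); rewrite lee_fin ler_wpM2r ?invr_ge0 ?(ltW q1') //.
  rewrite lerD2r ler_wpM2r ?invr_ge0 ?(ltW eps0) //.
  by rewrite le_eqVlt /c0; apply/orP; left; apply/eqP; ring.
have PE0 : P E = 0.
  have fP : P E \is a fin_num by exact: fin_num_measure.
  apply/eqP; rewrite eq_le measure_ge0 andbT -(fineK fP) lee_fin leNgt; apply/negP => p0.
  set p := fine (P E) in p0.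
  pose eps := p * (1 - q) / 4; have eps0 : 0 < eps by rewrite /eps divr_gt0 // mulr_gt0.
  pose C := s2 * (1 + c0); have C0 : 0 <= C by rewrite mulr_ge0 // addr_ge0.
  pose m := (Num.truncn (C / (eps * eps))).+1.
  have m0 : 0 < m%:R :> R by rewrite ltr0n.
  have Cm : C / m%:R / eps <= eps.
    rewrite ler_pdivrMr // ler_pdivrMr // mulrC -ler_pdivrMr ?mulr_gt0 //.
    exact/ltW/Num.Theory.truncnS_gt.
  have := bound m eps isT eps0; rewrite -(fineK fP) lee_fin -/p -/C.
  rewrite ler_pdivlMr // => H.
  have : p * (1 - q) <= eps + eps by apply: (le_trans H); rewrite lerD2r.
  have := mulr_gt0 p0 q1'; rewrite /eps; lra.
apply: (@filterS _ _ _ (fun w => ~ (E `|` N) w)); last first.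
  exists (E `|` N); split => [||w /contrapT //]; first exact: measurableU.
  by apply/null_set_setU.
move=> w ENw; have Nw : ~ N w by move=> ?; apply: ENw; right.
have [cw _] := good w Nw.
rewrite lt_neqAle; apply/andP; split.
  by apply/eqP => /esym L0; apply: ENw; left.
by apply: limr_ge => //; apply: nearW => n; rewrite divr_ge0 ?born_sel_ge0 // exprn_ge0.
Qed.

Definition first_line (t : family_tree) (n j : nat) : bool := ancestor t n j 0 == Some 0%N.

Lemma determined_first_line (n : nat) : determined n (fun t => first_line t n).
Proof. by move=> t t' a; apply/funext => j; rewrite /first_line (agree_ancestor _ _ a). Qed.

Lemma first_line_parent (m : nat) (t : family_tree) (n c : nat) :
  (m <= n)%N -> (c < born t n.+1)%N -> first_line t n.+1 c = first_line t n (parent t n c).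
Proof. by move=> _ cb; rewrite /first_line ancestorS. Qed.

Lemma integral_first_line (n : nat) :
  (\int[P]_w (born_sel R first_line n.+1 (T w))%:E = (mu ^+ n.+1)%:E)%E.
Proof.
have step k : (\int[P]_w (born_sel R first_line k.+1 (T w))%:E =
    mu%:E * \int[P]_w (present_sel R first_line k (T w))%:E)%E.
  have := @integral_born_selS _ _ _ P M imm xi hxi hind mu mu1 M1 first_line 0
    determined_first_line (@first_line_parent 0) (fun=> 1) 1 (fun _ _ _ => erefl) _ k (leq0n k).
  under eq_integral do rewrite mul1r.
  by under [in X in (_ * X)%E]eq_integral do rewrite mul1r; apply => t; rewrite lexx ler01.
elim: n => [|n IH].
  rewrite step expr1 -[RHS]mule1; congr (_ * _)%E.
  rewrite -[RHS](@probability_setT _ _ _ P) -[RHS]mul1e -(integral_cst P measurableT 1%E).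
  apply: ae_eq_integral => //.
    apply: (@mT 0 (present_sel R first_line 0)).
    exact: (determined_present_sel R determined_first_line).
  move: ae_fertile; apply: filterS => w [ip _] _; congr EFin.
  rewrite /present_sel /present /= add0n.
  rewrite (bigD1 (Ordinal (ip 0))) //= big1 ?addr0 // => j j0.
  by rewrite /first_line /= ; case: eqP => // -[E]; case/eqP: j0; apply: val_inj.
rewrite step exprS EFinM -IH; congr (_ * _)%E; apply: eq_integral => w _.
rewrite present_selE big1 ?addr0 // => l _.
by rewrite /first_line ancestor_immigrant ?leq_addr.
Qed.

(** If slow growth were almost sure, [extinction_bound] with a large constant
    [eps] would keep the mean size of the line bounded, whereas this mean is
    [mu ^+ n]. *)
Lemma first_line_not_extinct :
  ~ {ae P, forall w, born_sel R first_line n (T w) / mu ^+ n @[n --> \oo] --> 0}.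
Proof.
move=> [N [mN N0 subN]].
have mE : measurable (~` N) by exact: measurableC.
have cE w : (~` N) w -> born_sel R first_line n (T w) / mu ^+ n @[n --> \oo] --> 0.
  by move=> Nw; apply: contrapT => /subN.
pose q := (rho mu)^-1; have /andP[q0 q1] : 0 < q < 1 := rho_inv01 mu1.
have q1' : 0 < 1 - q by rewrite subr_gt0.
pose c0 := imm_const mu EI; have c00 : 0 <= c0 := imm_const_ge0 mu1 I1.
have bound (n : nat) eps : 0 < eps ->
    mu ^+ n.+1 * (1 - q) <= s2 * (mu ^+ n.+1 + c0) / eps + eps.
  move=> eps0; rewrite -ler_pdivlMr // -lee_fin -integral_first_line.
  have db := determined_born_sel R determined_first_line (n := n.+1).
  have mb := mT db.
  have := @extinction_bound _ _ _ P M I imm xi himm hxi hind mu s2 EI mu1 s20 M1 M2 I1 first_line n.+1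
    determined_first_line (@first_line_parent n.+1) (~` N) (fun=> 1) 1 (mu ^+ n.+1) eps mE cE
    (fun _ _ _ => erefl) (fun=> ler01).
  rewrite mul1r => /(_ _ _ eps0).
  have -> : (\int[P]_(w in ~` N) (1 * born_sel R first_line n.+1 (T w))%:E =
      \int[P]_w (born_sel R first_line n.+1 (T w))%:E)%E.
    rewrite [RHS](ge0_negligible_integral mN) // ?setTD.
      by apply: eq_integral => w _; rewrite mul1r.
    by move=> w _; rewrite lee_fin born_sel_ge0.
  apply => [t|]; first by rewrite expr1n.
  by under eq_integral do rewrite expr1n mul1r; rewrite integral_first_line.
pose C := s2 * (1 + c0); have C0 : 0 <= C by rewrite mulr_ge0 // addr_ge0.
pose eps := 2 * C / (1 - q) + 1.
have eps0 : 0 < eps by rewrite ltr_wpDl //; apply: divr_ge0; [exact: mulr_ge0|exact: ltW].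
have Ceps : C / eps <= (1 - q) / 2.
  rewrite ler_pdivrMr // /eps mulrDr mulr1 -subr_ge0.
  have -> : (1 - q) / 2 * (2 * C / (1 - q)) + (1 - q) / 2 - C = (1 - q) / 2.
    by field; rewrite gt_eqF.
  by rewrite divr_ge0 // ltW.
(* Bernoulli's inequality. *)
have bern k : 1 + k%:R * (mu - 1) <= mu ^+ k.
  elim: k => [|k IH]; first by rewrite mul0r addr0 expr0.
  rewrite exprS; apply: (le_trans _ (ler_wpM2l mu_ge0 IH)).
  have : 0 <= k%:R * (mu - 1) * (mu - 1) by rewrite !mulr_ge0 // subr_ge0 ltW.
  by rewrite -natr1; nra.
have le_eps n : mu ^+ n.+1 * (1 - q) <= 2 * eps.
  have mn1 : 1 <= mu ^+ n.+1 by rewrite exprn_ege1 // ltW.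
  have := bound n eps eps0.
  have : s2 * (mu ^+ n.+1 + c0) / eps <= mu ^+ n.+1 * ((1 - q) / 2).
    apply: (@le_trans _ _ (mu ^+ n.+1 * (C / eps))).
      rewrite mulrA ler_wpM2r ?invr_ge0 ?(ltW eps0) // /C mulrCA ler_wpM2l // mulrDr mulr1.
      by rewrite lerD2l ler_peMl.
    by rewrite ler_wpM2l // exprn_ge0.
  by rewrite mulrA; lra.
pose k := Num.truncn (2 * eps / ((1 - q) * (mu - 1))).
have := le_eps k; apply/negP; rewrite -ltNge.
have m10 : 0 < mu - 1 by rewrite subr_gt0.
apply: (@lt_le_trans _ _ ((1 + k.+1%:R * (mu - 1)) * (1 - q))); last first.
  by rewrite ler_wpM2r ?bern // ltW.
have := truncnS_gt (2 * eps / ((1 - q) * (mu - 1))).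
rewrite ltr_pdivrMr ?mulr_gt0 // -/k; nra.
Qed.

End Positivity.

(** * The limits of one tree *)

Lemma cvg_eq_from (T : topologicalType) (k : nat) (u v : nat -> T) (l : T) :
  (forall n, (k <= n)%N -> u n = v n) -> v n @[n --> \oo] --> l -> u n @[n --> \oo] --> l.
Proof.
move=> uv; apply: cvg_trans; apply: near_eq_cvg; near=> n; rewrite uv //.
by near: n; exact: nbhs_infty_ge.
Unshelve. all: by end_near. Qed.

Section LimitsOfOneTree.
Variables (R : realType) (mu : R) (t : family_tree) (m : nat).
Hypothesis mu1 : 1 < mu.

Let mun0 n : mu ^+ n != 0. Proof. by rewrite expf_neq0 // gt_eqF // (lt_trans _ mu1). Qed.

Lemma cvg_sum_ord (p : nat) (u : nat -> nat -> R) (l : nat -> R) :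
  (forall i, u i n @[n --> \oo] --> l i) ->
  \sum_(i < p) u i n @[n --> \oo] --> \sum_(i < p) l i.
Proof.
move=> ul; elim: p => [|p IH].
  by rewrite big_ord0; under eq_fun do rewrite big_ord0; exact: cvg_cst.
by rewrite big_ord_recr /=; under eq_fun do rewrite big_ord_recr /=; exact: cvgD.
Qed.

Lemma mu_shift (n : nat) (x : R) : (m <= n)%N -> x / mu ^+ (n - m) = mu ^+ m * (x / mu ^+ n).
Proof. by move=> mn; rewrite -{2}(subnK mn) exprD; field; rewrite !mun0. Qed.

Lemma mu2_shift (n : nat) (x : R) : (m <= n)%N ->
  x / mu ^+ (2 * (n - m)) = (mu ^+ 2) ^+ m * (x / (mu ^+ 2) ^+ n).
Proof. by move=> mn; rewrite exprM -{2}(subnK mn) exprD; field; rewrite -!exprM !mun0. Qed.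

Variables (Ninf rinf : R) (c : nat -> R).
Hypothesis hN : (born t n)%:R / mu ^+ n @[n --> \oo] --> Ninf.
Hypothesis hR : related R t m n / (mu ^+ 2) ^+ n @[n --> \oo] --> rinf.
Hypothesis hD : forall l, (descendants t m l n)%:R / mu ^+ n @[n --> \oo] --> c l.

Lemma W_limit (l : nat) : W_ mu t m l = mu ^+ m * c l.
Proof.
apply: cvg_lim => //; apply: (cvg_eq_from (k := m)) => [n mn|]; first exact: mu_shift.
by apply: cvgMr; exact: hD.
Qed.

Lemma X_limit : X_ mu t m = mu ^+ m * (Ninf - \sum_(l < born t m) c l).
Proof.
apply: cvg_lim => //.
apply: (cvg_eq_from (k := m) (v := fun n => mu ^+ m * ((born t n)%:R / mu ^+ n -
    \sum_(l < born t m) (descendants t m l n)%:R / mu ^+ n))) => [n mn|].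
  rewrite mu_shift // -mulr_suml -mulrBl; congr (_ * (_ / _)).
  by rewrite (born_partition R t mn) addrC addKr.
apply: cvgMr; apply: cvgB => //.
exact: (@cvg_sum_ord _ (fun l n => (descendants t m l n)%:R / mu ^+ n) c hD).
Qed.

Lemma V_limit : V_ mu t m = (mu ^+ 2) ^+ m * (rinf - \sum_(l < born t m) c l ^+ 2).
Proof.
apply: cvg_lim => //.
apply: (cvg_eq_from (k := m) (v := fun n => (mu ^+ 2) ^+ m * (related R t m n / (mu ^+ 2) ^+ n -
    \sum_(l < born t m) ((descendants t m l n)%:R / mu ^+ n) ^+ 2))) => [n mn|].
  rewrite mu2_shift //; congr (_ * _).
  have -> : \sum_(l < born t m) ((descendants t m l n)%:R / mu ^+ n) ^+ 2 =
      (\sum_(l < born t m) (descendants t m l n)%:R ^+ 2) / (mu ^+ 2) ^+ n :> R.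
    by rewrite mulr_suml; apply: eq_bigr => l _; rewrite expr_div_n -!exprM mulnC.
  by rewrite -mulrBl; congr (_ / _); rewrite (related_partition R t mn) addrC addKr.
apply: cvgMr; apply: cvgB => //.
apply: (@cvg_sum_ord _ (fun l n => ((descendants t m l n)%:R / mu ^+ n) ^+ 2)
  (fun l => c l ^+ 2)) => l.
by under eq_fun do rewrite expr2; rewrite expr2; apply: cvgM; exact: hD.
Qed.

(** By the partition into founders, the numerator and the denominator are the
    rates of [related] and [born]: in [V_] and [X_] the contributions of the
    individuals born in generation [m] are exactly what is missing. *)
Lemma limit_ratioE : limit_ratio mu t m = rinf / Ninf ^+ 2.
Proof.
rewrite /limit_ratio X_limit V_limit.
under eq_bigr do rewrite W_limit exprMn.
under [in X in _ / X]eq_bigr do rewrite W_limit.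
have -> : mu ^+ 2 ^+ m = mu ^+ m ^+ 2 by rewrite -!exprM mulnC.
rewrite -!mulr_sumr -!mulrDr [_ + (rinf - _)]addrC subrK [_ + (Ninf - _)]addrC subrK.
by rewrite exprMn -mulf_div divff ?mul1r // -exprM mun0.
Qed.

(** The probability, given the tree, that two individuals drawn from generation
    [n] have a common ancestor in generation [k] or later. *)
Definition pair_ratio (k : nat) (s : family_tree) (n : nat) : R :=
  (related R s k n - (born s n)%:R) / (born s n * (born s n).-1)%:R.

Lemma pair_ratio_cvg : Ninf != 0 -> pair_ratio m t n @[n --> \oo] --> rinf / Ninf ^+ 2.
Proof.
move=> Nn0; have mV n : (mu^-1) ^+ n = (mu ^+ n)^-1 by rewrite exprVn.
have mu_inv : (mu^-1) ^+ n @[n --> \oo] --> 0.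
  apply: cvg_expr; rewrite ger0_norm ?invr_ge0 ?(ltW (lt_trans ltr01 mu1)) //.
  by rewrite invf_lt1 // (lt_trans ltr01 mu1).
pose x n : R := (born t n)%:R / mu ^+ n.
have -> : pair_ratio m t = (fun n => (related R t m n / (mu ^+ 2) ^+ n - x n * (mu^-1) ^+ n) /
    (x n * (x n - (mu^-1) ^+ n))).
  apply/funext => n; rewrite /pair_ratio natrM.
  have -> : (born t n)%:R * (born t n).-1%:R = (born t n)%:R * ((born t n)%:R - 1) :> R.
    by case: (born t n) => [|k]; rewrite ?mul0r // -(natrB _ (ltn0Sn k)) subn1.
  set N := (born t n)%:R; set r := related _ _ _ _.
  have -> : r / mu ^+ 2 ^+ n - x n * mu^-1 ^+ n = (r - N) / (mu ^+ n * mu ^+ n).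
    by rewrite /x mV -/N -exprM mulnC exprM expr2; field; rewrite mun0.
  have -> : x n * (x n - mu^-1 ^+ n) = N * (N - 1) / (mu ^+ n * mu ^+ n).
    by rewrite /x mV -/N; field; rewrite mun0.
  rewrite invf_div mulrACA [X in _ = X](_ : _ = (r - N) / (N * (N - 1)) * ((mu ^+ n * mu ^+ n)^-1 * (mu ^+ n * mu ^+ n))); last by ring.
  by rewrite mulVf ?mulr1 // mulf_neq0.
have cx : x n * (mu^-1) ^+ n @[n --> \oo] --> 0 by rewrite -(mulr0 Ninf); exact: cvgM.
rewrite -[rinf]subr0 expr2 -[X in _ / (Ninf * X)]subr0.
apply: cvgM; first exact: cvgB.
apply: cvgV; first by rewrite subr0 mulf_neq0.
by apply: cvgM => //; exact: cvgB.
Qed.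

Lemma pair_ratio_bounds (k : nat) (s : family_tree) (n : nat) : 0 <= pair_ratio k s n <= 1.
Proof.
have lo : (born s n)%:R <= related R s k n.
  have -> : (born s n)%:R = \sum_(i < born s n) (1 : R) by rewrite sumr_const card_ord.
  apply: ler_sum => i _; rewrite (bigD1 i) //= eqxx lerDl.
  exact: sumr_ge0.
have hi : related R s k n <= (born s n * born s n)%:R.
  rewrite natrM; have -> : (born s n)%:R * (born s n)%:R =
      \sum_(i < born s n) \sum_(j < born s n) (1 : R).
    by rewrite !sumr_const !card_ord -[RHS]mulr_natl.
  by apply: ler_sum => i _; apply: ler_sum => j _; case: eqP.
rewrite /pair_ratio; apply/andP; split; first by rewrite divr_ge0 // subr_ge0.
have [->|d0] := eqVneq ((born s n * (born s n).-1)%:R : R) 0; first by rewrite invr0 mulr0.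
rewrite ler_pdivrMr ?mul1r; last by rewrite lt_neqAle eq_sym d0 ler0n.
rewrite lerBlDr; apply: (le_trans hi); rewrite -natrD ler_nat.
by case: (born s n) => // j /=; rewrite mulnS addnC.
Qed.

Lemma pair_ratioE (k : nat) (s : family_tree) (n : nat) :
  \sum_(i < born s n) \sum_(j < born s n)
    ((i : nat) != j)%:R * (founder s k n i == founder s k n j)%:R * ((born s n * (born s n).-1)%:R)^-1
  = pair_ratio k s n.
Proof.
rewrite /pair_ratio /related mulrBl [in X in _ - X](_ : (born s n)%:R = \sum_(i < born s n) (1 : R)); last first.
  by rewrite sumr_const card_ord.
rewrite !mulr_suml -sumrB; apply: eq_bigr => i _.
rewrite [X in X / _](bigD1 i) //= [LHS](bigD1 i) //= !eqxx /= mul0r mul0r add0r mulrDl addrC addKr.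
rewrite mulr_suml; apply: eq_bigr => j ji.
by rewrite -val_eqE /= eq_sym in ji; rewrite ji mul1r.
Qed.

End LimitsOfOneTree.

(** * The conditional probability of coalescence *)

Section CondProbUnique.
Context (R : realType) (d : measure_display) (Omega : measurableType d).
Variable P : probability Omega R.

(** Two versions of a conditional probability agree almost surely: each of the
    two events on which one exceeds the other belongs to the conditioning
    sigma-algebra, and both versions have the same integral over it. *)
Lemma cond_prob_unique (GG : set (set Omega)) (E : set Omega) (Y Z : Omega -> R) :
  GG `<=` measurable -> is_cond_prob P <<s GG >> E Y -> is_cond_prob P <<s GG >> E Z ->
  {ae P, forall w, Y w = Z w}.
Proof.
move=> Gm HY HZ.
have sub : <<s GG >> `<=` measurable.
  by apply: smallest_sub => //; exact: sigma_algebra_measurable.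
have half (Y1 Y2 : Omega -> R) : is_cond_prob P <<s GG >> E Y1 -> is_cond_prob P <<s GG >> E Y2 ->
    {ae P, forall w, Y1 w <= Y2 w}.
  move=> [m1 i1 v1] [m2 i2 v2].
  pose A := [set w | Y2 w < Y1 w].
  have GA : <<s GG >> A.
    have mf (f : Omega -> R) : (forall B : set R, measurable B -> <<s GG >> (f @^-1` B)) ->
        measurable_fun [set: g_sigma_algebraType GG] (f : g_sigma_algebraType GG -> R).
      by move=> mf _ B mB; rewrite setTI; exact: mf.
    have := measurable_fun_ltr (mf _ m2) (mf _ m1).
    by move=> /(_ measurableT [set true] I); rewrite setTI.
  have mA := sub _ GA.
  have i1A : P.-integrable A (EFin \o Y1) by exact: integrableS i1.
  have i2A : P.-integrable A (EFin \o Y2) by exact: integrableS i2.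
  have zero : (\int[P]_(w in A) `|(Y1 w - Y2 w)%:E| = 0)%E.
    transitivity (\int[P]_(w in A) ((EFin \o Y1) w - (EFin \o Y2) w))%E.
      apply: eq_integral => w /set_mem Aw; rewrite gee0_abs ?EFinB //.
      by rewrite lee_fin subr_ge0 ltW.
    rewrite integralB // v1 // v2 // subee //.
    by rewrite -(v1 A GA); exact: integrable_fin_num.
  have mY : measurable_fun A (fun w => (Y1 w - Y2 w)%:E).
    have [/measurable_EFinP h1 _] := integrableP _ _ _ i1A.
    have [/measurable_EFinP h2 _] := integrableP _ _ _ i2A.
    by apply: measurable_EFin_fun; exact: measurable_funB.
  have := (ae_eq_integral_abs P mA mY).1 zero.
  apply: filterS => w H; rewrite leNgt; apply/negP => lt12.
  have [/eqP] := H lt12; rewrite subr_eq0 => /eqP E12.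
  by rewrite E12 ltxx in lt12.
by move: (half _ _ HY HZ) (half _ _ HZ HY); apply: filterS2 => w h1 h2; apply/eqP; rewrite eq_le h1.
Qed.

Lemma eseries_finite_support (f : nat -> \bar R) (N : nat) :
  (forall i, (N <= i)%N -> f i = 0%E) -> (\sum_(i <oo) f i = \sum_(i < N) f i)%E.
Proof.
move=> f0; apply: cvg_lim => //; apply: cvg_near_cst; near=> n.
have Nn : (N <= n)%N by near: n; exact: nbhs_infty_ge.
rewrite (big_cat_nat (n := N)) //= -[RHS]adde0; congr (_ + _)%E; first by rewrite big_mkord.
by rewrite big_nat_cond big1 // => i /andP[/andP[/f0]].
Unshelve. all: by end_near. Qed.

End CondProbUnique.

Section ConditionalCoalescence.
Context (R : realType) (d : measure_display) (Omega : measurableType d).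
Variables (P : probability Omega R).
Variables (imm : nat -> {RV P >-> nat}) (xi : nat -> nat -> {RV P >-> nat}).
Local Notation T := (process_tree imm xi).

Definition tree_generators : set (set Omega) :=
  [set A | (exists n k : nat, A = [set w | immigrants (T w) n = k]) \/
           (exists n j k : nat,
              A = [set w | (j < present (T w) n)%N /\ children (T w) n j = k])].

Lemma tree_generators_measurable : tree_generators `<=` measurable.
Proof.
move=> A [[n [k ->]]|[n [j [k ->]]]].
  exact: (measurable_RV_fiber (imm n) k).
apply: measurableI; last exact: (measurable_RV_fiber (xi n j) k).
have dp : determined n (fun t => (j < present t n)%N).
  by move=> t t' a; have [_ ->] := agree_born a (leqnn n).
by have /(_ measurableT [set true] I) := measurable_determined imm xi dp; rewrite setTI.
Qed.

Lemma tree_sigmaE : tree_sigma T = <<s tree_generators >>.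
Proof. by []. Qed.

Lemma tree_sigma_measurable (A : set Omega) : tree_sigma T A -> measurable A.
Proof.
apply: smallest_sub; first exact: sigma_algebra_measurable.
exact: tree_generators_measurable.
Qed.

(** A history only involves the children of individuals that are present, which
    the generators of the sigma-algebra of the tree record. *)
Lemma tree_sigma_history (n : nat) (B : set nat) :
  tree_sigma T ((fun w => history n (T w)) @^-1` B).
Proof.
rewrite tree_sigmaE.
pose TT := g_sigma_algebraType tree_generators.
have gen (A : set Omega) : tree_generators A -> measurable (A : set TT).
  by move=> GA; exact: sub_sigma_algebra.
have ev w : measurable (history_event imm xi n w : set TT).
  have -> : history_event imm xi n w =
     (\bigcap_(k : nat) (if (k <= n)%N then [set v | immigrants (T v) k = immigrants (T w) k] else setT)) `&`
     \bigcap_(k : nat) \bigcap_(j : nat) (if (k < n)%N && (j < present (T w) k)%N then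
       [set v | (j < present (T v) k)%N /\ children (T v) k j = children (T w) k j] else setT).
    apply/seteqP; split => v.
      move=> /history_eventP a; split => [k _|k _ j _]; case: ifP => //.
        by move=> kn; case: a => ai _; rewrite /= -[RHS]/(immigrants (T w) k) ai.
      move=> /andP[kn jp]; have [_ pE] := agree_born a (ltnW kn).
      by split; [rewrite -pE|case: a => _ ->].
    move=> [H1 H2]; apply/history_eventP; split => [k kn|k j kn jp].
      by have := H1 k I; rewrite kn => /= ->.
    by have := H2 k I j I; rewrite kn jp => -[_ ->].
  apply: measurableI; apply: bigcapT_measurable => k.
    by case: ifP => // kn; apply: gen; left; exists k, (immigrants (T w) k).
  apply: bigcapT_measurable => j; case: ifP => // _.
  by apply: gen; right; exists k, j, (children (T w) k j).
have : measurable (((fun w => history n (T w)) @^-1` B) : set TT); last by [].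
have -> : (fun w => history n (T w)) @^-1` B =
    \bigcup_(i in B) ((fun w => history n (T w)) @^-1` [set i]).
  by apply/seteqP; split => [w Bw|w [i Bi] /= Hi]; [exists (history n (T w))|rewrite -Hi in Bi].
apply: bigcup_measurable => i _.
case: (pselect (exists w, history n (T w) = i)) => [[w <-]|no]; first exact: ev.
rewrite (_ : _ @^-1` _ = set0) //.
by apply/seteqP; split => // w wi; case: no; exists w.
Qed.

Lemma tree_sigma_determined (n : nat) (A : Type) (F : family_tree -> A) (B : set A) :
  determined n F -> tree_sigma T ((fun w => F (T w)) @^-1` B).
Proof. by move=> dF; rewrite (determined_preimage _ _ B dF); exact: tree_sigma_history. Qed.

Variables (a b : nat -> {RV P >-> nat}).
Hypothesis hab : uniform_pairs T a b.

Definition coalesced (m n : nat) : set Omega :=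
  [set w | (m%:R%:E <= coalescence R (T w) n (a n w) (b n w) < +oo)%E].

Lemma determined_pair_ratio (m n : nat) : determined n (fun t => pair_ratio R m t n).
Proof.
move=> t t' ag; rewrite /pair_ratio (determined_related R m ag).
by have [->] := agree_born ag (leqnn n).
Qed.

Lemma measurable_coalesced (m n : nat) : (m <= n)%N -> measurable (coalesced m n).
Proof.
move=> mn.
have -> : coalesced m n = \bigcup_i \bigcup_j ((a n @^-1` [set i] `&` b n @^-1` [set j]) `&`
    [set w | founder (T w) m n i == founder (T w) m n j]).
  apply/seteqP; split => [w|w [i _ [j _ [[/= ai bj] ij]]]].
    rewrite /coalesced /= coalescence_founder // => H.
    by exists (a n w) => //; exists (b n w).
  by rewrite /coalesced /= coalescence_founder // ai bj.
apply: bigcupT_measurable => i; apply: bigcupT_measurable => j.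
apply: measurableI; first by apply: measurableI; exact: measurable_RV_fiber.
apply: tree_sigma_measurable.
apply: (tree_sigma_determined (n := n) (F := fun t => founder t m n i == founder t m n j) [set true]).
by move=> t t' ag; rewrite !(agree_founder _ _ ag).
Qed.

(** Given the tree, the sampled pair is uniform on the ordered pairs of distinct
    individuals of generation [n]; summing over the pairs with a common founder
    leaves the proportion of such pairs. *)
Lemma cond_prob_coalesced (m n : nat) : (2 <= n)%N -> (m <= n)%N ->
  is_cond_prob P (tree_sigma T) (coalesced m n) (fun w => pair_ratio R m (T w) n).
Proof.
move=> n2 mn; have dY := @determined_pair_ratio m n.
have mY : measurable_fun [set: Omega] (fun w => pair_ratio R m (T w) n).
  exact: (measurable_determined imm xi dY).
split => [B mB||A GA]; first exact: tree_sigma_determined dY.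
  apply: measurable_bounded_integrable => //.
    by rewrite (le_lt_trans (probability_le1 P measurableT)) ?ltry.
  exists 1; split; first by rewrite num_real.
  move=> x x1 w _ /=; have /andP[y0 y1] := pair_ratio_bounds R m (T w) n.
  by rewrite ger0_norm // (le_trans y1) // ltW.
have mA := tree_sigma_measurable GA.
pose rat w i j : R := if [&& i != j, i < born (T w) n & j < born (T w) n]%N
  then ((born (T w) n * (born (T w) n).-1)%:R)^-1 else 0.
pose C i j := [set w | founder (T w) m n i == founder (T w) m n j].
pose y i j w : R := (w \in C i j)%:R * rat w i j.
have dy i j : determined n (fun t => (founder t m n i == founder t m n j)%:R *
    (if [&& i != j, i < born t n & j < born t n]%N
     then ((born t n * (born t n).-1)%:R)^-1 else 0) : R).
  move=> t t' ag; rewrite !(agree_founder _ _ ag) //.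
  by have [->] := agree_born ag (leqnn n).
have yE i j w : y i j w = (founder (T w) m n i == founder (T w) m n j)%:R * rat w i j.
  rewrite /y (_ : (w \in C i j) = (founder (T w) m n i == founder (T w) m n j)) //.
  by apply/idP/idP => [/set_mem|H] //; exact/mem_set.
have my i j : measurable_fun [set: Omega] (y i j).
  by rewrite (funext (yE i j)); exact: (measurable_determined imm xi (dy i j)).
have rat0 w i j : 0 <= rat w i j by rewrite /rat; case: ifP.
have y0 i j w : 0 <= y i j w by rewrite mulr_ge0.
have sumy w : (\sum_(i <oo) \sum_(j <oo) (y i j w)%:E = (pair_ratio R m (T w) n)%:E)%E.
  have yout i j : ((born (T w) n <= i) || (born (T w) n <= j))%N -> y i j w = 0.
    rewrite yE /rat => /orP[|] h; rewrite [X in if X then _ else _](_ : _ = false) ?mulr0 //.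
      by rewrite ltnNge h andbF.
    by rewrite [(j < _)%N]ltnNge h !andbF.
  rewrite (@eseries_finite_support _ _ (born (T w) n)) => [|i iN]; last first.
    by apply: eseries0 => j _ _; rewrite yout ?iN.
  rewrite -pair_ratioE -sumEFin; apply: eq_bigr => i _.
  rewrite (@eseries_finite_support _ _ (born (T w) n)) => [|j jN]; last by rewrite yout ?jN ?orbT.
  rewrite -sumEFin; apply: eq_bigr => j _; rewrite yE /rat !ltn_ord !andbT; congr EFin.
  by case: ((i : nat) != j); rewrite ?mulr0 ?mul0r ?mul1r.
have intyS i : (\int[P]_(w in A) (\sum_(j <oo) (y i j w)%:E) = \sum_(j <oo) \int[P]_(w in A) (y i j w)%:E)%E.
  rewrite integral_nneseries // => j; last by move=> w _; rewrite lee_fin.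
  by apply: measurable_funTS; exact: measurable_EFin_fun.
transitivity (\sum_(i <oo) \sum_(j <oo) \int[P]_(w in A) (y i j w)%:E)%E.
  under eq_integral do rewrite -sumy.
  rewrite integral_nneseries //.
  - by apply: eq_eseriesr => i _; exact: intyS.
  - move=> i; apply: measurable_funTS; apply: ge0_emeasurable_sum => j *; last exact: measurable_EFin_fun.
    by rewrite lee_fin.
  - by move=> i w _; apply: nneseries_ge0 => j _ _; rewrite lee_fin.
have mE := measurable_coalesced mn.
have mEA : measurable (coalesced m n `&` A) by exact: measurableI.
rewrite -[RHS]mul1e -(integral_cst P mEA 1%E) (@integral_fibers _ _ _ P _ (a n)) //.
apply: eq_eseriesr => i _.
rewrite (@integral_fibers _ _ _ P _ (b n)) //; last first.
  by apply: measurableI => //; exact: measurable_RV_fiber.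
apply: eq_eseriesr => j _.
have mC : tree_sigma T (C i j).
  apply: (tree_sigma_determined (n := n) (F := fun t => founder t m n i == founder t m n j) [set true]).
  by move=> t t' ag; rewrite !(agree_founder _ _ ag).
have GAC : tree_sigma T (A `&` C i j).
  have : measurable ((A `&` C i j) : set (g_sigma_algebraType tree_generators)) by exact: measurableI.
  by [].
have [_ _ /(_ _ GAC)] := hab i j n2.
rewrite integral_cst; last first.
  by apply: measurableI; [apply: measurableI|] => //; exact: measurable_RV_fiber.
rewrite mul1e => H.
have -> : coalesced m n `&` A `&` a n @^-1` [set i] `&` b n @^-1` [set j] =
    [set w | a n w = i /\ b n w = j] `&` (A `&` C i j).
  apply/seteqP; split => [w [[[Ew Aw] /= ai] bj]|w [[/= ai bj] [Aw Cw]]].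
    by split => //; split => //; move: Ew; rewrite /coalesced /C /= coalescence_founder // ai bj.
  by split => //; split => //; split => //; rewrite /coalesced /= coalescence_founder // ai bj.
apply: (etrans _ H); rewrite [RHS]integral_mkcondr; apply: eq_integral => w _.
by rewrite patchE /y; case: ifP => _; rewrite ?mul1r ?mul0r.
Qed.

End ConditionalCoalescence.

(** * Convergence of the coalescence probability *)

Section OffspringMoments.
Context (R : realType) (d : measure_display) (Omega : measurableType d).
Variables (P : probability Omega R) (M : {RV P >-> nat}).

Lemma pgf_deriv1_mean : pgf_deriv1 M 1 = (\int[P]_w (M w)%:R%:E)%E.
Proof. by rewrite pgf_deriv1E; under eq_integral do rewrite ffactn1. Qed.

Variable mu : R.
Hypothesis M1 : (\int[P]_w (M w)%:R%:E = mu%:E)%E.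

(** The number [s2] is the variance, hence nonnegative. *)
Lemma second_moment : (pgf_deriv1 M 2 < +oo)%E ->
  exists2 s2 : R, 0 <= s2 & (\int[P]_w ((M w)%:R ^+ 2)%:E = (s2 + mu ^+ 2)%:E)%E.
Proof.
rewrite pgf_deriv1E => f2.
have sqE : (\int[P]_w ((M w)%:R ^+ 2)%:E = \int[P]_w (M w ^_ 2)%:R%:E + mu%:E)%E.
  rewrite -M1 -ge0_integralD //; first last.
  - exact: (emeasurable_nat_fun M (fun k => k%:R)).
  - exact: (emeasurable_nat_fun M (fun k => (k ^_ 2)%:R)).
  apply: eq_integral => w _; rewrite -EFinD -natrD -natrX; congr (_%:R%:E).
  by case: (M w) => [|k] //; rewrite ffactnS ffactn1 /=; lia.
have f20 : (0 <= \int[P]_w (M w ^_ 2)%:R%:E)%E by apply: integral_ge0.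
case E : (\int[P]_w (M w ^_ 2)%:R%:E)%E f2 f20 sqE => [v| |] // _ _ sqE.
exists (v + mu - mu ^+ 2); last by rewrite subrK sqE.
have mM : mean_on P setT (fun w => (M w)%:R) mu.
  by apply: mean_on_ge0 => //; exact: (measurable_nat_fun M (fun k => k%:R)).
have mM2 : mean_on P setT (fun w => (M w)%:R ^+ 2) (v + mu).
  apply: mean_on_ge0 => //; first exact: (measurable_nat_fun M (fun k => k%:R ^+ 2)).
have [_ vE] := mean_onD measurableT mM2 (mean_onD measurableT
  (mean_onZ measurableT (- (2 * mu)) mM) (mean_on_cst P measurableT (mu ^+ 2))).
rewrite probability_setT mulr1 in vE.
have -> : v + mu - mu ^+ 2 = v + mu + (- (2 * mu) * mu + mu ^+ 2) by ring.
rewrite -lee_fin -vE; apply: integral_ge0 => w _; rewrite lee_fin /=.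
have -> : (M w)%:R ^+ 2 + (- (2 * mu) * (M w)%:R + mu ^+ 2) = ((M w)%:R - mu) ^+ 2 by ring.
exact: sqr_ge0.
Qed.

End OffspringMoments.

Section Limits.
Context (R : realType) (d : measure_display) (Omega : measurableType d).
Variables (P : probability Omega R) (M I : {RV P >-> nat}).
Variables (imm : nat -> {RV P >-> nat}) (xi : nat -> nat -> {RV P >-> nat}).
Hypothesis himm : forall n, same_law (imm n) I.
Hypothesis hxi : forall n j, same_law (xi n j) M.
Hypothesis hind : mutually_independent (all_variables imm xi).
Variables (mu s2 EI : R).
Hypotheses (mu1 : 1 < mu) (s20 : 0 <= s2).
Hypothesis M1 : (\int[P]_w (M w)%:R%:E = mu%:E)%E.
Hypothesis M2 : (\int[P]_w ((M w)%:R ^+ 2)%:E = (s2 + mu ^+ 2)%:E)%E.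
Hypothesis I1 : (\int[P]_w (I w)%:R%:E = EI%:E)%E.
Hypothesis M0 : P [set w | M w = 0%N] = 0.
Hypothesis I0 : P [set w | I w = 0%N] = 0.

Local Notation T := (process_tree imm xi).

Let mu_gt0 : 0 < mu. Proof. exact: lt_trans mu1. Qed.

Let mdet (n : nat) (F : family_tree -> R) :
  determined n F -> measurable_fun [set: Omega] (fun w => F (T w)).
Proof. exact: measurable_determined. Qed.

Lemma ae_cvg_descendants (m l : nat) :
  {ae P, forall w, cvgn (fun n => (descendants (T w) m l n)%:R / mu ^+ n : R)}.
Proof.
pose sel (t : family_tree) (n j : nat) := ancestor t n j m == Some l.
have ds n : determined n (fun t => sel t n).
  by move=> t t' a; apply/funext => j; rewrite /sel (agree_ancestor _ _ a).
have hs t n c : (m <= n)%N -> (c < born t n.+1)%N -> sel t n.+1 c = sel t n (parent t n c).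
  by move=> mn cb; rewrite /sel ancestorS.
have hb : (\int[P]_w (born_sel R sel m (T w))%:E <= (mu ^+ m * imm_const mu EI)%:E)%E.
  apply: le_trans (integral_born himm hxi hind mu1 M1 I1 m); apply: ge0_le_integral => //.
  - by move=> w _; rewrite lee_fin born_sel_ge0.
  - apply: measurable_EFin_fun; apply: (measurable_determined imm xi).
    exact: (determined_born_sel R ds).
  - apply: measurable_EFin_fun; apply: (@mdet m (fun t => (born t m)%:R)) => t t' a.
    by have [-> _] := agree_born a (leqnn m).
  - move=> w _; rewrite lee_fin /born_sel.
    rewrite (_ : (born _ _)%:R = \sum_(c < born (T w) m) (1 : R)); last by rewrite sumr_const card_ord.
    by apply: ler_sum => c _; case: (sel _ _ _).
have := cvg_born_sel himm hxi hind mu1 s20 M1 M2 I1 ds hs hb.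
apply: filterS => w.
by under eq_fun do rewrite /born_sel -descendantsE.
Qed.

Lemma ae_cvg_born : {ae P, forall w, cvgn (fun n => (born (T w) n)%:R / mu ^+ n : R)}.
Proof.
pose sel (t : family_tree) (n j : nat) := true.
have hb : (\int[P]_w (born_sel R sel 0 (T w))%:E <= 0%:E)%E.
  by under eq_integral do rewrite /born_sel big_ord0; rewrite integral0.
have := @cvg_born_sel _ _ _ P M I imm xi himm hxi hind mu s2 EI mu1 s20 M1 M2 I1 sel 0
  (fun _ _ _ _ => erefl) (fun _ _ _ _ _ => erefl) 0 hb.
apply: filterS => w.
by under eq_fun do rewrite /born_sel sumr_const card_ord.
Qed.

Lemma later_le_born (t : family_tree) (n : nat) : born_sel R later n t <= (born t n)%:R.
Proof.
rewrite (_ : (born _ _)%:R = \sum_(c < born t n) (1 : R)); last by rewrite sumr_const card_ord.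
by apply: ler_sum => c _; case: (later _ _ _).
Qed.

Lemma ae_cvg_later : {ae P, forall w, cvgn (fun n => born_sel R later n (T w) / mu ^+ n)}.
Proof.
apply: (@cvg_born_sel _ _ _ P M I imm xi himm hxi hind mu s2 EI mu1 s20 M1 M2 I1 later 0
    determined_later (@later_parent 0) 0).
by under eq_integral do rewrite /born_sel big_ord0; rewrite integral0.
Qed.

Definition born_limit (w : Omega) : R := limn (fun n => (born (T w) n)%:R / mu ^+ n).
Definition related_limit (m : nat) (w : Omega) : R :=
  limn (fun n => related R (T w) m n / (mu ^+ 2) ^+ n).

(** Only countably many limits are involved, so that they exist together on one
    event of probability one. *)
Lemma ae_limit_ratio : {ae P, forall w,
  [/\ 0 < born_limit w,
      forall m, limit_ratio mu (T w) m = related_limit m w / born_limit w ^+ 2 &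
      forall m, pair_ratio R m (T w) n @[n --> \oo] --> limit_ratio mu (T w) m]}.
Proof.
have cR := ae_foralln (fun m => cvg_related himm hxi hind mu1 s20 M1 M2 I1 m).
have cD := ae_foralln (fun m => ae_foralln (ae_cvg_descendants m)).
have pos := ae_later_pos himm hxi hind mu1 s20 M1 M2 I1 M0 I0.
have good1 : {ae P, forall w, 0 < born_limit w}.
  move: ae_cvg_born ae_cvg_later pos; apply: filterS3 => w cb cl.
  move=> /lt_le_trans; apply; apply: ler_lim => //; apply: nearW => n.
  by rewrite ler_wpM2r ?later_le_born // invr_ge0 exprn_ge0 // ltW.
have good2 : {ae P, forall w, (forall m, cvgn (fun n => related R (T w) m n / (mu ^+ 2) ^+ n)) /\
    (forall m l, cvgn (fun n => (descendants (T w) m l n)%:R / mu ^+ n : R))}.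
  by move: cR cD; apply: filterS2.
move: ae_cvg_born good1 good2; apply: filterS3 => w cb pb [cr cd].
have ratE m : limit_ratio mu (T w) m = related_limit m w / born_limit w ^+ 2.
  exact: (limit_ratioE mu1 cb (cr m) (cd m)).
split => // m; rewrite ratE; apply: (pair_ratio_cvg mu1 cb (cr m)).
by rewrite gt_eqF.
Qed.

(** The sums have a random number of terms, which is handled by the fibres of that
    number. *)
Lemma measurable_limit_ratio (m : nat) :
  measurable_fun [set: Omega] (fun w => limit_ratio mu (T w) m).
Proof.
have md k l n : measurable_fun [set: Omega] (fun w => (descendants (T w) k l n)%:R : R).
  apply: (@mdet n (fun t => (descendants t k l n)%:R)) => t t' a.
  rewrite !descendantsE; have [-> _] := agree_born a (leqnn n).
  by apply: eq_bigr => c _; rewrite (agree_ancestor _ _ a).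
have mi k l n : measurable_fun [set: Omega] (fun w => (imm_descendants (T w) k l n)%:R : R).
  apply: (measurable_fibers (H := fun w => born (T w) k)
     (F := fun i w => (descendants (T w) k (i + l)%N n)%:R : R)) => [|i]; last exact: md.
  apply: (@measurable_determined _ _ _ _ imm xi k _ _ (born ^~ k)) => t t' a.
  by have [-> _] := agree_born a (leqnn k).
have mW l : measurable_fun [set: Omega] (fun w => W_ mu (T w) m l).
  by apply: measurable_limn => n; apply: measurable_funM.
have mimm k (g : nat -> nat -> Omega -> R) : (forall i, measurable_fun [set: Omega] (g k i)) ->
    measurable_fun [set: Omega] (fun w => \sum_(l < immigrants (T w) k) g k l w).
  move=> mg; apply: (measurable_fibers (H := fun w => immigrants (T w) k)
     (F := fun i w => \sum_(l < i) g k l w : R)) => [|i]; last exact: measurable_sum.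
  exact: (measurable_funPT (imm k)).
have mX : measurable_fun [set: Omega] (fun w => X_ mu (T w) m).
  apply: measurable_limn => n; apply: measurable_funM => //.
  by apply: measurable_sum => k; apply: (mimm k (fun k l w => (imm_descendants (T w) k l n)%:R)).
have mV : measurable_fun [set: Omega] (fun w => V_ mu (T w) m).
  apply: measurable_limn => n; apply: measurable_funM => //.
  apply: measurable_sum => k; apply: (mimm k (fun k l w => (imm_descendants (T w) k l n)%:R ^+ 2)) => i.
  exact: measurable_funX.
have mB : measurable_fun [set: Omega] (fun w => born (T w) m).
  apply: (@measurable_determined _ _ _ _ imm xi m _ _ (born ^~ m)) => t t' a.
  by have [-> _] := agree_born a (leqnn m).
apply: measurable_funM.
  apply: measurable_funD => //.
  apply: (measurable_fibers (H := fun w => born (T w) m)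
    (F := fun i w => \sum_(l < i) W_ mu (T w) m l ^+ 2 : R)) => // i.
  by apply: measurable_sum => l; exact: measurable_funX.
(* The inverse of a square is a power with exponent -1, also at 0. *)
under eq_fun do rewrite -(powR_inv1 (sqr_ge0 _)).
apply: (measurableT_comp (measurable_powR (-1))).
apply: measurable_funX; apply: measurable_funD => //.
apply: (measurable_fibers (H := fun w => born (T w) m)
  (F := fun i w => \sum_(l < i) W_ mu (T w) m l : R)) => // i.
by apply: measurable_sum => l.
Qed.

Lemma integral_pair_ratio_cvg (m : nat) :
  (\int[P]_w (pair_ratio R m (T w) n)%:E @[n --> \oo] -->
   \int[P]_w (limit_ratio mu (T w) m)%:E)%E.
Proof.
have mf n : measurable_fun [set: Omega] (fun w => (pair_ratio R m (T w) n)%:E).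
  by apply: measurable_EFin_fun; exact: (mdet (@determined_pair_ratio R m n)).
have ml : measurable_fun [set: Omega] (fun w => (limit_ratio mu (T w) m)%:E).
  by apply: measurable_EFin_fun; exact: measurable_limit_ratio.
have [] // := @dominated_convergence _ _ _ P setT measurableT _ _ (cst 1%E) mf ml.
- move: ae_limit_ratio; apply: filterS => w [_ _ /(_ m) c] _.
  by apply: cvg_EFin => //; exact: nearW.
- exact: finite_measure_integrable_cst.
- apply: aeW => w n _; have /andP[r0 r1] := pair_ratio_bounds R m (T w) n.
  by rewrite /= ger0_norm // lee_fin.
Qed.

(** A descendant of the first immigrant and an individual whose line starts
    later have different founders. *)
Lemma unrelated_pairs (t : family_tree) (n : nat) :
  related R t 0 n + 2 * (born_sel R first_line n t * born_sel R later n t) <= (born t n)%:R ^+ 2.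
Proof.
have -> : 2 * (born_sel R first_line n t * born_sel R later n t) =
    \sum_(i < born t n) \sum_(j < born t n)
      ((first_line t n i)%:R * (later t n j)%:R + (later t n i)%:R * (first_line t n j)%:R).
  rewrite mulrDl mul1r {2}mulrC /born_sel !mulr_suml -big_split; apply: eq_bigr => i _.
  by rewrite !mulr_sumr -big_split.
have -> : (born t n)%:R ^+ 2 = \sum_(i < born t n) \sum_(j < born t n) (1 : R).
  by rewrite !sumr_const !card_ord -[RHS]mulr_natl expr2.
rewrite /related -big_split; apply: ler_sum => i _.
rewrite -big_split; apply: ler_sum => j _ /=.
have fl k : first_line t n k = (founder t 0 n k == (0%N, 0%N)).
  by rewrite /first_line founder_eq //; left.
rewrite /later; case: (eqVneq (founder t 0 n i) (founder t 0 n j)) => E.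
  have key : (ancestor t n i 0 == None) = (ancestor t n j 0 == None).
    have H k : (ancestor t n k 0 == None) = ((founder t 0 n k).1 != 0)%N.
      have [_ anc _] := founderP t k (leq0n n).
      case: (eqVneq (founder t 0 n k).1 0%N) => [E0|NE] /=; first by rewrite -E0 anc.
      case E1 : (ancestor t n k 0) => [e|] //.
      by move: NE; rewrite (founder_ancestor (isT : (0 <= 0 <= n)%N) E1) founder_refl.
    by rewrite !H E.
  have nofl k : first_line t n k -> ancestor t n k 0 == None = false.
    by rewrite /first_line => /eqP ->.
  have := nofl i; have := nofl j; rewrite !fl E key.
  by case: (_ == (0%N, 0%N)); case: (ancestor t n j 0 == None) => //= *; try lra; 
    exfalso; intuition.
have nofl k : first_line t n k -> ancestor t n k 0 == None = false.
  by rewrite /first_line => /eqP ->.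
have := nofl i; have := nofl j.
case: (first_line t n i); case: (first_line t n j);
case: (ancestor t n i 0 == None); case: (ancestor t n j 0 == None) => //= h1 h2; try lra; try (by have := h1 isT); by have := h2 isT.
Qed.

(** Passing to the limit in [unrelated_pairs], equality forces the line of the
    first immigrant or the later lines to grow slower than [mu ^+ n]; but the
    later lines almost surely do not, and [first_line_not_extinct] excludes the
    former. *)
Lemma related_limit_lt :
  ~ {ae P, forall w, related_limit 0 w = born_limit w ^+ 2}.
Proof.
move=> eqRN; apply: (first_line_not_extinct himm hxi hind mu1 s20 M1 M2 I1 M0 I0).
have pos := ae_later_pos himm hxi hind mu1 s20 M1 M2 I1 M0 I0.
have cR := cvg_related himm hxi hind mu1 s20 M1 M2 I1 0.
have good : {ae P, forall w, [/\ cvgn (fun n => (born (T w) n)%:R / mu ^+ n : R),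
    cvgn (fun n => born_sel R later n (T w) / mu ^+ n) &
    cvgn (fun n => (descendants (T w) 0 0 n)%:R / mu ^+ n : R)]}.
  by move: ae_cvg_born ae_cvg_later (ae_cvg_descendants 0 0); apply: filterS3.
have good2 : {ae P, forall w, 0 < limn (fun n => born_sel R later n (T w) / mu ^+ n) /\
   cvgn (fun n => related R (T w) 0 n / (mu ^+ 2) ^+ n)}.
  by move: pos cR; apply: filterS2.
move: eqRN good good2; apply: filterS3 => w EQ [cb cl cf] [pl cr].
pose f n := born_sel R first_line n (T w) / mu ^+ n.
have {}cf : cvgn f.
  by move: cf; under eq_fun do rewrite descendantsE.
suff f0 : limn f = 0 by rewrite -f0.
have f_ge0 : 0 <= limn f.
  by apply: limr_ge => //; apply: nearW => n; rewrite divr_ge0 ?born_sel_ge0 ?exprn_ge0 // ltW.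
set u := fun n => born_sel R later n (T w) / mu ^+ n in cl pl.
have : related_limit 0 w + 2 * (limn f * limn u) <= born_limit w ^+ 2.
  pose x n := related R (T w) 0 n / (mu ^+ 2) ^+ n + 2 * (f n * u n).
  pose y n := ((born (T w) n)%:R / mu ^+ n) * ((born (T w) n)%:R / mu ^+ n) : R.
  have cx : x n @[n --> \oo] --> related_limit 0 w + 2 * (limn f * limn u).
    by apply: cvgD => //; apply: cvgMr; apply: cvgM.
  have cy : y n @[n --> \oo] --> born_limit w ^+ 2 by rewrite expr2; apply: cvgM.
  rewrite -(cvg_lim _ cx) // -(cvg_lim _ cy) //; apply: ler_lim.
  - by apply/cvg_ex; eexists; exact: cx.
  - by apply/cvg_ex; eexists; exact: cy.
  apply: nearW => n; have mn0 : mu ^+ n != 0 by rewrite expf_neq0 // gt_eqF.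
  have -> : x n = (related R (T w) 0 n +
      2 * (born_sel R first_line n (T w) * born_sel R later n (T w))) / (mu ^+ n * mu ^+ n).
    by rewrite /x /f /u -exprM mulnC exprM expr2; field.
  have -> : y n = (born (T w) n)%:R ^+ 2 / (mu ^+ n * mu ^+ n) by rewrite /y; field.
  by rewrite ler_wpM2r ?unrelated_pairs // invr_ge0 mulr_ge0 // exprn_ge0 // ltW.
rewrite EQ gerDl pmulr_rle0 // pmulr_lle0 // => f_le0.
by apply/eqP; rewrite eq_le f_le0.
Qed.

(** The ratio is at most one, so a mean equal to one would make it one almost
    surely. *)
Lemma integral_limit_ratio_lt1 : (\int[P]_w (limit_ratio mu (T w) 0)%:E < 1)%E.
Proof.
pose f w : R := Num.max 0 (Num.min 1 (limit_ratio mu (T w) 0)).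
have f01 w : 0 <= f w <= 1.
  by rewrite /f le_max lexx /= ge_max ler01 ge_min lexx.
have mf : measurable_fun [set: Omega] f.
  apply: measurable_maxr => //; apply: measurable_minr => //.
  exact: measurable_limit_ratio.
have fE : {ae P, forall w, f w = limit_ratio mu (T w) 0}.
  move: ae_limit_ratio; apply: filterS => w [_ _ /(_ 0%N) c].
  have l0 : 0 <= limit_ratio mu (T w) 0.
    rewrite -(cvg_lim _ c) //; apply: limr_ge; first by apply/cvg_ex; eexists; exact: c.
    by apply: nearW => n; have /andP[] := pair_ratio_bounds R 0 (T w) n.
  have l1 : limit_ratio mu (T w) 0 <= 1.
    rewrite -(cvg_lim _ c) //; apply: limr_le; first by apply/cvg_ex; eexists; exact: c.
    by apply: nearW => n; have /andP[] := pair_ratio_bounds R 0 (T w) n.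
  by rewrite /f (min_r l1) (max_r l0).
have -> : (\int[P]_w (limit_ratio mu (T w) 0)%:E = \int[P]_w (f w)%:E)%E.
  apply: ae_eq_integral => //; try by apply: measurable_EFin_fun => //; exact: measurable_limit_ratio.
  by move: fE; apply: filterS => w -> _.
have m1f : measurable_fun [set: Omega] (fun w => (1 - f w)%:E).
  by apply: measurable_EFin_fun; exact: measurable_funB.
have sum1 : (\int[P]_w (f w)%:E + \int[P]_w (1 - f w)%:E = 1)%E.
  rewrite -ge0_integralD //; first last.
  - by move=> w _; rewrite lee_fin subr_ge0; case/andP: (f01 w).
  - exact: measurable_EFin_fun.
  - by move=> w _; rewrite lee_fin; case/andP: (f01 w).
  rewrite -[RHS](@probability_setT _ _ _ P) -[RHS]mul1e -(integral_cst P measurableT 1%E).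
  by apply: eq_integral => w _; rewrite -EFinD addrC subrK.
have g0 : (0 <= \int[P]_w (1 - f w)%:E)%E.
  by apply: integral_ge0 => w _; rewrite lee_fin subr_ge0; case/andP: (f01 w).
have If0 : (0 <= \int[P]_w (f w)%:E)%E.
  by apply: integral_ge0 => w _; rewrite lee_fin; case/andP: (f01 w).
rewrite ltNge; apply/negP => f_ge1.
have gE : (\int[P]_w (1 - f w)%:E = 0)%E.
  apply/eqP; rewrite eq_le g0 andbT; move: sum1 f_ge1 g0.
  case: (\int[P]_w (f w)%:E)%E => [x| |] //; case: (\int[P]_w (1 - f w)%:E)%E => [y| |] //.
  by rewrite -EFinD => -[xy]; rewrite !lee_fin; lra.
apply: related_limit_lt.
have : {ae P, forall w, f w = 1}.
  have := (ae_eq_integral_abs P measurableT m1f).1.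
  rewrite (eq_integral (fun w => (1 - f w)%:E)) ?gE => [/(_ erefl)|w _]; last first.
    by rewrite gee0_abs // lee_fin subr_ge0; case/andP: (f01 w).
  by apply: filterS => w /(_ Logic.I) [/eqP]; rewrite subr_eq0 => /eqP <-.
move: fE ae_limit_ratio; apply: filterS3 => w -> [b0 rE _].
by rewrite rE => /(congr1 ( *%R^~ (born_limit w ^+ 2))); rewrite divfK ?mul1r // gt_eqF // exprn_gt0.
Qed.

End Limits.

Lemma coalescence_ge0 (R : realType) (t : family_tree) (n a b : nat) :
  (0 <= coalescence R t n a b)%E.
Proof. by rewrite /coalescence; case: ifP => // _; rewrite lee_fin. Qed.

Lemma limit_ratio0 (R : realType) (mu : R) (t : family_tree) :
  limit_ratio mu t 0 = V_ mu t 0 / X_ mu t 0 ^+ 2.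
Proof. by rewrite /limit_ratio !big_ord0 !add0r. Qed.

Theorem theorem2 (R : realType) (d : measure_display) (Omega : measurableType d)
  (P : probability Omega R)
  (M I : {RV P >-> nat})
  (imm : nat -> {RV P >-> nat}) (xi : nat -> nat -> {RV P >-> nat})
  (himm : forall n, same_law (imm n) I)
  (hxi : forall n j, same_law (xi n j) M)
  (hind : mutually_independent (all_variables imm xi))
  (a b : nat -> {RV P >-> nat})
  (hab : uniform_pairs (process_tree imm xi) a b)
  (f0 : pgf M 0 = 0) (g0 : pgf I 0 = 0)
  (mu : R) (hmu : pgf_deriv1 M 1 = mu%:E) (mu_gt1 : 1 < mu)
  (g1 : (pgf_deriv1 I 1 < +oo)%E) (f2 : (pgf_deriv1 M 2 < +oo)%E) :
  let T := process_tree imm xi in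
  let X21 n w : \bar R := coalescence R (T w) n (a n w) (b n w) in
  [/\ forall cp : nat -> nat -> Omega -> R,
        (forall m n, (2 <= n)%N ->
           is_cond_prob P (tree_sigma T)
             [set w | (m%:R%:E <= X21 n w < +oo)%E] (cp m n)) ->
        {ae P, forall w, forall m,
           cp m n w @[n --> \oo] --> limit_ratio mu (T w) m},
      forall m : nat,
        P [set w | (m%:R%:E <= X21 n w < +oo)%E] @[n --> \oo]
          --> ('E_P[fun w => limit_ratio mu (T w) m])%E,
      P [set w | (X21 n w < +oo)%E] @[n --> \oo]
          --> ('E_P[fun w => (V_ mu (T w) 0 / X_ mu (T w) 0 ^+ 2)%R])%E &
      ('E_P[fun w => (V_ mu (T w) 0 / X_ mu (T w) 0 ^+ 2)%R] < 1)%E].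
Proof.
move=> T X21.
have M1 : (\int[P]_w (M w)%:R%:E = mu%:E)%E by rewrite -pgf_deriv1_mean.
have [s2 s20 M2] := second_moment M1 f2.
have I1 : (\int[P]_w (I w)%:R%:E = (fine (\int[P]_w (I w)%:R%:E))%:E)%E.
  rewrite pgf_deriv1_mean in g1; rewrite fineK // ge0_fin_numE //.
  by apply: integral_ge0 => w _; rewrite lee_fin.
have M0 := pgf0_eq0 f0; have I0 := pgf0_eq0 g0.
have lim_ae := ae_limit_ratio himm hxi hind mu_gt1 s20 M1 M2 I1 M0 I0.
have probE m n : (2 <= n)%N -> (m <= n)%N ->
    (P (coalesced imm xi a b m n) = \int[P]_w (pair_ratio R m (T w) n)%:E)%E.
  move=> n2 mn; have [_ _] := cond_prob_coalesced hab n2 mn.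
  move=> /(_ setT); rewrite setIT => <- //.
  exact: (@measurableT _ (g_sigma_algebraType (tree_generators imm xi))).
have lim_prob m : P (coalesced imm xi a b m n) @[n --> \oo] -->
    (\int[P]_w (limit_ratio mu (T w) m)%:E)%E.
  (* Sampling a pair takes [2 <= n], and founders are defined for [m <= n]. *)
  apply: (cvg_eq_from (k := maxn 2 m)) (integral_pair_ratio_cvg himm hxi hind mu_gt1
    s20 M1 M2 I1 M0 I0 (m := m)) => n.
  by rewrite geq_max => /andP[n2 mn]; exact: probE.
have expE : ('E_P[fun w => (V_ mu (T w) 0 / X_ mu (T w) 0 ^+ 2)%R] =
    \int[P]_w (limit_ratio mu (T w) 0)%:E)%E.
  by rewrite unlock; apply: eq_integral => w _; rewrite /= limit_ratio0.
split => [cp hcp|m||].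
- have cpE : {ae P, forall w, forall m n, (2 <= n)%N -> (m <= n)%N ->
      cp m n w = pair_ratio R m (T w) n}.
    apply: ae_foralln => m; apply: ae_foralln => n.
    case: (leqP 2 n) => n2; last exact: aeW.
    case: (leqP m n) => mn; last exact: aeW.
    have := cond_prob_unique (@tree_generators_measurable _ _ _ P imm xi)
      (hcp m n n2) (cond_prob_coalesced hab n2 mn).
    by apply: filterS.
  move: cpE lim_ae; apply: filterS2 => w cpE [_ _ lr] m.
  apply: (cvg_eq_from (k := maxn 2 m)) (lr m) => n.
  by rewrite geq_max => /andP[n2 mn]; exact: cpE.
- by rewrite unlock; exact: lim_prob.
- rewrite expE; apply: (cvg_eq_from (k := 0)) (lim_prob 0%N) => n _.
  congr (P _); apply/seteqP; split => w /=; rewrite /coalesced /=; last by case/andP.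
  by rewrite coalescence_ge0.
- by rewrite expE; apply: (integral_limit_ratio_lt1 himm hxi hind mu_gt1 s20 M1 M2 I1 M0 I0).
Qed.
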